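(* For $1\le i\le r$ (i.e. for $i$ in the set of representatives of $\tau$-orbits in $\mathbb I_0$), we have $$\mathbf T_i|_{\widetilde{\mathbf U}^\imath_{[i]}}=\aleph_i\circ\dot{\mathbf T}_1\circ\aleph_i^{-1},\qquad\mathbf T_{\varpi_i}|_{\widetilde{\mathbf U}^\imath_{[i]}}=\aleph_i\circ\dot{\mathbf T}_{\varpi_1}\circ\aleph_i^{-1}.$$
   Context: **Setting.** Fix an integer $r\ge1$. Let $\mathbb I=\{0,1,\dots,2r\}$, $\mathbb I_0=\{1,\dots,2r\}$, and let $(c_{ij})_{i,j\in\mathbb I}$ be the affine Cartan matrix of type $A^{(1)}_{2r}$: $c_{ii}=2$, $c_{ij}=-1$ if $i-j\equiv\pm1\pmod{2r+1}$, $c_{ij}=0$ otherwise. Let $\tau$ be the involution of $\mathbb I$ with $\tau 0=0$, $\tau i=2r+1-i$ for $i\in\mathbb I_0$; thus $c_{0,\tau 0}=2$, $c_{i,\tau i}=-1$ for $i\in\{r,r+1\}$, $c_{i,\tau i}=0$ otherwise. Let $v$ be an indeterminate, $[n]=\frac{v^n-v^{-n}}{v-v^{-1}}$, $[a,b]_q=ab-q\,ba$, $[a,b]=[a,b]_1$. **The algebra $\widetilde{\mathbf U}^\imath$** (affine iquantum group of type AIII$_{2r}^{(\tau)}$) is the $\mathbb Q(v)$-algebra with generators $B_i,\mathbb K_i^{\pm1}$ ($i\in\mathbb I$) and relations: $\mathbb K_i\mathbb K_i^{-1}=\mathbb K_i^{-1}\mathbb K_i=1$; $\mathbb K_i\mathbb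 K_\ell=\mathbb K_\ell\mathbb K_i$; $\mathbb K_\ell B_i=v^{c_{\tau\ell,i}-c_{\ell i}}B_i\mathbb K_\ell$; $B_iB_j=B_jB_i$ if $c_{ij}=0$, $j\ne\tau i$; $B_i^2B_j-[2]B_iB_jB_i+B_jB_i^2=0$ if $c_{ij}=-1$, $j\neq\tau i\ne i$; $B_{\tau i}B_i-B_iB_{\tau i}=\frac{\mathbb K_i-\mathbb K_{\tau i}}{v-v^{-1}}$ if $c_{i,\tau i}=0$; $B_i^2B_j-[2]B_iB_jB_i+B_jB_i^2=-v^{-1}B_j\mathbb K_i$ if $c_{ij}=-1$, $\tau i=i$; $B_i^2B_{\tau i}-[2]B_iB_{\tau i}B_i+B_{\tau i}B_i^2=-[2](v\mathbb K_iB_i+vB_i\mathbb K_{\tau i})$ if $c_{i,\tau i}=-1$. **Symmetries.** The following known formulas define algebra automorphisms $\mathbf T_i$ ($0\le i\le r$) of $\widetilde{\mathbf U}^\imath$ satisfying the braid relations of the Coxeter group $W_\tau$ below; set $\mathbf T_{\tau i}=\mathbf T_i$. - $\mathbf T_0(\mathbb K_j)=\mathbb K_j\mathbb K_0^{-c_{0j}}$; $\mathbf T_0(B_0)=\mathbb K_0^{-1}B_0$; $\mathbf T_0(B_j)=B_jB_0-vB_0B_j$ if $c_{0j}=-1$; $\mathbf T_0(B_j)=B_j$ if $c_{0j}=0$. - For $1\le i\le r-1$: $\mathbf T_i(\mathbb K_j)=(-v)^{-c_{ij}-c_{\tau i,j}}\mathbb K_j\mathbb K_i^{-c_{ij}}\mathbb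 K_{\tau i}^{-c_{\tau i,j}}$; $\mathbf T_i(B_i)=-\mathbb K_i^{-1}B_{\tau i}$; $\mathbf T_i(B_{\tau i})=-\mathbb K_{\tau i}^{-1}B_i$; $\mathbf T_i(B_j)=B_jB_i-vB_iB_j$ if $(c_{ij},c_{\tau i,j})=(-1,0)$; $B_jB_{\tau i}-vB_{\tau i}B_j$ if $(c_{ij},c_{\tau i,j})=(0,-1)$; $[[B_j,B_i]_v,B_{\tau i}]_v-vB_j\mathbb K_i$ if $(c_{ij},c_{\tau i,j})=(-1,-1)$; $B_j$ otherwise. - For $i=r$: $\mathbf T_r(\mathbb K_j)=v^{-(c_{rj}+c_{r+1,j})}\mathbb K_j(\mathbb K_r\mathbb K_{r+1})^{-c_{rj}-c_{r+1,j}}$; $\mathbf T_r(B_r)=-v^{-2}B_r\mathbb K_{r+1}^{-1}$; $\mathbf T_r(B_{r+1})=-v^{-2}B_{r+1}\mathbb K_r^{-1}$; $\mathbf T_r(B_j)=[[B_j,B_r]_v,B_{r+1}]_v-\mathbb K_rB_j$ if $(c_{rj},c_{r+1,j})=(-1,0)$; $[[B_j,B_{r+1}]_v,B_r]_v-\mathbb K_{r+1}B_j$ if $(c_{rj},c_{r+1,j})=(0,-1)$; $v\big[[[B_j,B_r]_v,B_{r+1}],[B_{r+1},B_r]_v\big]-\big[B_j,[B_{r+1},B_r]_{v^3}\big]\mathbb K_r+vB_j\mathbb K_r\mathbb K_{r+1}$ if $(c_{rj},c_{r+1,j})=(-1,-1)$; $B_j$ otherwise. **Weyl groups.** Let $W=\langle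 s_i\mid i\in\mathbb I\rangle$ be the affine Weyl group acting on $\bigoplus_{i\in\mathbb I}\mathbb Z\alpha_i$ by $s_i\alpha_j=\alpha_j-c_{ij}\alpha_i$, and $\delta=\sum_{i\in\mathbb I}\alpha_i$. $W_\tau=\{w\in W\mid\tau w=w\tau\}$ is a Coxeter group with generators $\mathbf r_0=s_0$, $\mathbf r_i=s_is_{\tau i}$ ($1\le i\le r-1$), $\mathbf r_r=s_rs_{r+1}s_r$. For a reduced expression $w=\mathbf r_{i_1}\cdots\mathbf r_{i_k}$ in $W_\tau$, $\mathbf T_w=\mathbf T_{i_1}\cdots\mathbf T_{i_k}$. With $\omega_i$ ($i\in\mathbb I_0$) the fundamental weights of $\mathfrak{sl}_{2r+1}$ and $t_\omega$ the translation in the extended affine Weyl group, $t_\omega(\alpha_j)=\alpha_j-\langle\omega,\alpha_j\rangle\delta$ ($j\in\mathbb I_0$, $\langle\omega_i,\alpha_j\rangle=\delta_{ij}$), put $\varpi_i=t_{\omega_i}t_{\omega_{\tau i}}\in W_\tau$. Put $\varpi_i'=\varpi_i\mathbf r_i$, so $\mathbf T_{\varpi_i'}=\mathbf T_{\varpi_i}\mathbf T_i^{-1}$. Let $C=-v^{2r-1}\prod_{j\in\mathbb I}\mathbb K_j$. Let $\boldsymbol\theta_r$ be the longest element of $\langle\mathbf r_1,\dots,\mathbf r_{r-1}\rangle$; $\mathbf T_{\boldsymbol\theta_r}^{-1}(B_0)=\mathbf T_{r-1}^{-1}\cdots\mathbf T_1^{-1}(B_0)$. **Case $i<r$ ($c_{i,\tau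 i}=0$).** $\widetilde{\mathbf U}^\imath_{[i]}$ is the subalgebra generated by $B_j,\mathbb K_j^{\pm1},\mathbf T_{\varpi_j'}(B_j),C^{\pm1}$ for $j\in\{i,\tau i\}$. Let $\overline{\mathbf U}(\widehat{\mathfrak{sl}}_2)$ be the $\mathbb Q(v)$-algebra with generators $\dot E_a,\dot F_a,\dot K_a^{\pm1},\dot K_a'^{\pm1}$ ($a\in\{0,1\}$), with the $\dot K_a,\dot K_b'$ commuting, $[\dot E_a,\dot F_b]=\delta_{ab}\frac{\dot K_a-\dot K_a'}{v-v^{-1}}$, $\dot K_a\dot E_b=v^{a_{ab}}\dot E_b\dot K_a$, $\dot K_a\dot F_b=v^{-a_{ab}}\dot F_b\dot K_a$, $\dot K_a'\dot E_b=v^{-a_{ab}}\dot E_b\dot K_a'$, $\dot K_a'\dot F_b=v^{a_{ab}}\dot F_b\dot K_a'$ (here $a_{aa}=2$, $a_{01}=a_{10}=-2$), the quantum Serre relations, and $\dot K_0\dot K_1=\dot K_0'\dot K_1'$. There is a known algebra isomorphism $\aleph_i:\overline{\mathbf U}(\widehat{\mathfrak{sl}}_2)\to\widetilde{\mathbf U}^\imath_{[i]}$, $\dot F_1\mapsto B_i$, $\dot F_0\mapsto\mathbf T_{\varpi_i'}(B_i)$, $\dot E_1\mapsto B_{\tau i}$, $\dot E_0\mapsto\mathbf T_{\varpi_i'}(B_{\tau i})$, $\dot K_1\mapsto\mathbb K_i$, $\dot K_1'\mapsto\mathbb K_{\tau i}$, $\dot K_0\mapsto\mathbf T_{\varpi_i'}(\mathbb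 K_i)$, $\dot K_0'\mapsto\mathbf T_{\varpi_i'}(\mathbb K_{\tau i})$. $\dot{\mathbf T}_1$ denotes Lusztig's braid symmetry, normalized by $\dot F_1\mapsto-\dot K_1^{-1}\dot E_1$, $\dot E_1\mapsto-\dot K_1'^{-1}\dot F_1$, $\dot F_0\mapsto\dot F_0\dot F_1^{(2)}-v\dot F_1\dot F_0\dot F_1+v^2\dot F_1^{(2)}\dot F_0$, $\dot E_0\mapsto\dot E_0\dot E_1^{(2)}-v\dot E_1\dot E_0\dot E_1+v^2\dot E_1^{(2)}\dot E_0$, $\dot K_1\mapsto v^{-2}\dot K_1^{-1}$, $\dot K_0\mapsto v^2\dot K_0\dot K_1^2$, and the same formulas for $\dot K_1',\dot K_0'$ (with $x^{(2)}=x^2/[2]$). $\dot{\mathbf T}_{\varpi_1}=\rho\,\dot{\mathbf T}_1$, the operator of the fundamental translation $t_{\omega_1}=\rho s_1$ of $\widehat{\mathfrak{sl}}_2$, where $\rho$ is the automorphism exchanging the indices $0\leftrightarrow1$. **Case $i=r$.** $\widetilde{\mathbf U}^\imath_{[r]}$ is the subalgebra generated by $B_r,B_{r+1},\mathbb K_r^{\pm1},\mathbb K_{r+1}^{\pm1},\mathbf T_{\boldsymbol\theta_r}(\mathbb K_0)^{\pm1},\mathbf T_{\boldsymbol\theta_r}^{-1}(B_0)$. Let $\widetilde{\mathbf U}^\imath(\widehat{\mathfrak{sl}}_3,\tau)$ be the $r=1$ instance of the algebra above, with dotted generators $\dot B_i,\dot{\mathbb K}_i$ ($i=0,1,2$)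 and dotted symmetries $\dot{\mathbf T}_0,\dot{\mathbf T}_1$ (the $r=1$ formulas above), so $\dot{\mathbf T}_{\varpi_1}=\dot{\mathbf T}_0\dot{\mathbf T}_1$. There is an algebra isomorphism $\aleph_r:\widetilde{\mathbf U}^\imath(\widehat{\mathfrak{sl}}_3,\tau)\to\widetilde{\mathbf U}^\imath_{[r]}$, $\dot B_1\mapsto B_r$, $\dot B_2\mapsto B_{r+1}$, $\dot B_0\mapsto\mathbf T_{\boldsymbol\theta_r}^{-1}(B_0)$, $\dot{\mathbb K}_1\mapsto\mathbb K_r$, $\dot{\mathbb K}_2\mapsto\mathbb K_{r+1}$, $\dot{\mathbb K}_0\mapsto\mathbf T_{\boldsymbol\theta_r}(\mathbb K_0)$. *)

(* Defs.v *)
From HB Require Import structures.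
From mathcomp Require Import all_boot all_order all_algebra.
From mathcomp Require Import boolp.
From mathcomp Require Import monalg.

Set Implicit Arguments.
Unset Strict Implicit.
Unset Printing Implicit Defensive.

Import GRing.Theory Num.Theory.
Local Open Scope ring_scope.

(* A relation R x y imposes x = y in the quotient of the free algebra.       *)
(* The algType structure requires 1 != 0, hence the field [rels_proper].     *)
Section Presentation.
Local Open Scope quotient_scope.
Variables (F : comNzRingType) (X : choiceType).
Notation freeAlg := {malg F[{fmonom X}]}.

Inductive ideal_gen (R : freeAlg -> freeAlg -> Prop) : freeAlg -> Prop :=
| IdealRel a b x y of R x y : ideal_gen R (a * (x - y) * b)
| Ideal0 : ideal_gen R 0
| IdealD x y of ideal_gen R x & ideal_gen R y : ideal_gen R (x + y).

Record relations := Relations {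
  rels :> freeAlg -> freeAlg -> Prop;
  rels_proper : ~ ideal_gen rels 1
}.

Lemma free_scalerAr (k : F) (x y : freeAlg) : k *: (x * y) = x * (k *: y).
Proof.
have cM (z : freeAlg) : z * k%:MP = k *: z.
  rewrite [z]monalgE mulr_suml scaler_sumr; apply: eq_bigr => m _.
  rewrite -mul_malgC -![_ * _]/(fgmul _ _) !fgmulUU.
  by rewrite mulm1 mul1m mulrC.
by rewrite -(cM y) mulrA cM.
Qed.

Variable R : relations.

Lemma ideal_mull a x : ideal_gen R x -> ideal_gen R (a * x).
Proof.
elim=> [c d u w Ruw||u w _ IHu _ IHw]; first by rewrite !mulrA; apply: IdealRel.
  by rewrite mulr0; apply: Ideal0.
by rewrite mulrDr; apply: IdealD.
Qed.

Lemma ideal_mulr a x : ideal_gen R x -> ideal_gen R (x * a).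
Proof.
elim=> [c d u w Ruw||u w _ IHu _ IHw].
- by rewrite -mulrA; apply: IdealRel.
- by rewrite mul0r; apply: Ideal0.
- by rewrite mulrDl; apply: IdealD.
Qed.

Definition ideal_pred : {pred freeAlg} := fun x => `[< ideal_gen R x >].

Fact ideal_zmod_closed : zmod_closed ideal_pred.
Proof.
split=> [|x y /asboolP Ix /asboolP Iy]; apply/asboolP; first exact: Ideal0.
by apply: IdealD => //; rewrite -mulN1r; apply: ideal_mull.
Qed.
HB.instance Definition _ :=
  GRing.isZmodClosed.Build freeAlg ideal_pred ideal_zmod_closed.

Definition presAlg : Type := Quotient.quot ideal_pred.
HB.instance Definition _ := GRing.Zmodule.on presAlg.

Notation piA := (\pi_(Quotient.quot ideal_pred) : freeAlg -> presAlg).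
Notation reprA := (repr : Quotient.quot ideal_pred -> freeAlg).

Lemma piA_eq x y : piA x = piA y <-> ideal_gen R (x - y).
Proof.
have eqE : (x - y \in ideal_pred) = (piA x == piA y).
  exact: Quotient.idealrBE.
by split=> [/eqP|Ixy]; [rewrite -eqE => /asboolP | apply/eqP; rewrite -eqE; apply/asboolP].
Qed.

Definition presAlg_one : presAlg := piA 1.
Definition presAlg_mul (x y : presAlg) : presAlg := piA (reprA x * reprA y).
Definition presAlg_scale (k : F) (x : presAlg) : presAlg := piA (k *: reprA x).

Lemma piA_reprK (x : presAlg) : piA (reprA x) = x. Proof. exact: reprK. Qed.

Lemma piAD x y : piA (x + y) = piA x + piA y.
Proof. by rewrite Quotient.pi_add. Qed.

Lemma piAM x y : piA (x * y) = presAlg_mul (piA x) (piA y).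
Proof.
apply/piA_eq; set x' := reprA _; set y' := reprA _.
have -> : x * y - x' * y' = (x - x') * y + x' * (y - y').
  by rewrite mulrBl mulrBr addrA subrK.
by apply: IdealD; [apply: ideal_mulr | apply: ideal_mull];
  apply/piA_eq; rewrite piA_reprK.
Qed.

Lemma piAZ k x : piA (k *: x) = presAlg_scale k (piA x).
Proof.
apply/piA_eq; rewrite -scalerBr -mul_malgC; apply: ideal_mull.
by apply/piA_eq; rewrite piA_reprK.
Qed.

Fact presAlg_mulA : associative presAlg_mul.
Proof.
move=> x y z; rewrite -[x]piA_reprK -[y]piA_reprK -[z]piA_reprK.
by rewrite -!piAM mulrA.
Qed.
Fact presAlg_mul1r : left_id presAlg_one presAlg_mul.
Proof. by move=> x; rewrite -[x]piA_reprK -!piAM mul1r. Qed.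
Fact presAlg_mulr1 : right_id presAlg_one presAlg_mul.
Proof. by move=> x; rewrite -[x]piA_reprK -!piAM mulr1. Qed.
Fact presAlg_mulDl : left_distributive presAlg_mul +%R.
Proof.
move=> x y z; rewrite -[x]piA_reprK -[y]piA_reprK -[z]piA_reprK.
by rewrite -piAD -!piAM -piAD mulrDl.
Qed.
Fact presAlg_mulDr : right_distributive presAlg_mul +%R.
Proof.
move=> x y z; rewrite -[x]piA_reprK -[y]piA_reprK -[z]piA_reprK.
by rewrite -piAD -!piAM -piAD mulrDr.
Qed.
Fact presAlg_one_neq0 : presAlg_one != 0.
Proof.
have pi0 : piA 0 = 0 by apply: (addrI (piA 0)); rewrite -piAD !addr0.
apply/eqP=> one0; have : piA 1 = piA 0 by rewrite pi0.
by move/(iffLR (piA_eq _ _)); rewrite subr0; apply: rels_proper.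
Qed.
HB.instance Definition _ := GRing.Zmodule_isNzRing.Build presAlg
  presAlg_mulA presAlg_mul1r presAlg_mulr1 presAlg_mulDl presAlg_mulDr
  presAlg_one_neq0.

Fact presAlg_scalerA a b x :
  presAlg_scale a (presAlg_scale b x) = presAlg_scale (a * b) x.
Proof. by rewrite -[x]piA_reprK -!piAZ scalerA. Qed.
Fact presAlg_scale1r : left_id 1 presAlg_scale.
Proof. by move=> x; rewrite -[x]piA_reprK -!piAZ scale1r. Qed.
Fact presAlg_scalerDr : right_distributive presAlg_scale +%R.
Proof.
move=> k x y; rewrite -[x]piA_reprK -[y]piA_reprK.
by rewrite -piAD -!piAZ -piAD scalerDr.
Qed.
Fact presAlg_scalerDl x : {morph presAlg_scale^~ x : a b / a + b}.
Proof. by move=> a b; rewrite -[x]piA_reprK -!piAZ -piAD scalerDl. Qed.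
HB.instance Definition _ := GRing.Zmodule_isLmodule.Build F presAlg
  presAlg_scalerA presAlg_scale1r presAlg_scalerDr presAlg_scalerDl.

Fact presAlg_scalerAl (a : F) (x y : presAlg) : a *: (x * y) = (a *: x) * y.
Proof.
rewrite -[x]piA_reprK -[y]piA_reprK -[_ * piA _]piAM -[a *: _]piAZ.
by rewrite -[a *: piA _]piAZ -[RHS]piAM scalerAl.
Qed.
HB.instance Definition _ := GRing.Lmodule_isLalgebra.Build F presAlg
  presAlg_scalerAl.
Fact presAlg_scalerAr (a : F) (x y : presAlg) : a *: (x * y) = x * (a *: y).
Proof.
rewrite -[x]piA_reprK -[y]piA_reprK -[_ * piA _]piAM -[a *: _]piAZ.
by rewrite -[a *: piA _]piAZ -[RHS]piAM free_scalerAr.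
Qed.
HB.instance Definition _ := GRing.Lalgebra_isAlgebra.Build F presAlg
  presAlg_scalerAr.

Definition presAlg_pi (x : freeAlg) : presAlg := piA x.
Definition presAlg_gen (x : X) : presAlg := piA << fmu x >>.

Fact presAlg_pi_is_zmod : zmod_morphism presAlg_pi.
Proof. by move=> x y; rewrite /presAlg_pi piAD Quotient.pi_opp. Qed.
Fact presAlg_pi_is_monoid : monoid_morphism presAlg_pi.
Proof. by split; [exact: erefl | move=> x y; exact: piAM]. Qed.
Fact presAlg_pi_is_scalable : scalable presAlg_pi.
Proof. by move=> k x; rewrite /presAlg_pi piAZ. Qed.
HB.instance Definition _ :=
  GRing.isZmodMorphism.Build freeAlg presAlg presAlg_pi presAlg_pi_is_zmod.
HB.instance Definition _ :=
  GRing.isMonoidMorphism.Build freeAlg presAlg presAlg_pi presAlg_pi_is_monoid.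
HB.instance Definition _ :=
  GRing.isScalable.Build F freeAlg presAlg *:%R presAlg_pi
    presAlg_pi_is_scalable.

Lemma presAlg_rel x y : R x y -> presAlg_pi x = presAlg_pi y.
Proof.
by move=> Rxy; apply/piA_eq; rewrite -[_ - _]mul1r -[_ * _]mulr1; apply: IdealRel.
Qed.

Lemma presAlg_surj (z : presAlg) : exists x, z = presAlg_pi x.
Proof. by exists (reprA z); rewrite /presAlg_pi piA_reprK. Qed.

End Presentation.

(* A proof of [rels_proper]: a character of the free algebra that is         *)
(* compatible with the relations.                                            *)
Section Augmentation.
Variables (F : comNzRingType) (X : choiceType) (a : X -> F).

Definition aug_mon (m : {fmonom X}) : F := \prod_(x <- m) a x.
Fact aug_mon_is_mult : mmorphism aug_mon.
Proof.
by split=> [m1 m2|]; rewrite /aug_mon ?fmM ?big_cat ?fm1 ?big_nil.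
Qed.
HB.instance Definition _ :=
  monalg.isMultiplicative.Build {fmonom X} F aug_mon aug_mon_is_mult.

Definition aug : {malg F[{fmonom X}]} -> F := mmap idfun aug_mon.
HB.instance Definition _ := GRing.RMorphism.on aug.

Lemma aug_gen x : aug << fmu x >> = a x.
Proof. by rewrite /aug mmapU mul1r /aug_mon fmU big_seq1. Qed.

Lemma aug_scale k x : aug (k *: x) = k * aug x.
Proof. exact: mmapZ. Qed.

Lemma aug_proper (R : {malg F[{fmonom X}]} -> {malg F[{fmonom X}]} -> Prop) :
  (forall x y, R x y -> aug x = aug y) -> ~ ideal_gen R 1.
Proof.
move=> augR; have aug0 x : ideal_gen R x -> aug x = 0.
  elim=> [c d u w /augR Euw||u w _ IHu _ IHw].
  - by rewrite !rmorphM rmorphB /= Euw subrr mulr0 mul0r.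
  - exact: rmorph0.
  - by rewrite rmorphD /= IHu IHw addr0.
by move/aug0/eqP; rewrite rmorph1 oner_eq0.
Qed.
End Augmentation.

Section Algebras.
Variable F : comNzRingType.

Record algAut (A : algType F) := AlgAut {
  aut :> {lrmorphism A -> A};
  autV : A -> A;
  autK : cancel aut autV;
  autVK : cancel autV aut
}.

(* An isomorphism of A onto the subalgebra S of B; isoV is relevant on S only. *)
Record algIsoOnto (A B : algType F) (S : B -> Prop) := AlgIsoOnto {
  iso :> {lrmorphism A -> B};
  isoV : B -> A;
  iso_in : forall a, S (iso a);
  isoK : cancel iso isoV;
  isoVK : forall b, S b -> iso (isoV b) = b
}.

Inductive subalg_gen (A : algType F) (G : A -> Prop) : A -> Prop :=
| SubalgGen x of G x : subalg_gen G x
| SubalgScalar k : subalg_gen G k%:A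
| SubalgAdd x y of subalg_gen G x & subalg_gen G y : subalg_gen G (x + y)
| SubalgMul x y of subalg_gen G x & subalg_gen G y : subalg_gen G (x * y).

Variable A : algType F.

Definition qcomm (q : F) (a b : A) : A := a * b - q *: (b * a).

(* x ^ m for m : int, where y is the inverse of x. *)
Definition zpow (x y : A) (m : int) : A :=
  match m with Posz k => x ^+ k | Negz k => y ^+ k.+1 end.

End Algebras.

Definition Qv : fieldType := {fraction {poly rat}}.
Definition v : Qv := FracField.tofrac 'X.
Definition qnum (m : nat) : Qv := (v ^+ m - v ^- m) / (v - v^-1).

(* Nodes of type A_{2r}^(1) are residues modulo 2r+1; tau i = 2r+1-i is the  *)
(* negation of 'I_(2r+1) seen as Z/(2r+1).                                   *)
Section Dynkin.
Variable r : nat.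
Implicit Types i j : 'I_r.*2.+1.

Definition cartan i j : int :=
  if i == j then 2
  else if (i.+1 == j %[mod r.*2.+1])%N || (j.+1 == i %[mod r.*2.+1])%N then -1
  else 0.

Definition tau i : 'I_r.*2.+1 := - i.

(* 'I_r.+1 indexes the tau-orbits of nodes; T_i and the generators of W_tau  *)
(* depend only on the orbit of i.                                            *)
Definition node (i : 'I_r.+1) : 'I_r.*2.+1 := inord i.
Definition orb i : 'I_r.+1 := inord (minn i (tau i)).

(* Elements of the extended affine Weyl group are represented by their       *)
(* matrices on the root lattice: column j is the image of alpha_j.           *)
Definition refl i : 'M[int]_r.*2.+1 :=
  \matrix_(k, j) ((k == j)%:R - (k == i)%:R * cartan i j).

(* <omega_i, alpha_j> for i <> 0; the value at j = 0 comes from              *)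
(* <omega_i, delta> = 0.                                                     *)
Definition fweight i j : int := if j == 0 then -1 else (i == j)%:R.

Definition transl i : 'M[int]_r.*2.+1 := \matrix_(k, j) ((k == j)%:R - fweight i j).

Definition varpi i : 'M[int]_r.*2.+1 := transl i * transl (tau i).

Definition rrefl (i : 'I_r.+1) : 'M[int]_r.*2.+1 :=
  let i0 := node i in
  if i == 0%N :> nat then refl i0
  else if (i < r)%N then refl i0 * refl (tau i0)
  else refl i0 * refl (tau i0) * refl i0.

Definition wprod (s : seq 'I_r.+1) : 'M[int]_r.*2.+1 := \prod_(i <- s) rrefl i.

Definition reduced (s : seq 'I_r.+1) : Prop :=
  forall s', wprod s' = wprod s -> (size s <= size s')%N.

Definition reduced_expr (s : seq 'I_r.+1) (w : 'M[int]_r.*2.+1) : Prop :=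
  wprod s = w /\ reduced s.

Definition varpi' i : 'M[int]_r.*2.+1 := varpi i * rrefl (orb i).

Definition is_longest (J : pred 'I_r.+1) (w : 'M[int]_r.*2.+1) : Prop :=
  exists s, [/\ all J s, reduced_expr s w &
    forall s', all J s' -> reduced s' -> (size s' <= size s)%N].

(* The word i j i j ... of length m. *)
Definition alt_word (i j : 'I_r.+1) (m : nat) : seq 'I_r.+1 :=
  mkseq (fun k => if odd k then j else i) m.

End Dynkin.

Inductive iq_rels (r : nat) (A : lalgType Qv) (B K Kinv : 'I_r.*2.+1 -> A) :
  A -> A -> Prop :=
| iqKV i : iq_rels B K Kinv (K i * Kinv i) 1
| iqVK i : iq_rels B K Kinv (Kinv i * K i) 1
| iqKK i l : iq_rels B K Kinv (K i * K l) (K l * K i)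
| iqKB l i : iq_rels B K Kinv
    (K l * B i) (v ^ (cartan (tau l) i - cartan l i) *: (B i * K l))
| iqBB i j of cartan i j = 0 & j <> tau i : iq_rels B K Kinv
    (B i * B j) (B j * B i)
| iqSerre i j of cartan i j = -1 & j <> tau i & tau i <> i : iq_rels B K Kinv
    (B i ^+ 2 * B j - qnum 2 *: (B i * B j * B i) + B j * B i ^+ 2) 0
| iqBtau i of cartan i (tau i) = 0 : iq_rels B K Kinv
    (B (tau i) * B i - B i * B (tau i)) ((v - v^-1)^-1 *: (K i - K (tau i)))
| iqSerre_fix i j of cartan i j = -1 & tau i = i : iq_rels B K Kinv
    (B i ^+ 2 * B j - qnum 2 *: (B i * B j * B i) + B j * B i ^+ 2)
    (- (v^-1 *: (B j * K i)))
| iqSerre_tau i of cartan i (tau i) = -1 : iq_rels B K Kinv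
    (B i ^+ 2 * B (tau i) - qnum 2 *: (B i * B (tau i) * B i)
       + B (tau i) * B i ^+ 2)
    (- (qnum 2 *: (v *: (K i * B i) + v *: (B i * K (tau i))))).

Definition iq_gens (r : nat) : choiceType :=
  ('I_r.*2.+1 + 'I_r.*2.+1 * bool)%type.

Notation freeB r i := (<< fmu (inl i : iq_gens r) >> : {malg Qv[{fmonom iq_gens r}]}).
Notation freeK r i := (<< fmu (inr (i, true) : iq_gens r) >> : {malg Qv[{fmonom iq_gens r}]}).
Notation freeKinv r i := (<< fmu (inr (i, false) : iq_gens r) >> : {malg Qv[{fmonom iq_gens r}]}).

Lemma iq_rels_char (r : nat) (A : lalgType Qv) (phi : {rmorphism A -> Qv})
    (B K Kinv : 'I_r.*2.+1 -> A) (x y : A) :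
  (forall c z, phi (c *: z) = c * phi z) ->
  (forall i, phi (B i) = 0) -> (forall i, phi (K i) = 1) ->
  (forall i, phi (Kinv i) = 1) -> iq_rels B K Kinv x y -> phi x = phi y.
Proof.
move=> hZ hB hK hV; case=> *.
- by rewrite !rmorphM rmorph1 hK hV mulr1.
- by rewrite !rmorphM rmorph1 hK hV mulr1.
- by rewrite !rmorphM !hK.
- by rewrite hZ !rmorphM !hB mul0r !mulr0.
- by rewrite !rmorphM !hB.
- by rewrite !rmorphD rmorphN hZ !rmorphM !hB !mul0r !mulr0 subrr addr0 rmorph0.
- by rewrite hZ !rmorphB !rmorphM !hK !hB !subrr mulr0.
- by rewrite !rmorphD !rmorphN !hZ !rmorphM !hB !mul0r !mulr0 subrr addr0 oppr0.
- rewrite !rmorphD !rmorphN !hZ !rmorphD !hZ !rmorphM !hB !mul0r !mulr0.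
  by rewrite subrr !addr0 mulr0 oppr0.
Qed.

Lemma iq_proper r : ~ ideal_gen
  (iq_rels (fun i => freeB r i) (fun i => freeK r i) (fun i => freeKinv r i)) 1.
Proof.
apply: (aug_proper (a := fun x : iq_gens r => if x is inr _ then 1 else 0)).
move=> x y; apply: iq_rels_char => [c z|i|i|i]; first exact: aug_scale.
all: exact: aug_gen.
Qed.

Definition Uiq (r : nat) : algType Qv := presAlg (Relations (@iq_proper r)).

Section IQuantumGroup.
Variable r : nat.
Implicit Types i j : 'I_r.*2.+1.

Definition B i : Uiq r := presAlg_pi _ (freeB r i).
Definition K i : Uiq r := presAlg_pi _ (freeK r i).
Definition Kinv i : Uiq r := presAlg_pi _ (freeKinv r i).
Definition Kz i (m : int) : Uiq r := zpow (K i) (Kinv i) m.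

Definition T_K (i : 'I_r.+1) j : Uiq r :=
  let i0 := node i in let i1 := tau i0 in
  if i == 0%N :> nat then K j * Kz i0 (- cartan i0 j)
  else if (i < r)%N then
    (- v) ^ (- cartan i0 j - cartan i1 j) *:
      (K j * Kz i0 (- cartan i0 j) * Kz i1 (- cartan i1 j))
  else
    v ^ (- (cartan i0 j + cartan i1 j)) *:
      (K j * zpow (K i0 * K i1) (Kinv i1 * Kinv i0) (- cartan i0 j - cartan i1 j)).

Definition T_B (i : 'I_r.+1) j : Uiq r :=
  let i0 := node i in let i1 := tau i0 in
  let a := (cartan i0 j, cartan i1 j) in
  if i == 0%N :> nat then
    if j == i0 then Kinv i0 * B i0
    else if cartan i0 j == -1 then qcomm v (B j) (B i0)
    else B j
  else if (i < r)%N then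
    if j == i0 then - (Kinv i0 * B i1)
    else if j == i1 then - (Kinv i1 * B i0)
    else if a == (-1, 0) then qcomm v (B j) (B i0)
    else if a == (0, -1) then qcomm v (B j) (B i1)
    else if a == (-1, -1) then
      qcomm v (qcomm v (B j) (B i0)) (B i1) - v *: (B j * K i0)
    else B j
  else
    if j == i0 then - (v ^- 2 *: (B i0 * Kinv i1))
    else if j == i1 then - (v ^- 2 *: (B i1 * Kinv i0))
    else if a == (-1, 0) then
      qcomm v (qcomm v (B j) (B i0)) (B i1) - K i0 * B j
    else if a == (0, -1) then
      qcomm v (qcomm v (B j) (B i1)) (B i0) - K i1 * B j
    else if a == (-1, -1) then
      v *: qcomm 1 (qcomm 1 (qcomm v (B j) (B i0)) (B i1)) (qcomm v (B i1) (B i0))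
      - qcomm 1 (B j) (qcomm (v ^+ 3) (B i1) (B i0)) * K i0
      + v *: (B j * K i0 * K i1)
    else B j.

Definition is_symmetry (i : 'I_r.+1) (f : algAut (Uiq r)) : Prop :=
  forall j, f (K j) = T_K i j /\ f (B j) = T_B i j.

Variable T : 'I_r.+1 -> algAut (Uiq r).

Definition Tword (s : seq 'I_r.+1) : Uiq r -> Uiq r :=
  foldr (fun (i : 'I_r.+1) f => T i \o f) id s.

(* Here m is the order of the product of the two reflections.               *)
Definition braid_relations : Prop :=
  forall (i j : 'I_r.+1) (m : nat), i != j -> (0 < m)%N ->
    (rrefl i * rrefl j) ^+ m = 1 ->
    (forall k, (0 < k < m)%N -> (rrefl i * rrefl j) ^+ k <> 1) ->
    Tword (alt_word i j m) =1 Tword (alt_word j i m).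

(* T_w is independent of the reduced expression of w in W_tau; the values of *)
(* Tw on matrices outside W_tau are irrelevant.                              *)
Variable Tw : 'M[int]_r.*2.+1 -> algAut (Uiq r).

Definition is_Tw : Prop :=
  forall s w, reduced_expr s w -> Tw w =1 Tword s.

Definition iqC : Uiq r := (- v ^ (r.*2%:Z - 1)) *: \prod_j K j.
Definition iqCinv : Uiq r := (- v ^ (r.*2%:Z - 1))^-1 *: \prod_j Kinv j.

Inductive gens_lt (i : 'I_r.+1) : Uiq r -> Prop :=
| GltB j of j \in [:: node i; tau (node i)] : gens_lt i (B j)
| GltK j of j \in [:: node i; tau (node i)] : gens_lt i (K j)
| GltKinv j of j \in [:: node i; tau (node i)] : gens_lt i (Kinv j)
| GltTB j of j \in [:: node i; tau (node i)] : gens_lt i (Tw (varpi' j) (B j))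
| GltC : gens_lt i iqC
| GltCinv : gens_lt i iqCinv.

Variable theta : 'M[int]_r.*2.+1.

Inductive gens_r : Uiq r -> Prop :=
| GrB j of j \in [:: node ord_max; tau (node ord_max)] : gens_r (B j)
| GrK j of j \in [:: node ord_max; tau (node ord_max)] : gens_r (K j)
| GrKinv j of j \in [:: node ord_max; tau (node ord_max)] : gens_r (Kinv j)
| GrTK : gens_r (Tw theta (K 0))
| GrTKinv : gens_r (Tw theta (Kinv 0))
| GrTB : gens_r (autV (Tw theta) (B 0)).

End IQuantumGroup.

Definition is_aleph_r r (Tw : 'M[int]_r.*2.+1 -> algAut (Uiq r))
    (theta : 'M[int]_r.*2.+1) (f : Uiq 1 -> Uiq r) : Prop :=
  let i0 := node (ord_max : 'I_r.+1) in let i1 := tau i0 in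
  [/\ f (B (inord 1)) = B i0, f (B (inord 2)) = B i1
    & f (B (inord 0)) = autV (Tw theta) (B 0)] /\
  [/\ f (K (inord 1)) = K i0, f (K (inord 2)) = K i1
    & f (K (inord 0)) = Tw theta (K 0)].

(* The nodes 0 and 1 of affine sl_2 are encoded as false and true.           *)
Inductive sl2_gens := GE of bool | GF of bool
  | GK of bool | GKinv of bool | GK' of bool | GK'inv of bool.
HB.instance Definition _ := gen_eqMixin sl2_gens.
HB.instance Definition _ := gen_choiceMixin sl2_gens.

Definition cartan_sl2 (a b : bool) : int := if a == b then 2 else -2.

Definition serre3 (A : lalgType Qv) (x y : A) : A :=
  x ^+ 3 * y - qnum 3 *: (x ^+ 2 * y * x) + qnum 3 *: (x * y * x ^+ 2) - y * x ^+ 3.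

Inductive sl2_rels (A : lalgType Qv) (g : sl2_gens -> A) : A -> A -> Prop :=
| slKV a : sl2_rels g (g (GK a) * g (GKinv a)) 1
| slVK a : sl2_rels g (g (GKinv a) * g (GK a)) 1
| slKV' a : sl2_rels g (g (GK' a) * g (GK'inv a)) 1
| slVK' a : sl2_rels g (g (GK'inv a) * g (GK' a)) 1
| slKK a b : sl2_rels g (g (GK a) * g (GK b)) (g (GK b) * g (GK a))
| slKK' a b : sl2_rels g (g (GK a) * g (GK' b)) (g (GK' b) * g (GK a))
| slK'K' a b : sl2_rels g (g (GK' a) * g (GK' b)) (g (GK' b) * g (GK' a))
| slEF a b : sl2_rels g (g (GE a) * g (GF b) - g (GF b) * g (GE a))
    (if a == b then (v - v^-1)^-1 *: (g (GK a) - g (GK' a)) else 0)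
| slKE a b : sl2_rels g (g (GK a) * g (GE b))
    (v ^ cartan_sl2 a b *: (g (GE b) * g (GK a)))
| slKF a b : sl2_rels g (g (GK a) * g (GF b))
    (v ^ (- cartan_sl2 a b) *: (g (GF b) * g (GK a)))
| slK'E a b : sl2_rels g (g (GK' a) * g (GE b))
    (v ^ (- cartan_sl2 a b) *: (g (GE b) * g (GK' a)))
| slK'F a b : sl2_rels g (g (GK' a) * g (GF b))
    (v ^ cartan_sl2 a b *: (g (GF b) * g (GK' a)))
| slSerreE a : sl2_rels g (serre3 (g (GE a)) (g (GE (~~ a)))) 0
| slSerreF a : sl2_rels g (serre3 (g (GF a)) (g (GF (~~ a)))) 0
| slCentral : sl2_rels g (g (GK false) * g (GK true)) (g (GK' false) * g (GK' true)).

Lemma sl2_rels_char (A : lalgType Qv) (phi : {rmorphism A -> Qv})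
    (g : sl2_gens -> A) (x y : A) :
  (forall c z, phi (c *: z) = c * phi z) ->
  (forall u, phi (g u) = match u with GE _ | GF _ => 0 | _ => 1 end) ->
  sl2_rels g x y -> phi x = phi y.
Proof.
move=> hZ hg.
have serre0 u w : phi (g u) = 0 -> phi (g w) = 0 -> phi (serre3 (g u) (g w)) = 0.
  move=> hu hw; rewrite /serre3 !(rmorphB, rmorphD) !hZ !rmorphM hu hw.
  by rewrite !(mulr0, mul0r, addr0, subrr).
case=> *.
1-4: by rewrite !rmorphM rmorph1 !hg mulr1.
1-3: by rewrite !rmorphM !hg.
- rewrite rmorphB !rmorphM !hg subrr; case: ifP => _; last by rewrite rmorph0.
  by rewrite hZ rmorphB !hg subrr mulr0.
1-4: by rewrite hZ !rmorphM !hg mul0r !mulr0.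
1-2: by rewrite rmorph0 serre0 ?hg.
by rewrite !rmorphM !hg.
Qed.

Lemma sl2_proper : ~ ideal_gen
  (sl2_rels (fun x => << fmu x >> : {malg Qv[{fmonom sl2_gens}]})) 1.
Proof.
apply: (aug_proper (a := fun u => match u with GE _ | GF _ => 0 | _ => 1 end)).
move=> x y; apply: sl2_rels_char => [c z|u]; first exact: aug_scale.
exact: aug_gen.
Qed.

Definition Usl2 : algType Qv := presAlg (Relations sl2_proper).

Section AffineSl2.
Definition sl2 (x : sl2_gens) : Usl2 := presAlg_pi _ << fmu x >>.
Notation E := (fun a => sl2 (GE a)).
Notation F := (fun a => sl2 (GF a)).

Definition dpow2 (x : Usl2) : Usl2 := (qnum 2)^-1 *: x ^+ 2.

Definition lusztig_T1_0 (x0 x1 : Usl2) : Usl2 :=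
  x0 * dpow2 x1 - v *: (x1 * x0 * x1) + v ^+ 2 *: (dpow2 x1 * x0).

Definition is_lusztig_T1 (f : Usl2 -> Usl2) : Prop :=
  [/\ f (F true) = - (sl2 (GKinv true) * E true),
      f (E true) = - (sl2 (GK'inv true) * F true),
      f (F false) = lusztig_T1_0 (F false) (F true)
    & f (E false) = lusztig_T1_0 (E false) (E true)] /\
  [/\ f (sl2 (GK true)) = v ^- 2 *: sl2 (GKinv true),
      f (sl2 (GK' true)) = v ^- 2 *: sl2 (GK'inv true),
      f (sl2 (GK false)) = v ^+ 2 *: (sl2 (GK false) * sl2 (GK true) ^+ 2)
    & f (sl2 (GK' false)) = v ^+ 2 *: (sl2 (GK' false) * sl2 (GK' true) ^+ 2)].

Definition is_rho (f : Usl2 -> Usl2) : Prop :=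
  forall a, [/\ f (E a) = E (~~ a), f (F a) = F (~~ a),
    f (sl2 (GK a)) = sl2 (GK (~~ a)) & f (sl2 (GK' a)) = sl2 (GK' (~~ a))].

Definition is_aleph_lt r (Tw : 'M[int]_r.*2.+1 -> algAut (Uiq r)) (i : 'I_r.+1)
    (f : Usl2 -> Uiq r) : Prop :=
  let i0 := node i in let i1 := tau i0 in let Tv := Tw (varpi' i0) in
  [/\ f (F true) = B i0, f (F false) = Tv (B i0),
      f (E true) = B i1 & f (E false) = Tv (B i1)] /\
  [/\ f (sl2 (GK true)) = K i0, f (sl2 (GK' true)) = K i1,
      f (sl2 (GK false)) = Tv (K i0) & f (sl2 (GK' false)) = Tv (K i1)].
End AffineSl2.

(* Main.v *)
Require Import Defs.
From mathcomp Require Import all_boot all_order all_algebra.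
From mathcomp Require Import zify.
From mathcomp Require Import monalg.

Set Implicit Arguments.
Unset Strict Implicit.
Unset Printing Implicit Defensive.

(* Write t_k for T_k. The word c_i = t_0 t_1 ... t_r ... t_i (down from r to
   i) has the property that c_i^i is a reduced expression of varpi_i, so that
   T_(varpi'_i) can be rewritten, using the braid relations only, in terms of
   Q_j = t_j ... t_r ... t_j and of the conjugate P_m of t_0 by t_1 ... t_m.
   For i < r this gives T_(varpi'_i)(B_i) as an explicit v-commutator [a, b]_v
   (with one correction term when i = r - 1) of two elements satisfying the
   Serre relation with B_i; Lusztig's operator sends [a, b]_v to
   [[a, B_i]_v, [b, B_i]_v]_v, and so does T_i. Moreover T_(varpi'_i)^2 fixes
   B_i and K_i, which gives the second equality.
   For i = r, T_r is computed on T_theta^-1(B_0), an explicit polynomial in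
   the B_j, by a rank two identity, and T_(varpi_r) T_r^-1 reduces to
   P_(r-1), which acts on the generators as the symmetry T_0 of rank one.
   Reducedness is proved in the realization of the affine Weyl group by
   permutations of Z, from a potential that each generator increases by at
   most one. *)

(** * Words in the braid group of W_tau *)

(** The word for [T_(varpi'_i)] is too long to be evaluated letter by letter: the successive images
    of [B_i] are commutators of growing depth. The way round is injectivity. An equality is proved
    after applying an invertible word that collapses both sides; for instance [Q_(i+1)] sends
    [T_(varpi'_i)(B_i)] to [P_(i-1)(B_(tau i))], so the explicit v-commutator only has to be checked
    against this short value. The word arguments take place on a mere set with bijections and use
    seven values of short words on a family [b]. These seven are rank two computations, carried out
    once for the [B_k] and once for the [K_k]. The correction term at [i = r - 1] has its origin in
    [T_r]: the preimage of [B_(r-1)] under [T_r] is a double commutator minus a term in [K].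
    Reducedness only requires a lower bound for the length of a word. The braid hypothesis, in turn,
    speaks of the exact order of [r_i r_j], so these orders are computed as well. The maps aleph
    enter through their values on generators: both sides of each equality are algebra morphisms, and
    every element of the subalgebra is an image. *)

Definition far (k l : nat) := (k.+1 < l) || (l.+1 < k).

Lemma iota_rcons a m : iota a m.+1 = rcons (iota a m) (a + m).
Proof. by rewrite -cats1 -addn1 iotaD. Qed.

Section Braid.
Variables (X : Type) (r : nat) (t ti : nat -> X -> X).
Hypotheses (tK : forall k, cancel (t k) (ti k)) (tiK : forall k, cancel (ti k) (t k)).
Hypothesis t_far : forall k l x, k <= r -> l <= r -> far k l -> t k (t l x) = t l (t k x).
Hypothesis t_br3 : forall k x, 0 < k -> k.+1 < r ->
  t k (t k.+1 (t k x)) = t k.+1 (t k (t k.+1 x)).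
Hypothesis t_br40 : forall x, 1 < r -> t 0 (t 1 (t 0 (t 1 x))) = t 1 (t 0 (t 1 (t 0 x))).
Hypothesis t_br4r : forall x, 1 < r ->
  t r.-1 (t r (t r.-1 (t r x))) = t r (t r.-1 (t r (t r.-1 x))).

Definition tw (s : seq nat) (x : X) : X := foldr t x s.

Lemma tw_cat s1 s2 x : tw (s1 ++ s2) x = tw s1 (tw s2 x).
Proof. exact: foldr_cat. Qed.
Lemma tw_rcons s k x : tw (rcons s k) x = tw s (t k x).
Proof. by rewrite -cats1 tw_cat. Qed.
Lemma t_inj k : injective (t k). Proof. exact: can_inj (tK k). Qed.
Lemma tw_inj s : injective (tw s).
Proof. by elim: s => [|k s IH] x y //= /t_inj /IH. Qed.

Lemma tw_far s l x : l <= r -> all (fun k => (k <= r) && far k l) s ->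
  tw s (t l x) = t l (tw s x).
Proof.
move=> lr; elim: s => [|k s IH] //= /andP[/andP[kr kl] /IH ->].
exact: t_far.
Qed.

Lemma ti_far k l x : k <= r -> l <= r -> far k l -> ti k (t l x) = t l (ti k x).
Proof. by move=> kr lr kl; apply: (@t_inj k); rewrite tiK t_far // tiK. Qed.

(** Letters beyond [k+1] commute with [t_k], the braid relation turns [t_k t_(k+1) t_k] into
    [t_(k+1) t_k t_(k+1)], and letters before [k] commute with [t_(k+1)]. The bounds keep [k] and
    [k+1] among [1, ..., r-1], where the relation has length three. *)
Lemma iota_shift a n k x : 0 < k -> a <= k -> k.+1 < a + n -> a + n <= r ->
  tw (iota a n) (t k x) = t k.+1 (tw (iota a n) x).
Proof.
move=> k0 ak kn nr.
have -> : n = (k - a) + (2 + (n - (k - a) - 2)) by lia.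
rewrite !iotaD !tw_cat; have -> : a + (k - a) = k by lia.
rewrite [tw (iota (k + 2) _) (t k x)]tw_far; first last.
- by apply/allP => l; rewrite mem_iota /far; lia.
- lia.
rewrite /= t_br3; [|lia|lia].
rewrite tw_far //; first lia.
by apply/allP => l; rewrite mem_iota /far; lia.
Qed.

Lemma iota_shifts a n k m x : 0 < k -> a <= k -> k + m < a + n -> a + n <= r ->
  tw (iota a n) (tw (iota k m) x) = tw (iota k.+1 m) (tw (iota a n) x).
Proof.
elim: m k => [|m IH] k k0 ak kn nr //=.
rewrite iota_shift //; last lia.
by rewrite IH //; lia.
Qed.

(* Q i = t_i .. t_r .. t_i, G i = t_0 .. t_(i-1) and c i = G i Q i. *)
Definition Qw (i : nat) : seq nat := iota i (r - i).+1 ++ rev (iota i (r - i)).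
Definition Q i := tw (Qw i).
Definition G i := tw (iota 0 i).
Definition cw (i : nat) : seq nat := iota 0 r.+1 ++ rev (iota i (r - i)).
Definition c i := tw (cw i).

Lemma Qr x : Q r x = t r x.
Proof. by rewrite /Q /Qw subnn. Qed.
Lemma QS i x : i < r -> Q i x = t i (Q i.+1 (t i x)).
Proof.
move=> ir; rewrite /Q /Qw; have -> : r - i = (r - i.+1).+1 by lia.
by rewrite [iota i (_.+1)]/= rev_cons -cats1 catA tw_cat /= !tw_cat.
Qed.
Lemma cE i x : i <= r -> c i x = G i (Q i x).
Proof.
move=> ir; rewrite /c /cw /G /Q /Qw -!tw_cat catA.
by congr (tw (_ ++ _) x); rewrite -iotaD; congr iota; lia.
Qed.
Lemma cS i x : i < r -> c i x = c i.+1 (t i x).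
Proof.
move=> ir; rewrite /c /cw; have -> : r - i = (r - i.+1).+1 by lia.
by rewrite [iota i (_.+1)]/= rev_cons -cats1 catA tw_cat.
Qed.

Lemma mem_Qw i k : i <= r -> k \in Qw i -> i <= k <= r.
Proof. by move=> ir; rewrite /Qw mem_cat mem_rev !mem_iota; lia. Qed.

Lemma Q_far i k x : i <= r -> k.+1 < i -> Q i (t k x) = t k (Q i x).
Proof.
move=> ir ki; apply: tw_far; first lia.
by apply/allP => l /(mem_Qw ir); rewrite /far; lia.
Qed.

Lemma Q_tw i s x : i <= r -> all (fun k => k.+1 < i) s -> Q i (tw s x) = tw s (Q i x).
Proof.
move=> ir; elim: s => [|k s IH] //= /andP[ki /IH <-]; exact: Q_far.
Qed.

(** In [W_tau] the element [Q_(i+1)] is a conjugate of [r_r], so it stands to [t_i] as [t_r] does to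
    [t_(r-1)]. Since [Q_(i+1) = t_(i+1) Q_(i+2) t_(i+1)] and [Q_(i+2)] commutes with [t_i], the
    relation descends from [i = r-1]. *)
Lemma QQ_braid i x : 0 < i < r -> t i (Q i.+1 (t i (Q i.+1 x))) = Q i.+1 (t i (Q i.+1 (t i x))).
Proof.
move=> /andP[i0 ir]; have [m em] : exists m, r = i.+1 + m by exists (r - i.+1); lia.
elim: m i i0 ir em x => [|m IH] i i0 ir em x.
  have -> : i.+1 = r by lia.
  have -> : i = r.-1 by lia.
  by rewrite !Qr t_br4r //; lia.
rewrite !(@QS i.+1); try lia.
have F y : Q i.+2 (t i y) = t i (Q i.+2 y) by apply: Q_far; lia.
have B y : t i.+1 (t i (t i.+1 y)) = t i (t i.+1 (t i y)) by rewrite t_br3 //; lia.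
rewrite !B !F -(F (t i.+1 x)) -(F (t i.+1 (t i x))) -!B.
by rewrite IH //; lia.
Qed.

Lemma c_shift i k x : 0 < k -> k.+1 < i -> i <= r -> c i (t k x) = t k.+1 (c i x).
Proof.
by move=> k0 ki ir; rewrite !cE // Q_far // /G iota_shift //; lia.
Qed.

Lemma iter_c_shift i m k x : 0 < k -> k + m < i -> i <= r ->
  iter m (c i) (t k x) = t (k + m) (iter m (c i) x).
Proof.
elim: m k x => [|m IH] k x k0 ki ir; first by rewrite addn0.
by rewrite !iterS IH ?c_shift //; try lia; rewrite addnS.
Qed.

(** Each [c_i] raises the index of a letter by one, so the [m] letters can be distributed among the
    [m] factors, where each one becomes the [t_(i-1)] of [c_(i-1) = c_i t_(i-1)]. *)
Lemma iter_c i m x : m < i -> i <= r ->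
  iter m (c i) (tw (iota (i - m) m) x) = iter m (c i.-1) x.
Proof.
elim: m x => [|m IH] x mi ir //.
rewrite [iota _ _]/= [tw _ _]/= -/(tw _) iterS iter_c_shift //; try lia.
have -> : (i - m.+1).+1 = i - m by lia.
rewrite IH //; last lia.
have -> : i - m.+1 + m = i.-1 by lia.
by rewrite iterS (@cS i.-1) ?prednK //; lia.
Qed.

(* The conjugate of t_0 by t_1 .. t_m. *)
Fixpoint P (m : nat) (x : X) : X :=
  if m is m'.+1 then ti m (P m' (t m x)) else t 0 x.

Lemma PS m x : t m.+1 (P m.+1 x) = P m (t m.+1 x).
Proof. exact: tiK. Qed.

Lemma SP m x : tw (iota 1 m) (P m x) = G m.+1 x.
Proof.
elim: m x => [|m IH] x //; rewrite /G !(iota_rcons _ m) iota_rcons !tw_rcons PS.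
by rewrite IH /G iota_rcons tw_rcons.
Qed.

Lemma P_far m k x : m.+1 < k -> k <= r -> P m (t k x) = t k (P m x).
Proof.
elim: m x => [|m IH] x mk kr /=; first by rewrite t_far // /far; lia.
rewrite t_far ?IH ?ti_far //; rewrite /far; lia.
Qed.

Lemma P_tw m s x : all (fun k => m.+1 < k <= r) s -> P m (tw s x) = tw s (P m x).
Proof. by elim: s => [|k s IH] //= /andP[/andP[k1 k2] /IH <-]; exact: P_far. Qed.

(** Conjugation by [t_(m+2) t_(m+1)] carries the pair [P_(m+1)], [t_(m+2)] to [P_m], [t_(m+1)], so
    the relation between [t_0] and [t_1] propagates. *)
Lemma PP_braid m x : m.+1 < r ->
  t m.+1 (P m (t m.+1 (P m x))) = P m (t m.+1 (P m (t m.+1 x))).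
Proof.
elim: m x => [|m IH] x mr; first by rewrite /= t_br40 //; lia.
have B y : t m.+2 (t m.+1 (t m.+2 y)) = t m.+1 (t m.+2 (t m.+1 y)) by rewrite t_br3.
have F y : t m.+2 (P m y) = P m (t m.+2 y) by rewrite P_far //; lia.
apply: (@t_inj m.+1); apply: (@t_inj m.+2).
by rewrite !(B, PS, F) IH //; lia.
Qed.

Section Family.
(* b true k and b false k stand for B_k and B_(tau k), or for K_k and K_(tau k). *)
Variable b : bool -> nat -> X.
Hypothesis b_far : forall e k l, k <= r -> l <= r -> far k l -> t k (b e l) = b e l.
Hypothesis b_up : forall e k, 0 < k -> k.+1 < r -> t k (t k.+1 (b e k)) = b e k.+1.
Hypothesis b_dn : forall e k, 0 < k -> k.+1 < r -> t k.+1 (t k (b e k.+1)) = b e k.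
Hypothesis b_end : forall e, 1 < r -> t r (t r.-1 (t r (b e r.-1))) = b (~~ e) r.-1.
Hypothesis b_st : forall e, 1 < r -> t 0 (t 1 (t 0 (b e 1))) = b (~~ e) 1.
Hypothesis b_r : forall e, 1 < r -> t r.-1 (t r (t r.-1 (b e r))) = b e r.
Hypothesis b_0 : forall e, 1 < r -> t 1 (t 0 (t 1 (b e 0))) = b e 0.

Lemma tw_fix e s l : l <= r -> all (fun k => (k <= r) && far k l) s -> tw s (b e l) = b e l.
Proof.
by move=> lr; elim: s => [|k s IH] //= /andP[/andP[kr kl] /IH ->]; exact: b_far.
Qed.

Lemma Q_fix_far e i l : l.+1 < i -> i <= r -> Q i (b e l) = b e l.
Proof.
move=> li ir; apply: tw_fix; first lia.
by apply/allP => k /(mem_Qw ir); rewrite /far; lia.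
Qed.

(** [Q_(i+1)] acts on [b_i] as [t_r] does on [b_(r-1)]: the outer letters [t_(i+1)] are absorbed by
    [b_up] and [b_dn], which leaves the case [i+1]. *)
Lemma QtQ e i : 0 < i < r -> Q i.+1 (t i (Q i.+1 (b e i))) = b (~~ e) i.
Proof.
move=> /andP[i0 ir]; have [m em] : exists m, r = i.+1 + m by exists (r - i.+1); lia.
elim: m i i0 ir em => [|m IH] i i0 ir em.
  have E : i = r.-1 by lia.
  have {1 2}-> : i.+1 = r by lia.
  by rewrite !Qr E b_end //; lia.
rewrite !(@QS i.+1); try lia.
have F y : Q i.+2 (t i y) = t i (Q i.+2 y) by apply: Q_far; lia.
have B y : t i.+1 (t i (t i.+1 y)) = t i (t i.+1 (t i y)) by rewrite t_br3 //; lia.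
rewrite B F -(F (t i.+1 (b e i))) b_up; try lia.
by rewrite IH ?b_dn //; lia.
Qed.

Lemma Q_fix e i j : 0 < j -> j < i -> i <= r -> Q j (b e i) = b e i.
Proof.
move=> j0 ji ir; have [m em] : exists m, i = j.+1 + m by exists (i - j.+1); lia.
elim: m j j0 ji em => [|m IH] j j0 ji em.
  have [ir'|ir'] := eqVneq i r.
    have -> : j = r.-1 by lia.
    by rewrite QS ?prednK; try lia; rewrite Qr ir' b_r //; lia.
  have -> : i = j.+1 by lia.
  rewrite QS ?(@QS j.+1); try lia.
  by rewrite b_dn ?Q_fix_far ?b_up //; lia.
rewrite QS; last lia.
rewrite b_far ?IH ?b_far // /far; lia.
Qed.

Lemma G_fix e i l : i < l -> l <= r -> G i (b e l) = b e l.
Proof.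
move=> il lr; apply: tw_fix => //.
by apply/allP => k; rewrite mem_iota /far; lia.
Qed.

Lemma c_fix e i j : 0 < j -> j < i -> i <= r -> c j (b e i) = b e i.
Proof. by move=> j0 ji ir; rewrite cE ?Q_fix ?G_fix //; lia. Qed.

Lemma iter_c_fix e m i : m < i -> i <= r -> iter m (c m) (b e i) = b e i.
Proof.
move=> mi ir; case: m mi => // m mi.
by elim: {1}m.+1 => [|k IH] //; rewrite iterS IH c_fix.
Qed.

Lemma P_fix e m l : m.+1 < l -> l <= r -> P m (b e l) = b e l.
Proof.
elim: m => [|m IH] ml lr /=; first by rewrite b_far // /far; lia.
rewrite b_far ?IH; try (rewrite /far; lia).
by apply: (@t_inj m.+1); rewrite tiK b_far // /far; lia.
Qed.

(** The counterpart of [QtQ] at the node 0, transported from [m = 0] by [t_(m+2) t_(m+1)] as in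
    [PP_braid]. *)
Lemma PtP e m : m.+1 < r -> P m (t m.+1 (P m (b e m.+1))) = b (~~ e) m.+1.
Proof.
elim: m => [|m IH] mr; first by rewrite /= b_st //; lia.
have B y : t m.+2 (t m.+1 (t m.+2 y)) = t m.+1 (t m.+2 (t m.+1 y)) by rewrite t_br3.
have F y : t m.+2 (P m y) = P m (t m.+2 y) by rewrite P_far //; lia.
apply: (@t_inj m.+1); apply: (@t_inj m.+2).
rewrite !(PS, B, F) !b_dn //.
by rewrite IH //; lia.
Qed.

Lemma P_shift e m : m.+2 < r -> t m.+2 (t m.+1 (P m.+1 (b e m.+2))) = P m (b e m.+1).
Proof. by move=> mr; rewrite PS -P_far ?b_dn //; lia. Qed.

(** Here [c_m = G_(m+1) Q_(m+1) t_m]; the word [t_2 .. t_m] becomes [t_1 .. t_(m-1)] on passing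
    [G_(m+1)], commutes with [Q_(m+1)], and is completed by the final [t_m]. The resulting
    [t_1 .. t_m] is what [SP] cancels against [P_m]. *)
Lemma S2_c m x : 0 < m < r ->
  tw (iota 2 m.-1) (c m x) = G m.+1 (Q m.+1 (tw (iota 1 m) x)).
Proof.
case: m => // m mr; rewrite [_.-1]/= cE ?(@QS m.+1); try lia.
rewrite iota_rcons tw_rcons Q_tw; try lia; last first.
  by apply/allP => k; rewrite mem_iota; lia.
rewrite [G m.+2 _]iota_shifts //; try lia.
by rewrite [in RHS]iota_rcons tw_rcons.
Qed.

(** By [SP] and [S2_c] this expresses that [c_m] fixes [P_m b_(m+1)]. The length four relation
    between [t_0] and [t_1] rearranges the heads of the two copies of [G]; it makes
    [t_m Q_(m+1) t_m = Q_m] act directly on [b_(m+1)], which [Q_m] fixes. *)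
Lemma GQG e m : 0 < m -> m.+1 < r ->
  t 1 (G m.+1 (Q m.+1 (G m.+1 (b e m.+1)))) = G m.+1 (b e m.+1).
Proof.
case: m => // m _ mr; set B := b e m.+2.
have ES y : tw (iota 2 m) (t 0 y) = t 0 (tw (iota 2 m) y).
  by apply: tw_far => //; apply/allP => k; rewrite mem_iota /far; lia.
have EG y : G m.+2 y = t 0 (t 1 (tw (iota 2 m) y)) by [].
rewrite [G m.+2 B]/G iota_rcons tw_rcons Q_tw; try lia; last first.
  by apply/allP => k; rewrite mem_iota; lia.
rewrite EG [tw (iota 0 m.+1) _]/= -/(tw _) ES -t_br40; last lia.
have -> y : t 1 (tw (iota 2 m) y) = tw (iota 1 m.+1) y by [].
rewrite iota_shifts //; last lia.
have -> y : tw (iota 1 m.+1) y = tw (iota 1 m) (t m.+1 y) by rewrite iota_rcons tw_rcons.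
rewrite -[t m.+1 (Q _ _)](@QS m.+1); last lia.
have T k n : n + k < m.+2 -> tw (iota k n) (b e m.+2) = b e m.+2.
  by move=> kn; apply: tw_fix; [lia | apply/allP => l; rewrite mem_iota /far; lia].
rewrite /B Q_fix; try lia; rewrite [tw (iota 1 m) _]T; last lia.
rewrite -ES b_far //; try (rewrite /far; lia).
by rewrite -tw_rcons -iota_rcons.
Qed.

Lemma cP_fix e m : m.+1 < r -> 0 < m -> c m (P m (b e m.+1)) = P m (b e m.+1).
Proof.
move=> mr m0; apply: (@tw_inj (iota 1 m)); rewrite SP.
have SS y : tw (iota 1 m) y = t 1 (tw (iota 2 m.-1) y) by case: (m) m0.
rewrite SS S2_c ?SP ?GQG //; lia.
Qed.

Lemma iter_cP_fix e k m : m.+1 < r -> (0 < m) || (k == 0) ->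
  iter k (c m) (P m (b e m.+1)) = P m (b e m.+1).
Proof.
move=> mr; case: m mr => [|m] mr; first by move=> /eqP->.
by move=> _; elim: k => [|k IH] //; rewrite iterS IH cP_fix.
Qed.

(** [G_(m+1) = t_1 .. t_m P_m] by [SP], and [iter_c] absorbs [t_1 .. t_m] into the power of
    [c_(m+1)]. *)
Lemma iter_cG m x : m < r -> iter m (c m.+1) (G m.+1 x) = iter m (c m) (P m x).
Proof. by move=> mr; have := @iter_c m.+1 m (P m x) (ltnSn m) mr; rewrite subSnn SP. Qed.

(* T_(varpi'_(m+1)). *)
Definition Tp m x := iter m (c m.+1) (G m.+1 (t m.+1 (Q m.+2 x))).

Lemma iter_c_Tp m x : m.+1 < r -> iter m.+1 (c m.+1) x = Tp m (t m.+1 x).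
Proof. by move=> mr; rewrite iterSr cE ?(@QS m.+1) //; lia. Qed.

(** The collapse of the long word: [Q_(m+2)] commutes with [G_(m+1)], and with [c_(m+1)] by
    [QQ_braid], so it reaches [t_(m+1) Q_(m+2) b_(m+1)], where [QtQ] applies. By [iter_cG] what
    remains is a power of [c_m] acting on an element that [c_m] fixes. *)
Lemma Q_Tp e m : m.+1 < r -> Q m.+2 (Tp m (b e m.+1)) = P m (b (~~ e) m.+1).
Proof.
move=> mr; have QG y : Q m.+2 (G m.+1 y) = G m.+1 (Q m.+2 y).
  by apply: Q_tw => //; apply/allP => k; rewrite mem_iota; lia.
have Qc y : Q m.+2 (c m.+1 y) = c m.+1 (Q m.+2 y).
  rewrite !cE; try lia; rewrite QG; congr (G _ _).
  by rewrite !(@QS m.+1); try lia; rewrite QQ_braid //; lia.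
have Qi k y : Q m.+2 (iter k (c m.+1) y) = iter k (c m.+1) (Q m.+2 y).
  by elim: k => [|k IH] //; rewrite !iterS Qc IH.
rewrite /Tp Qi QG QtQ // iter_cG; last lia.
by rewrite iter_cP_fix //; case: (m).
Qed.

Lemma Tp_Tp e m : m.+1 < r -> Tp m (Tp m (b e m.+1)) = b e m.+1.
Proof.
move=> mr; rewrite [Tp m (Tp _ _)]/Tp Q_Tp // iter_cG; last lia.
by rewrite PtP // negbK iter_c_fix //; lia.
Qed.

(** [x] stands for [T_theta^-1(B_0)] or [T_theta(K_0)], both of which are handled only through their
    image under [t_1 .. t_(r-1)]. *)
Lemma c_fix_S e x : 1 < r -> tw (iota 1 r.-1) x = b e 0 -> c r.-1 x = x.
Proof.
move=> r1 Sx; apply: (@tw_inj (iota 1 r.-1)); rewrite Sx.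
have SS y : tw (iota 1 r.-1) y = t 1 (tw (iota 2 r.-2) y).
  by rewrite -[r.-1 in LHS]prednK //; lia.
rewrite SS S2_c; last lia.
rewrite prednK; last lia.
have Z : t r (b e 0) = b e 0 by apply: b_far; rewrite ?/far; lia.
rewrite Qr Sx Z -[RHS](b_0 e r1); congr (t 1 _).
have -> y : G r y = t 0 (t 1 (tw (iota 2 r.-2) y)).
  by rewrite /G -[r in iota 0 r](_ : r.-2.+2 = r) //; lia.
by rewrite tw_fix //; apply/allP => k; rewrite mem_iota /far; lia.
Qed.

(** In the Weyl group this word carries the simple root of index [n+1] to that of index 1. It serves
    to recognize [T_theta^-1(B_0)] in [Bh_U]. *)
Lemma tw_iota2_fix e n : n.+1 < r -> tw (iota 2 n) (tw (iota 1 n) (b e n.+1)) = b e 1.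
Proof.
elim: n => [|n IH] nr //; rewrite !iota_rcons !tw_rcons.
rewrite -[t (2 + n) (tw _ _)]tw_far; first last.
- by apply/allP => k; rewrite mem_iota /far; lia.
- lia.
by rewrite b_dn // IH //; lia.
Qed.
End Family.

(** Splits [T_r] off [T_(varpi_r)]; the remaining factor will match the rank one [T_0]. *)
Lemma iter_cr x : 0 < r -> iter r (c r) x = iter r.-1 (c r.-1) (P r.-1 (t r x)).
Proof.
move=> r0; rewrite -[in iter r](prednK r0) iterSr cE // Qr -iter_cG ?prednK //.
Qed.

End Braid.

Import Order.TTheory GRing.Theory Num.Theory.
Local Open Scope ring_scope.

(** * Normalization in noncommutative algebras *)

Inductive sexp := SV | SVi | SVn of nat | SVin of nat | SN of nat | SAdd of sexp & sexp | SMul of sexp & sexp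
  | SOpp of sexp.
Inductive aexp := AVar of nat | A0 | A1 | AAdd of aexp & aexp | AOpp of aexp
  | AMul of aexp & aexp | AScale of sexp & aexp | APow of aexp & nat.

(* (c, (e, w)) stands for c v^e w, with w a word in the variables. *)
Definition ncterm := (int * (int * seq nat))%type.
Definition ncpoly := seq ncterm.

Definition nc_mulT (t u : ncterm) : ncterm :=
  (t.1 * u.1, (t.2.1 + u.2.1, t.2.2 ++ u.2.2)).
Definition nc_mul (p q : ncpoly) : ncpoly :=
  flatten [seq [seq nc_mulT t u | u <- q] | t <- p].

Fixpoint nc_ins (t : ncterm) (p : ncpoly) : ncpoly :=
  if p is u :: p' then
    if u.2 == t.2 then
      let c := u.1 + t.1 in if c == 0 then p' else (c, u.2) :: p'
    else u :: nc_ins t p'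
  else [:: t].
Definition nc_collect (p : ncpoly) : ncpoly := foldr nc_ins [::] p.

Fixpoint nc_of_s (s : sexp) : ncpoly :=
  match s with
  | SV => [:: (1, (1, [::]))]
  | SVi => [:: (1, (-1, [::]))]
  | SVn n => [:: (1, (n%:Z, [::]))]
  | SVin n => [:: (1, (- n%:Z, [::]))]
  | SN n => [:: (n%:Z, (0, [::]))]
  | SAdd s1 s2 => nc_of_s s1 ++ nc_of_s s2
  | SMul s1 s2 => nc_mul (nc_of_s s1) (nc_of_s s2)
  | SOpp s1 => nc_mul [:: (-1, (0, [::]))] (nc_of_s s1)
  end.
Fixpoint nc_of_a (a : aexp) : ncpoly :=
  match a with
  | AVar n => [:: (1, (0, [:: n]))]
  | A0 => [::]
  | A1 => [:: (1, (0, [::]))]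
  | AAdd a1 a2 => nc_of_a a1 ++ nc_of_a a2
  | AOpp a1 => nc_mul [:: (-1, (0, [::]))] (nc_of_a a1)
  | AMul a1 a2 => nc_collect (nc_mul (nc_of_a a1) (nc_of_a a2))
  | AScale s a1 => nc_mul (nc_of_s s) (nc_of_a a1)
  | APow a1 n => iter n (nc_mul (nc_of_a a1)) [:: (1, (0, [::]))]
  end.

Fixpoint nc_cut (l w : seq nat) : option (seq nat) :=
  match l, w with
  | [::], _ => Some w
  | i :: l', j :: w' => if i == j then nc_cut l' w' else None
  | _, _ => None
  end.
Definition ncrules := seq (seq nat * ncpoly).
Fixpoint nc_head (R : ncrules) (w : seq nat) : option (ncpoly * seq nat) :=
  if R is (l, p) :: R' then
    if nc_cut l w is Some z then Some (p, z) else nc_head R' w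
  else None.
Fixpoint nc_find (R : ncrules) (w : seq nat) : option (seq nat * ncpoly * seq nat) :=
  if nc_head R w is Some (p, z) then Some ([::], p, z)
  else if w is i :: w' then
    if nc_find R w' is Some (u, p, z) then Some (i :: u, p, z) else None
  else None.
Definition nc_step (R : ncrules) (t : ncterm) : ncpoly :=
  if nc_find R t.2.2 is Some (u, p, z) then
    nc_mul [:: (t.1, (t.2.1, u))] (nc_mul p [:: (1, (0, z))])
  else [:: t].
Fixpoint nc_red (n : nat) (R : ncrules) (p : ncpoly) : ncpoly :=
  if n is n'.+1 then
    if p is [::] then [::]
    else nc_red n' R (nc_collect (flatten (map (nc_step R) p)))
  else p.

(** Only a hypothesis whose left side is a single word with coefficient 1 becomes a rule; dropping
    any other one is sound. *)
Definition nc_rule (lr : aexp * aexp) : option (seq nat * ncpoly) :=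
  if nc_of_a lr.1 is [:: (Posz 1, (Posz 0, w))] then Some (w, nc_collect (nc_of_a lr.2)) else None.
(** A sufficient test: soundness asks for neither termination nor confluence of the rules, and [n]
    merely bounds the number of passes. *)
Definition nc_check (n : nat) (rules : seq (aexp * aexp)) (l r : aexp) : bool :=
  nc_red n (pmap nc_rule rules) (nc_collect (nc_of_a (AAdd l (AOpp r)))) == [::].

Section NCSound.
Variables (F : fieldType) (A : algType F) (v : F) (v_neq0 : v != 0) (env : seq A).

Fixpoint sval (s : sexp) : F :=
  match s with
  | SV => v | SVi => v^-1 | SVn n => v ^+ n | SVin n => v ^- n | SN n => n%:R
  | SAdd s1 s2 => sval s1 + sval s2 | SMul s1 s2 => sval s1 * sval s2
  | SOpp s1 => - sval s1
  end.
Fixpoint aval (a : aexp) : A :=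
  match a with
  | AVar n => nth 0 env n | A0 => 0 | A1 => 1
  | AAdd a1 a2 => aval a1 + aval a2 | AOpp a1 => - aval a1
  | AMul a1 a2 => aval a1 * aval a2 | AScale s a1 => sval s *: aval a1
  | APow a1 n => aval a1 ^+ n
  end.

Definition nc_word (w : seq nat) : A := \prod_(i <- w) nth 0 env i.
Definition nc_termv (t : ncterm) : A := (t.1%:~R * v ^ t.2.1) *: nc_word t.2.2.
Definition nc_val (p : ncpoly) : A := \sum_(t <- p) nc_termv t.

Lemma nc_val_nil : nc_val [::] = 0. Proof. exact: big_nil. Qed.
Lemma nc_val_cons t p : nc_val (t :: p) = nc_termv t + nc_val p.
Proof. exact: big_cons. Qed.
Lemma nc_val1 t : nc_val [:: t] = nc_termv t. Proof. exact: big_seq1. Qed.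
Lemma nc_val_cat p q : nc_val (p ++ q) = nc_val p + nc_val q.
Proof. exact: big_cat. Qed.
Lemma nc_val_one : nc_val [:: (1, (0, [::]))] = 1.
Proof. by rewrite nc_val1 /nc_termv /= mul1r expr0z scale1r /nc_word big_nil. Qed.

Lemma nc_mulTE t u : nc_termv (nc_mulT t u) = nc_termv t * nc_termv u.
Proof.
rewrite /nc_termv /= -scalerAl -scalerAr scalerA /nc_word big_cat /=.
by rewrite intrM expfzDr // mulrACA.
Qed.

Lemma nc_mulE p q : nc_val (nc_mul p q) = nc_val p * nc_val q.
Proof.
rewrite /nc_val /nc_mul big_flatten /= big_map mulr_suml; apply: eq_bigr => t _.
by rewrite big_map mulr_sumr; apply: eq_bigr => u _; rewrite nc_mulTE.
Qed.

Lemma nc_insE t p : nc_val (nc_ins t p) = nc_termv t + nc_val p.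
Proof.
elim: p => [|u p IH] /=; first by rewrite nc_val1 nc_val_nil addr0.
case: eqP => [E|_]; last by rewrite !nc_val_cons IH addrCA.
have D : nc_termv (u.1 + t.1, u.2) = nc_termv t + nc_termv u.
  by rewrite /nc_termv /= -E rmorphD /= mulrDl scalerDl addrC.
case: eqP => [c0|_]; rewrite ?nc_val_cons addrA -D //.
by rewrite /nc_termv c0 mul0r scale0r add0r.
Qed.

Lemma nc_collectE p : nc_val (nc_collect p) = nc_val p.
Proof. by elim: p => [|t p IH] //=; rewrite nc_insE IH nc_val_cons. Qed.

Lemma nc_val_opp p : nc_val (nc_mul [:: (-1, (0, [::]))] p) = - nc_val p.
Proof.
rewrite nc_mulE nc_val1 /nc_termv /= expr0z mulr1 /nc_word big_nil.
by rewrite scaleN1r mulN1r.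
Qed.

Lemma nc_of_sE s : nc_val (nc_of_s s) = (sval s)%:A.
Proof.
have W (t : ncterm) : t.2.2 = [::] -> nc_termv t = (t.1%:~R * v ^ t.2.1)%:A.
  by rewrite /nc_termv => ->; rewrite /nc_word big_nil.
elim: s => [||n|n|n|s1 I1 s2 I2|s1 I1 s2 I2|s1 I1] /=.
- by rewrite nc_val1 W //= mul1r expr1z.
- by rewrite nc_val1 W //= mul1r exprN1.
- by rewrite nc_val1 W //= mul1r.
- by rewrite nc_val1 W //= mul1r exprnN.
- by rewrite nc_val1 W //= expr0z mulr1.
- by rewrite nc_val_cat I1 I2 scalerDl.
- by rewrite nc_mulE I1 I2 -scalerAl mul1r scalerA.
- by rewrite nc_val_opp I1 scaleNr.
Qed.

Lemma nc_of_aE a : nc_val (nc_of_a a) = aval a.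
Proof.
elim: a => [n|||a1 I1 a2 I2|a1 I1|a1 I1 a2 I2|s a1 I1|a1 I1 n] /=.
- by rewrite nc_val1 /nc_termv /= mul1r expr0z scale1r /nc_word big_seq1.
- exact: nc_val_nil.
- exact: nc_val_one.
- by rewrite nc_val_cat I1 I2.
- by rewrite nc_val_opp I1.
- by rewrite nc_collectE nc_mulE I1 I2.
- by rewrite nc_mulE nc_of_sE I1 -scalerAl mul1r.
- by elim: n => [|n IH]; [exact: nc_val_one | rewrite iterS nc_mulE I1 IH exprS].
Qed.

Definition nc_valid (R : ncrules) := forall l p, (l, p) \in R -> nc_word l = nc_val p.

Lemma nc_cutP l w z : nc_cut l w = Some z -> w = l ++ z.
Proof.
elim: l w => [|i l IH] [|j w] //=; try by case=> ->.
by case: eqP => // -> /IH ->.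
Qed.

Lemma nc_stepE R t : nc_valid R -> nc_val (nc_step R t) = nc_termv t.
Proof.
move=> VR; rewrite /nc_step; case: t => c [e w] /=.
have H w' p z : nc_head R w' = Some (p, z) -> nc_word w' = nc_val p * nc_word z.
  elim: R VR => [|[l q] R' IH] //= VR.
  case E : (nc_cut l w') => [z'|].
    case=> <- <-; rewrite (nc_cutP E) /nc_word big_cat /= -/(nc_word _).
    by rewrite (VR l q) // mem_head.
  by apply: IH => l' p' lp; apply: VR; rewrite in_cons lp orbT.
have W0 : nc_word [::] = 1 by rewrite /nc_word big_nil.
have Fd u p z : nc_find R w = Some (u, p, z) ->
    nc_word w = nc_word u * (nc_val p * nc_word z).
  elim: w u => [|i w IH] u /=.
    case E : (nc_head R [::]) => [[p' z']|] // [<- <- <-].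
    by rewrite [LHS](H _ _ _ E) W0 mul1r.
  case E : (nc_head R (i :: w)) => [[p' z']|].
    by case=> <- <- <-; rewrite [LHS](H _ _ _ E) W0 mul1r.
  case E' : (nc_find R w) => [[[u' p'] z']|] // [<- Ep Ez].
  rewrite {1}/nc_word big_cons -/(nc_word w) (IH u') ?E' ?Ep ?Ez //.
  by rewrite mulrA /nc_word big_cons.
case E : (nc_find R w) => [[[u p] z]|]; last by rewrite nc_val1.
rewrite !nc_mulE !nc_val1 /nc_termv /= mul1r expr0z scale1r.
by rewrite -scalerAl -(Fd _ _ _ E).
Qed.

Lemma nc_redE n R p : nc_valid R -> nc_val (nc_red n R p) = nc_val p.
Proof.
move=> VR; elim: n p => [|n IH] // [|t p] //=.
rewrite IH nc_collectE nc_val_cat nc_stepE // nc_val_cons; congr (_ + _).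
elim: p => [|u p IHp] //=.
by rewrite nc_val_cat nc_stepE // nc_val_cons IHp.
Qed.

Fixpoint nc_hyps (rules : seq (aexp * aexp)) : Prop :=
  if rules is lr :: rules' then aval lr.1 = aval lr.2 /\ nc_hyps rules' else True.

Lemma nc_checkP n rules l r :
  nc_hyps rules -> nc_check n rules l r -> aval l = aval r.
Proof.
move=> H /eqP E; apply/eqP; rewrite -subr_eq0; apply/eqP.
have VR : nc_valid (pmap nc_rule rules).
  elim: rules H {E} => [|[a b] rules IH] //= [ab /IH {}IH].
  rewrite /nc_rule /=; case Ea : (nc_of_a a) => [|[c [e w]] q] //.
  case: c Ea => [[|[|c]]|c] //; case: e => [[|e]|e] // Ea; case: q Ea => // Ea.
  move=> l' p'; rewrite /= in_cons => /orP[/eqP[-> ->]|]; last exact: IH.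
  rewrite nc_collectE nc_of_aE -ab -nc_of_aE Ea nc_val1 /nc_termv /=.
  by rewrite mul1r expr0z scale1r.
have := nc_redE n (nc_collect (nc_of_a (AAdd l (AOpp r)))) VR.
by rewrite E nc_val_nil nc_collectE nc_of_aE /= => <-.
Qed.

End NCSound.

Ltac nc_index x env :=
  lazymatch env with
  | x :: _ => constr:(0%N)
  | _ :: ?e => let n := nc_index x e in constr:(S n)
  end.
Ltac nc_s v s :=
  lazymatch s with
  | v => constr:(SV)
  | v^-1 => constr:(SVi)
  | v ^+ ?n => constr:(SVn n)
  | v ^- ?n => constr:(SVin n)
  | 1 => constr:(SN 1)
  | ?n%:R => constr:(SN n)
  | ?a + ?b => let a' := nc_s v a in let b' := nc_s v b in constr:(SAdd a' b')
  | ?a * ?b => let a' := nc_s v a in let b' := nc_s v b in constr:(SMul a' b')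
  | - ?a => let a' := nc_s v a in constr:(SOpp a')
  end.
Ltac nc_a v env a :=
  lazymatch a with
  | 0 => constr:(A0)
  | 1 => constr:(A1)
  | ?x + ?y => let x' := nc_a v env x in let y' := nc_a v env y in constr:(AAdd x' y')
  | ?x * ?y => let x' := nc_a v env x in let y' := nc_a v env y in constr:(AMul x' y')
  | - ?x => let x' := nc_a v env x in constr:(AOpp x')
  | ?s *: ?x => let s' := nc_s v s in let x' := nc_a v env x in constr:(AScale s' x')
  | ?x ^+ ?n => let x' := nc_a v env x in constr:(APow x' n)
  | qcomm ?q ?x ?y => nc_a v env (x * y - q *: (y * x))
  | ?x => let n := nc_index x env in constr:(AVar n)
  end.
Ltac nc_r v env hs :=
  lazymatch hs with
  | (?hs', ?h) => let r := nc_r v env hs' in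
    lazymatch type of h with ?a = ?b =>
      let a' := nc_a v env a in let b' := nc_a v env b in constr:((a', b') :: r) end
  | tt => constr:(@nil (aexp * aexp))
  end.
Ltac nc_hypsP hs :=
  lazymatch hs with
  | (?hs', ?h) => split; [exact h | nc_hypsP hs']
  | tt => exact I
  end.
(* nc v0 env (tt, h1, ..., hn) proves an identity between noncommutative
   polynomials in env, rewriting words from left to right with h1, ..., hn;
   60 bounds the number of rewriting passes. *)
Ltac nc v0 env hs :=
  lazymatch type of v0 with is_true (?v != 0) =>
  lazymatch goal with |- ?l = ?r =>
    let l' := nc_a v env l in let r' := nc_a v env r in
    let rs := nc_r v env hs in
    let f := constr:(@nc_checkP _ _ v v0 env 60 rs l' r') in
    lazymatch type of f with _ -> _ -> ?g => change g end;
    refine (f _ _);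
    [nc_hypsP hs | vm_compute; reflexivity]
  end end.

(** * Rank two identities *)

Section Identities.
Variables (F : fieldType) (A : algType F) (v : F) (v0 : v != 0).
Local Notation "[ a , b ]_ q" := (qcomm q a b) (at level 0, q at level 2).
Local Notation q2 := (v + v^-1).

(** The commutator [(v - v^-1)^-1 *: (Kf - Kg)] will be treated as a single letter [k]. Its
    commutation rules then have Laurent polynomial coefficients in [v], the only ones that the
    normalization understands. *)
Lemma kcomm (a b c : F) (Kf Kg x : A) : v - v^-1 != 0 ->
  Kf * x = a *: (x * Kf) -> Kg * x = b *: (x * Kg) -> a - b = c * (v - v^-1) ->
  (v - v^-1)^-1 *: (Kf - Kg) * x
    = c *: (x * Kf) + b *: (x * ((v - v^-1)^-1 *: (Kf - Kg))).
Proof.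
move=> d0 ef eg ec; have -> : c = (v - v^-1)^-1 * (a - b) by rewrite ec mulrC mulfK.
rewrite -scalerAl mulrBl ef eg -scalerAr scalerA [b * _]mulrC -!scalerA -scalerDr.
by congr (_ *: _); rewrite mulrBr scalerBr scalerBl addrA subrK.
Qed.

(** For [f = B_k], [g = B_(tau k)] and [x = B_l] with [l] adjacent to [k], the element [- (Kfi * g)]
    is [T_k(B_k)] and [[x, f]_v] is [T_k(B_l)]: the identity reads [T_k [B_k, B_l]_v = B_l]. *)
Lemma mid_fg_qcomm (f g x Kf Kfi k : A) :
  Kf * Kfi = 1 -> k * Kfi = Kfi * k ->
  g * f = f * g + k -> g * x = x * g -> k * x = x * Kf + v^-1 *: (x * k) ->
  Kfi * g = v ^- 2 *: (g * Kfi) -> Kfi * f = v ^+ 2 *: (f * Kfi) ->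
  Kfi * x = v^-1 *: (x * Kfi) ->
  [- (Kfi * g), [x, f]_v]_v = x.
Proof.
move=> h1 h2 h3 h4 h5 h6 h7 h8.
nc v0 [:: f; g; x; Kf; Kfi; k] (tt, h1, h3, h4, h5, h6, h7, h8, esym h2).
Qed.

(** The Serre relation is oriented in two ways, with leading word [s s t] here and [t s s] in
    [serre_rule']; each identity takes the one that suits its other rules. *)
Lemma serre_rule (q : F) (s t u : A) : s ^+ 2 * t - q *: (s * t * s) + t * s ^+ 2 = u ->
  s * s * t = q *: (s * t * s) - t * s * s + u.
Proof. by move=> <-; rewrite -!mulrA -!expr2 addrACA addNr addr0 addrC subrK. Qed.

Lemma serre_rule' (q : F) (s t u : A) : s ^+ 2 * t - q *: (s * t * s) + t * s ^+ 2 = u ->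
  t * s * s = q *: (s * t * s) - s * s * t + u.
Proof. by move/serre_rule->; rewrite opprD addrA subrK opprB addrC subrK. Qed.

(* x, y play the roles of B_r, B_{r+1} and z that of a neighbour of y only. *)
Section End.
Variables (x y z Kx Ky : A).
Hypotheses (zx : x * z = z * x)
  (serre : y ^+ 2 * z - q2 *: (y * z * y) + z * y ^+ 2 = 0)
  (iserre_y : y ^+ 2 * x - q2 *: (y * x * y) + x * y ^+ 2
     = - (q2 *: (v *: (Ky * y) + v *: (y * Kx))))
  (iserre_x : x ^+ 2 * y - q2 *: (x * y * x) + y * x ^+ 2
     = - (q2 *: (v *: (Kx * x) + v *: (x * Ky))))
  (Kxx : Kx * x = v ^- 3 *: (x * Kx)) (Kxy : Kx * y = v ^+ 3 *: (y * Kx))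
  (Kyx : Ky * x = v ^+ 3 *: (x * Ky)) (Kyy : Ky * y = v ^- 3 *: (y * Ky))
  (Kxz : Kx * z = v^-1 *: (z * Kx)) (Kyz : Ky * z = v *: (z * Ky)).
Let M := [[z, y]_v, x]_v - Ky * z.

(** [M] is [T_r(z)]. *)
Lemma end_M_y : q2 != 0 -> M * y = y * M + v *: ([z, y]_v * Kx).
Proof.
move=> q20; apply/eqP; rewrite -subr_eq0; apply/eqP/(scalerI q20); rewrite scaler0 /M.
set Sl := y ^+ 2 * z - q2 *: (y * z * y) + z * y ^+ 2.
set Il := y ^+ 2 * x - q2 *: (y * x * y) + x * y ^+ 2.
set Ir := - (q2 *: (v *: (Ky * y) + v *: (y * Kx))).
(* A certificate: [[2]] times the difference of the two sides is this combination of one Serre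
   relation and one modified Serre relation, both of which vanish. *)
transitivity (v ^+ 2 *: ((Il - Ir) * z) - z * (Il - Ir) + Sl * x - v ^+ 2 *: (x * Sl)).
  rewrite /Sl /Il /Ir.
  by nc v0 [:: x; y; z; Kx; Ky] (tt, zx, Kyz, Kyy, Kyx, Kxx, Kxy, Kxz).
by rewrite /Sl serre /Il iserre_y subrr !(mulr0, mul0r, scaler0, oppr0, addr0).
Qed.

Lemma end_M_x : M * x = v^-1 *: (x * M).
Proof.
apply/eqP; rewrite -subr_eq0; apply/eqP; rewrite /M.
set Il := x ^+ 2 * y - q2 *: (x * y * x) + y * x ^+ 2.
set Ir := - (q2 *: (v *: (Kx * x) + v *: (x * Ky))).
transitivity (z * (Il - Ir) - v *: ((Il - Ir) * z)).
  rewrite /Il /Ir.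
  by nc v0 [:: x; y; z; Kx; Ky] (tt, zx, Kyz, Kyy, Kyx, Kxx, Kxy, Kxz).
by rewrite /Il iserre_x subrr !(mulr0, mul0r, scaler0, oppr0, addr0).
Qed.

Variables (Kxi Kyi : A).
Hypotheses (KxK : Kx * Kxi = 1) (KyK : Kyi * Ky = 1)
  (Kxiy : Kxi * y = v ^- 3 *: (y * Kxi)) (Kxix : Kxi * x = v ^+ 3 *: (x * Kxi))
  (Kxiz : Kxi * z = v *: (z * Kxi)) (KxiKy : Kxi * Ky = Ky * Kxi)
  (Kyiy : Kyi * y = v ^+ 3 *: (y * Kyi)) (Kyix : Kyi * x = v ^- 3 *: (x * Kyi))
  (Kyiz : Kyi * z = v^-1 *: (z * Kyi)).

Lemma end_T_qcomm : q2 != 0 -> [- (v ^- 2 *: (y * Kxi)), M]_v = [z, y]_v.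
Proof.
move=> q20; have h : Kxi * M = v *: (M * Kxi).
  by rewrite /M; nc v0 [:: x; y; z; Kx; Ky; Kxi] (tt, zx, Kxix, Kxiy, Kxiz, KxiKy, Kyz).
transitivity (v^-1 *: ((M * y - y * M) * Kxi)).
  by nc v0 [:: y; M; Kxi] (tt, h).
rewrite end_M_y // addrC addKr.
by nc v0 [:: y; z; Kx; Kxi] (tt, KxK).
Qed.

(** The left side is [T_r] of [[x, [y, z]_v]_v - v *: (Kx * z)], in view of [end_T_qcomm]; this
    exhibits a preimage of [z]. *)
Lemma end_T_inv : [- (v ^- 2 *: (x * Kyi)), [z, y]_v]_v - v *: ((v^-1 *: Kyi) * M) = z.
Proof.
rewrite /M.
by nc v0 [:: x; y; z; Kx; Ky; Kyi] (tt, KyK, Kyix, Kyiy, Kyiz).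
Qed.

End End.

(** For [o = B_0] and [f] adjacent to it, this is [T_0 [o, f]_v = f]. *)
Lemma T0_inv (o f Ko Koi : A) :
  Ko * Koi = 1 -> Koi * f = f * Koi -> Koi * o = o * Koi ->
  o ^+ 2 * f - q2 *: (o * f * o) + f * o ^+ 2 = - (v^-1 *: (f * Ko)) ->
  [Koi * o, [f, o]_v]_v = f.
Proof.
move=> h1 h2 h3 h4.
by nc v0 [:: o; f; Ko; Koi] (tt, h1, h2, h3, serre_rule h4).
Qed.

(* f = B_1, g = B_{2r}, o = B_0 and k = (K_1 - K_{2r}) / (v - v^-1). *)
Section Start.
Variables (f g o Kf Kfi k : A).
Hypotheses (gf : g * f = f * g + k)
  (serre_f : f ^+ 2 * o - q2 *: (f * o * f) + o * f ^+ 2 = 0)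
  (serre_g : g ^+ 2 * o - q2 *: (g * o * g) + o * g ^+ 2 = 0)
  (ko : k * o = o * k) (kf : k * f = v ^+ 2 *: (f * k) - q2 *: (f * Kf))
  (kg : k * g = v ^- 2 *: (g * k) + q2 *: (g * Kf))
  (Kfo : Kf * o = o * Kf) (Kff : Kf * f = v ^- 2 *: (f * Kf))
  (Kfg : Kf * g = v ^+ 2 *: (g * Kf))
  (KfK : Kf * Kfi = 1) (KfK' : Kfi * Kf = 1) (kKf : k * Kf = Kf * k) (kKfi : k * Kfi = Kfi * k)
  (Kfio : Kfi * o = o * Kfi) (Kfif : Kfi * f = v ^+ 2 *: (f * Kfi))
  (Kfig : Kfi * g = v ^- 2 *: (g * Kfi)).
Let O := [[o, f]_v, g]_v - v *: (o * Kf).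
Let fg : f * g = g * f - k. Proof. by rewrite gf addrK. Qed.

(** [Kf - (v - v^-1) *: k] is [K_(2r)], so [T_1(B_0)] has the same form whichever of the nodes 1 and
    2r is bracketed first. *)
Lemma start_T_sym : O = [[o, g]_v, f]_v - v *: (o * (Kf - (v - v^-1) *: k)).
Proof.
rewrite /O.
by nc v0 [:: f; g; o; Kf; k] (tt, gf, ko, Kfo).
Qed.

Lemma start_T_qcomm : [- (Kfi * g), O]_v = [o, g]_v.
Proof.
rewrite /O.
by nc v0 [:: f; g; o; Kf; Kfi; k] (tt, fg, ko, Kfo, Kff, kf, kg, Kfg, KfK, KfK',
  esym kKf, esym kKfi, Kfio, Kfif, Kfig, serre_rule' serre_g).
Qed.

(** The analogue of [end_T_inv] for [T_1]: the preimage of [o] is [[f, [g, o]_v]_v - v *: (o *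
    Kf)]. *)
Lemma start_T_inv : [- (Kfi * g), [o, f]_v]_v - v *: (O * (v ^- 2 *: Kfi)) = o.
Proof.
rewrite /O.
by nc v0 [:: f; g; o; Kf; Kfi; k] (tt, fg, ko, Kfo, Kff, kf, kg, Kfg, KfK, KfK',
  esym kKf, esym kKfi, Kfio, Kfif, Kfig, serre_rule' serre_g).
Qed.

(** [[g, o]_v] is [P_0(B_(2r))], and [[o, f]_v] is its image under [T_1]. The nonzero right side
    accounts for the correction term of [T_(varpi'_i)(B_i)] at [i = r - 1]. *)
Lemma start_serre :
  [g, o]_v * f ^+ 2 - q2 *: (f * [g, o]_v * f) + f ^+ 2 * [g, o]_v
  = - (q2 * v *: (Kf * [o, f]_v)).
Proof.
by nc v0 [:: f; g; o; Kf; k] (tt, gf, ko, Kfo, Kff, kf, kg, Kfg, serre_rule' serre_f).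
Qed.
End Start.

(** [[2]] times Lusztig's formula for the affine generators, which avoids divided powers; also equal
    to [[[u, f]_(v^2), f]_1]. *)
Definition lusztig_op (f u : A) : A :=
  u * f ^+ 2 - (1 + v ^+ 2) *: (f * u * f) + v ^+ 2 *: (f ^+ 2 * u).

(** A second order Leibniz rule. With [D_q u = u f - q f u] the operator is [D_1 D_(v^2)]; on [a b]
    and on [b a] the terms where [f] acts twice on one factor contain [D_(v^-1) D_v], which is the
    Serre expression, and the mixed terms add up with coefficient [v + v^-1]. *)
Lemma lusztig_op_qcomm (f a b : A) :
  f ^+ 2 * a - q2 *: (f * a * f) + a * f ^+ 2 = 0 ->
  f ^+ 2 * b - q2 *: (f * b * f) + b * f ^+ 2 = 0 ->
  lusztig_op f [a, b]_v = q2 *: [[a, f]_v, [b, f]_v]_v.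
Proof.
move=> ha hb; rewrite /lusztig_op.
by nc v0 [:: f; a; b] (tt, serre_rule' ha, serre_rule' hb).
Qed.

Lemma lusztig_opKp (f p K Kf p' : A) :
  K * f = v *: (f * K) -> 
  p * f ^+ 2 - q2 *: (f * p * f) + f ^+ 2 * p = - (q2 * v *: (Kf * p')) ->
  lusztig_op f (K * p) = - (q2 * v *: (K * (Kf * p'))).
Proof.
move=> Kf1 E.
transitivity (K * (p * f ^+ 2 - q2 *: (f * p * f) + f ^+ 2 * p)).
  by rewrite /lusztig_op; nc v0 [:: f; p; K] (tt, Kf1).
rewrite E; by nc v0 [:: K; Kf; p'] tt.
Qed.

Section BigIdentity.
Variables (b c o x y Kx Ky Kb : A).
Let be := [b, x]_v.
Let ga := [c, y]_v.
Let M := [be, y]_v - Kx * b.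
Let N := [ga, x]_v - Ky * c.
Let G := [b, c]_v - v *: (o * Kb).
Hypotheses (yb : b * y = y * b) (xc : c * x = x * c) (ox : o * x = x * o) (oy : o * y = y * o)
  (bex : be * x = v^-1 *: (x * be)) (gay : ga * y = v^-1 *: (y * ga))
  (Mx : M * x = x * M + v *: (be * Ky)) (My : M * y = v^-1 *: (y * M))
  (Ny : N * y = y * N + v *: (ga * Kx)) (Nx : N * x = v^-1 *: (x * N))
  (iserre_x : x ^+ 2 * y - q2 *: (x * y * x) + y * x ^+ 2
     = - (q2 *: (v *: (Kx * x) + v *: (x * Ky))))
  (iserre_y : y ^+ 2 * x - q2 *: (y * x * y) + x * y ^+ 2
     = - (q2 *: (v *: (Ky * y) + v *: (y * Kx))))
  (Kxx : Kx * x = v ^- 3 *: (x * Kx)) (Kxy : Kx * y = v ^+ 3 *: (y * Kx))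
  (Kyx : Ky * x = v ^+ 3 *: (x * Ky)) (Kyy : Ky * y = v ^- 3 *: (y * Ky))
  (Kxb : Kx * b = v *: (b * Kx)) (Kyb : Ky * b = v^-1 *: (b * Ky))
  (Kxc : Kx * c = v^-1 *: (c * Kx)) (Kyc : Ky * c = v *: (c * Ky))
  (Kxo : Kx * o = o * Kx) (Kyo : Ky * o = o * Ky)
  (Kbx : Kb * x = v *: (x * Kb)) (Kby : Kb * y = v^-1 *: (y * Kb))
  (KxKy : Kx * Ky = Ky * Kx) (KbKx : Kb * Kx = Kx * Kb) (KbKy : Kb * Ky = Ky * Kb).

(** With [G = T_theta^-1(B_0)], the left side is [T_r(G)] computed factor by factor, since
    [M = T_r(b)] and [N = T_r(c)], and the right side is the rank one formula for [T_1(B_0)] with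
    [G] in place of [B_0]. *)
Lemma big_identity :
  [M, N]_v - v *: (o * (v *: (Kb * Kx * Ky)))
  = v *: [[[G, x]_v, y]_1, [y, x]_v]_1 - [G, [y, x]_(v ^+ 3)]_1 * Kx + v *: (G * Kx * Ky).
Proof.
(* [be], [ga], [M] and [N] are kept as letters of their own: these rules contract words in [b], [c]
   to them, and the hypotheses move [x] and [y] to their left. *)
have bx : b * x = be + v *: (x * b) by rewrite /be /qcomm subrK.
have cy : c * y = ga + v *: (y * c) by rewrite /ga /qcomm subrK.
have bey : be * y = M + Kx * b + v *: (y * be) by rewrite /M /qcomm !subrK.
have gax : ga * x = N + Ky * c + v *: (x * ga) by rewrite /N /qcomm !subrK.
have Kxbe : Kx * be = v ^- 2 *: (be * Kx) by rewrite /be; nc v0 [:: b; x; Kx] (tt, Kxb, Kxx).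
have Kybe : Ky * be = v ^+ 2 *: (be * Ky) by rewrite /be; nc v0 [:: b; x; Ky] (tt, Kyb, Kyx).
have Kxga : Kx * ga = v ^+ 2 *: (ga * Kx) by rewrite /ga; nc v0 [:: c; y; Kx] (tt, Kxc, Kxy).
have Kyga : Ky * ga = v ^- 2 *: (ga * Ky) by rewrite /ga; nc v0 [:: c; y; Ky] (tt, Kyc, Kyy).
have KxM : Kx * M = v *: (M * Kx).
  by rewrite /M; nc v0 [:: b; be; y; Kx] (tt, Kxb, Kxbe, Kxy).
have KyM : Ky * M = v^-1 *: (M * Ky).
  by rewrite /M; nc v0 [:: b; be; y; Kx; Ky] (tt, Kyb, Kybe, Kyy, esym KxKy).
have KxN : Kx * N = v^-1 *: (N * Kx).
  by rewrite /N; nc v0 [:: c; ga; x; Kx; Ky] (tt, Kxc, Kxga, Kxx, KxKy).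
rewrite /G.
nc v0 [:: b; c; o; x; y; Kx; Ky; Kb; M; N; be; ga]
 (tt, yb, xc, ox, oy, bex, gay, Mx, My, Ny, Nx, bx, cy, bey, gax, Kxbe, Kybe, Kxga, Kyga, KxM, KyM, KxN,
  Kxx, Kxy, Kyx, Kyy, Kxb, Kyb, Kxc, Kyc, Kxo, Kyo, Kbx, Kby, KxKy, KbKx, KbKy,
  serre_rule iserre_x, serre_rule' iserre_y).
Qed.
End BigIdentity.

End Identities.

(** * The affine Weyl group as permutations of Z *)

Section Cox.
Variable r : nat.
Hypothesis r_gt0 : (0 < r)%N.
Local Notation n := r.*2.+1.
Local Notation N := (n%:Z).
Implicit Types (x y z : int) (M : 'M[int]_n).

Let n_ge3 : (3 <= n)%N. Proof. lia. Qed.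

Lemma dvdN t : - N < t -> t < N -> (N %| t)%Z = (t == 0).
Proof.
move=> t1 t2; apply/idP/eqP => [/dvdzP[q tq]|->]; last exact: dvdz0.
by rewrite tq; have -> : q = 0 by nia.
Qed.

Lemma dvdzD_l (d a b : int) : (d %| a)%Z -> (d %| a + b)%Z = (d %| b)%Z.
Proof. exact: rpredDl. Qed.
Lemma dvdz_opp (d a : int) : (d %| - a)%Z = (d %| a)%Z.
Proof. exact: rpredN. Qed.

Lemma dvdN2 t : - N *+ 2 < t -> t < N *+ 2 -> (N %| t)%Z = [|| t == 0, t == N | t == - N].
Proof.
move=> t1 t2; apply/idP/or3P => [/dvdzP[q tq]|].
  have : q = 0 \/ q = 1 \/ q = -1 by nia.
  case=> [E|[E|E]]; rewrite E in tq; [apply: Or31|apply: Or32|apply: Or33]; lia.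
by case=> /eqP->; rewrite ?dvdz0 ?dvdz_opp ?dvdzz.
Qed.

(* wt x is the weight eps_x normalized by eps_(x+n) = eps_x - delta, so that
   wt x - wt (x + 1) is the simple root indexed by x mod n. *)
Definition wt x : 'cV[int]_n := \col_k - ((x - 1 - k%:Z) %/ N)%Z.
Definition rt x : 'cV[int]_n := \col_k (N %| x - k%:Z)%Z%:R.

Lemma divz_succ t : ((t + 1) %/ N)%Z - (t %/ N)%Z = (N %| t + 1)%Z%:R.
Proof.
have n0 : N != 0 by [].
have := divz_eq t N; have := modz_ge0 t n0; have := @ltz_pmod t N isT.
set q := (t %/ N)%Z; set m := (t %% N)%Z => m1 m2 E.
have [mN|mN] := eqVneq m (N - 1).
  have -> : t + 1 = (q + 1) * N by rewrite E mN; lia.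
  by rewrite mulzK // dvdz_mull // addrC addKr.
have D : (((t + 1) %/ N)%Z = q).
  have -> : t + 1 = q * N + (m + 1) by lia.
  by rewrite divzMDl // divz_small ?addr0 //; lia.
rewrite D subrr; have -> : t + 1 = q * N + (m + 1) by lia.
by rewrite dvdzD_l ?dvdz_mull // dvdN; lia.
Qed.

Lemma wt_succ x : wt x - wt (x + 1) = rt x.
Proof.
apply/colP => k; rewrite !mxE; have -> : x - k%:Z = x - 1 - k%:Z + 1 by lia.
by rewrite -divz_succ addrC opprK (_ : x + 1 - 1 - k%:Z = x - 1 - k%:Z + 1) //; lia.
Qed.

Definition ht (u : 'cV[int]_n) : int := \sum_k u k 0.

Lemma ht_rt x : ht (rt x) = 1.
Proof.
have n0 : N != 0 by [].
have m1 := modz_ge0 x n0; have m2 := @ltz_pmod x N isT.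
have kP : (`|(x %% N)%Z| < n)%N by lia.
rewrite /ht (bigD1 (Ordinal kP)) //= mxE /= big1 => [|k kx].
  by rewrite addr0 gez0_abs // -eqz_mod_dvd modz_mod eqxx.
rewrite mxE -eqz_mod_dvd; case: eqP => // E; case/eqP: kx; apply: val_inj.
by rewrite /= E modz_small //; have := ltn_ord k; lia.
Qed.

Lemma htB u w : ht (u - w) = ht u - ht w.
Proof. by rewrite /ht -sumrB; apply: eq_bigr => k _; rewrite !mxE. Qed.

Lemma int_succ_ind (p : int -> Prop) : p 0 -> (forall x, p x <-> p (x + 1)) -> forall x, p x.
Proof.
move=> p0 pS; elim/int_rec => [//|m IH|m IH].
  have -> : m.+1%:Z = m%:Z + 1 by lia.
  exact: (pS _).1.
apply: (pS _).2; have -> : - m.+1%:Z + 1 = - m%:Z by lia.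
exact: IH.
Qed.

(** Indices can be read off differences of weights; this is how equal matrices yield equal
    permutations. *)
Lemma ht_wt x y : ht (wt x - wt y) = y - x.
Proof.
have H z : ht (wt z) = ht (wt 0) - z.
  elim/int_succ_ind: z => [|z]; first by rewrite subr0.
  have := ht_rt z; rewrite -wt_succ htB => E; split; lia.
by rewrite htB (H x) (H y); lia.
Qed.

(** Only differences of the [wt x] are constrained, so [f] is determined up to an additive constant;
    [fw_mid] removes this ambiguity. *)
Definition acts M (f : int -> int) :=
  forall x y, M *m (wt x - wt y) = wt (f x) - wt (f y).

Lemma acts_rt M f : (forall x, M *m rt x = wt (f x) - wt (f (x + 1))) -> acts M f.
Proof.
move=> H.
have H0 z : M *m (wt 0 - wt z) = wt (f 0) - wt (f z).
  elim/int_succ_ind: z => [|z]; first by rewrite !subrr mulmx0.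
  have E : wt 0 - wt (z + 1) = (wt 0 - wt z) + rt z by rewrite -wt_succ addrA subrK.
  have E' : wt (f 0) - wt (f (z + 1)) = (wt (f 0) - wt (f z)) + (wt (f z) - wt (f (z + 1))).
    by rewrite addrA subrK.
  rewrite E E' (mulmxDr M (wt 0 - wt z)) H; split=> [->//|]; exact: addIr.
move=> x y; have -> : wt x - wt y = (wt 0 - wt y) - (wt 0 - wt x) by rewrite opprB [RHS]addrC addrA subrK.
by rewrite mulmxBr !H0 opprB [LHS]addrC addrA subrK.
Qed.

Lemma acts1 : acts 1 id. Proof. by move=> x y; rewrite mul1mx. Qed.
Lemma actsM M1 M2 f1 f2 : acts M1 f1 -> acts M2 f2 -> acts (M1 * M2) (f1 \o f2).
Proof. by move=> a1 a2 x y; rewrite -mulmxA a2 a1. Qed.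
Lemma acts_fun M f g x y : acts M f -> acts M g -> f x - f y = g x - g y.
Proof.
move=> af ag; have := ht_wt (f x) (f y); rewrite -af ag ht_wt; lia.
Qed.

Lemma rt_ord (i : 'I_n) x : (N %| x - i%:Z)%Z -> rt x = delta_mx i 0.
Proof.
move=> ix; apply/colP => k; rewrite !mxE eqxx andbT.
have -> : x - k%:Z = (x - i%:Z) + (i%:Z - k%:Z) by lia.
rewrite dvdzD_l //; have := ltn_ord i; have := ltn_ord k => k1 i1.
rewrite dvdN; try lia.
by rewrite subr_eq0 eqz_nat eq_sym.
Qed.

Lemma acts_eq M1 M2 f : acts M1 f -> acts M2 f -> M1 = M2.
Proof.
move=> a1 a2; apply/matrixP => k j.
have rj : rt j = delta_mx j 0 by apply: rt_ord; rewrite subrr.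
have H M : col j M = M *m rt j by rewrite rj colE.
have : col j M1 = col j M2 by rewrite !H -wt_succ a1 a2.
by move/colP/(_ k); rewrite !mxE.
Qed.

(** The affine simple transposition, exchanging [i + mN] and [i + 1 + mN] for every [m]. *)
Definition sf (i : int) x : int := x + (N %| x - i)%Z%:R - (N %| x - i - 1)%Z%:R.

Lemma res x : exists j : 'I_n, (N %| x - j%:Z)%Z.
Proof.
have n0 : N != 0 by [].
have m1 := modz_ge0 x n0; have m2 := @ltz_pmod x N isT.
have kP : (`|(x %% N)%Z| < n)%N by lia.
by exists (Ordinal kP); rewrite /= gez0_abs // -eqz_mod_dvd modz_mod.
Qed.

Lemma cartanE (i j : 'I_n) : cartan i j =
  if i == j then 2 else if (N %| i%:Z + 1 - j%:Z)%Z || (N %| j%:Z + 1 - i%:Z)%Z then -1 else 0.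
Proof.
rewrite /cartan; have H (a b : nat) : (a.+1 == b %[mod n])%N = (N %| a%:Z + 1 - b%:Z)%Z.
  by rewrite -eqz_mod_dvd -[_ + 1]/(_%:Z + 1%:Z) -PoszD addn1 !modz_nat eqz_nat.
by rewrite !H.
Qed.

Lemma acts_refl (i : 'I_n) : acts (refl i) (sf i).
Proof.
apply: acts_rt => x; have [j jx] := res x.
have E : refl i *m rt x = rt x - cartan i j *: rt i.
  rewrite !(rt_ord jx) (@rt_ord i i%:Z) ?subrr //.
  apply/colP => k; rewrite -colE !mxE !eqxx !andbT.
  by rewrite mulrC.
rewrite E cartanE.
have D (a b : int) : (N %| a - b)%Z -> rt a = rt b.
  move=> ab; apply/colP => k; rewrite !mxE.
  have -> : a - k%:Z = (a - b) + (b - k%:Z) by lia.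
  by rewrite dvdzD_l.
have Dj (a b : int) : x - j%:Z + a = b -> (N %| b)%Z = (N %| a)%Z by move=> <-; rewrite dvdzD_l.
have ij1 := ltn_ord i; have ij2 := ltn_ord j.
rewrite /sf (Dj (j%:Z - i%:Z) (x - i%:Z)); last lia.
rewrite (Dj (j%:Z - i%:Z - 1) (x - i%:Z - 1)); last lia.
rewrite (Dj (j%:Z - i%:Z + 1) (x + 1 - i%:Z)); last lia.
rewrite (Dj (j%:Z - i%:Z) (x + 1 - i%:Z - 1)); last lia.
have -> : (N %| i%:Z + 1 - j%:Z)%Z = (N %| j%:Z - i%:Z - 1)%Z by rewrite -dvdz_opp (_ : - _ = j%:Z - i%:Z - 1) //; lia.
have -> : j%:Z + 1 - i%:Z = j%:Z - i%:Z + 1 by lia.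
have W2 (a : int) : wt (a - 1) - wt (a + 1) = rt (a - 1) + rt a.
  by rewrite -!wt_succ subrK addrA subrK.
have [ij|nij] := eqVneq i j.
  rewrite ij subrr dvdz0 add0r !dvdN; try lia.
  rewrite (_ : x + _ - _ = x + 1); last lia.
  rewrite (_ : x + 1 - _ = x); last lia.
  rewrite -[RHS]opprB wt_succ (D j%:Z x); last by rewrite -dvdz_opp opprB.
  by rewrite scaler_nat mulr2n opprD addrA subrr add0r.
have nd : (N %| j%:Z - i%:Z)%Z = false.
  by rewrite dvdN; try lia; apply/eqP => E'; case/eqP: nij; apply: val_inj => /=; lia.
rewrite nd; case: ifPn => [/orP[h|h]|/norP[/negPf-> /negPf->]]; first last.
- by rewrite scale0r !(subr0, addr0) wt_succ.
(* [j] cannot follow and precede [i] at once: [N >= 3] would divide 2. *)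
- have -> : (N %| j%:Z - i%:Z - 1)%Z = false.
    apply/negbTE/negP; rewrite -dvdz_opp => h'; have := rpredD h h'.
    by rewrite (_ : _ + _ = 2) ?dvdN; lia.
  rewrite h scaleN1r opprK (_ : x + _ - _ = x + 1 - 1); last lia.
  rewrite (_ : x + 1 + _ - _ = x + 1 + 1); last lia.
  rewrite W2 addrK; congr (_ + _); apply: D.
  have -> : i%:Z - (x + 1) = - ((x - j%:Z) + (j%:Z - i%:Z + 1)) by lia.
  by rewrite dvdz_opp dvdzD_l.
- have -> : (N %| j%:Z - i%:Z + 1)%Z = false.
    apply/negbTE/negP => h'; have : (N %| - (j%:Z - i%:Z - 1) + (j%:Z - i%:Z + 1))%Z by rewrite dvdzD_l ?dvdz_opp.
    by rewrite (_ : _ + _ = 2) ?dvdN; lia.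
  rewrite h scaleN1r opprK (_ : x + _ - _ = x - 1); last lia.
  rewrite (_ : x + 1 + _ - _ = x + 1); last lia.
  rewrite W2 addrC; congr (_ + _); apply: D.
  have -> : i%:Z - (x - 1) = - ((x - j%:Z) + (j%:Z - i%:Z - 1)) by lia.
  by rewrite dvdz_opp dvdzD_l.
Qed.

Lemma sf_add i x (m : int) : sf i (x + m * N) = sf i x + m * N.
Proof.
have D : (N %| m * N)%Z by apply/dvdzP; exists m.
have H a : (N %| x + m * N - a)%Z = (N %| x - a)%Z by rewrite addrAC addrC (dvdzD_l _ D).
rewrite /sf; have -> : x + m * N - i - 1 = x + m * N - (i + 1) by lia.
rewrite !H (_ : x - (i + 1) = x - i - 1); lia.
Qed.

Lemma sfE (i x : int) : - N *+ 2 < x - i - 1 -> x - i < N *+ 2 ->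
  sf i x = if [|| x == i, x == i + N | x == i - N] then x + 1 else
           if [|| x == i + 1, x == i + 1 + N | x == i + 1 - N] then x - 1 else x.
Proof.
move=> h1 h2; rewrite /sf !dvdN2; try lia.
have -> : [|| x - i == 0, x - i == N | x - i == - N] = [|| x == i, x == i + N | x == i - N] by lia.
have -> : [|| x - i - 1 == 0, x - i - 1 == N | x - i - 1 == - N]
  = [|| x == i + 1, x == i + 1 + N | x == i + 1 - N] by lia.
by case: ifP => a; [|case: ifP => b]; lia.
Qed.

Definition rf (k : nat) x : int :=
  if k == 0%N then sf 0 x else
  if (k < r)%N then sf k%:Z (sf (N - k%:Z) x) else sf r%:Z (sf (r%:Z + 1) (sf r%:Z x)).

Lemma rf_add k x (m : int) : rf k (x + m * N) = rf k x + m * N.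
Proof. by rewrite /rf; case: ifP => // _; [|case: ifP => // _]; rewrite !sf_add. Qed.

Lemma rf0E x : - r%:Z <= x <= r%:Z + 1 ->
  rf 0 x = if x == 0 then 1 else if x == 1 then 0 else x.
Proof.
move=> xr; rewrite /rf /= sfE; try lia.
by case: ifP => a; [|case: ifP => b]; repeat case: ifP; lia.
Qed.

Lemma rfkE (k : nat) x : (0 < k < r)%N -> - r%:Z <= x <= r%:Z + 1 ->
  rf k x = if x == k%:Z then k%:Z + 1 else if x == k%:Z + 1 then k%:Z else
    if x == - k%:Z then 1 - k%:Z else if x == 1 - k%:Z then - k%:Z else x.
Proof.
move=> kr xr; rewrite /rf; case: ifP => [|_]; first lia.
case: ifP => [_|]; last lia.
rewrite (@sfE (N - k%:Z)); try lia.
case: ifP => a; [|case: ifP => b]; rewrite sfE; try lia;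
  (case: ifP => c; [|case: ifP => d]); repeat case: ifP; lia.
Qed.

Lemma rfrE x : - r%:Z <= x <= r%:Z + 1 ->
  rf r x = if x == r%:Z then r%:Z + 2 else if x == 1 - r%:Z then - r%:Z - 1 else x.
Proof.
move=> xr; rewrite /rf; case: ifP => [|_]; first lia.
case: ifP => [|_]; first lia.
rewrite (@sfE r%:Z x); try lia.
case: ifP => a; [|case: ifP => b]; rewrite (@sfE (r%:Z + 1)); try lia;
  (case: ifP => c; [|case: ifP => d]); rewrite sfE; try lia;
  (case: ifP => e; [|case: ifP => f]); repeat case: ifP; lia.
Qed.

(** The involution [x -> 1 - x] realizes [tau], since it conjugates [sf i] into [sf (- i)]. By
    periodicity the window of [rf0E], [rfkE] and [rfrE] is enough. *)
Lemma rf_sym k x : (k <= r)%N -> rf k (1 - x) = 1 - rf k x.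
Proof.
move=> kr; have [m [y [-> yr]]] : exists m y, x = y + m * N /\ - r%:Z <= y <= r%:Z + 1.
  have n0 : N != 0 by [].
  exists ((x + r%:Z) %/ N)%Z, (((x + r%:Z) %% N)%Z - r%:Z).
  have := divz_eq (x + r%:Z) N; have := modz_ge0 (x + r%:Z) n0; have := @ltz_pmod (x + r%:Z) N isT.
  by set q := (_ %/ _)%Z; set z := (_ %% _)%Z; split; lia.
have -> : 1 - (y + m * N) = (1 - y) + (- m) * N by lia.
rewrite !rf_add; suff -> : rf k (1 - y) = 1 - rf k y by lia.
have [->|k0] := eqVneq k 0%N; first by rewrite !rf0E; try lia; repeat case: ifP; lia.
have [->|kr'] := eqVneq k r; first by rewrite !rfrE; try lia; repeat case: ifP; lia.
by rewrite !rfkE; try lia; repeat case: ifP; lia.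
Qed.

Lemma acts_rrefl (i : 'I_r.+1) : acts (Defs.rrefl i) (rf i).
Proof.
have ir := ltn_ord i.
have a1 : acts (refl (node i)) (sf i%:Z).
  by have := acts_refl (node i); rewrite /node inordK //; lia.
rewrite /Defs.rrefl /rf; case: ifP => [/eqP i0|i0]; first by rewrite i0 in a1.
have a2 : acts (refl (tau (node i))) (sf (N - i%:Z)).
  have := acts_refl (tau (node i)); rewrite /tau /= /node inordK ?modn_small; try lia.
  by rewrite (_ : (n - i)%:Z = N - i%:Z) //; lia.
case: ifP => [_|ri]; first exact: (actsM a1 a2).
have ei : i = r :> nat by lia.
have := actsM (actsM a1 a2) a1; rewrite ei (_ : N - r%:Z = r%:Z + 1) //; lia.
Qed.

Definition fw (s : seq nat) : int -> int := foldr (fun k f => rf k \o f) id s.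
Definition ords (s : seq nat) : seq 'I_r.+1 := map inord s.

Lemma fw_cat s1 s2 x : fw (s1 ++ s2) x = fw s1 (fw s2 x).
Proof. by elim: s1 => [|k s1 IH] //=; rewrite IH. Qed.
Lemma fw_rcons s k x : fw (rcons s k) x = fw s (rf k x).
Proof. by rewrite -cats1 fw_cat. Qed.
Lemma fw_add s x (m : int) : fw s (x + m * N) = fw s x + m * N.
Proof. by elim: s => [|k s IH] //=; rewrite IH rf_add. Qed.
Lemma fw_sym s x : all (fun k => k <= r)%N s -> fw s (1 - x) = 1 - fw s x.
Proof. by elim: s => [|k s IH] //= /andP[kr /IH->]; rewrite rf_sym. Qed.
(** Up to a period, [r + 1] is its own mirror image under [x -> 1 - x]. *)
Lemma fw_mid s : all (fun k => k <= r)%N s -> fw s (r%:Z + 1) = r%:Z + 1.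
Proof.
move=> sr; have := fw_sym (r%:Z + 1) sr.
have -> : 1 - (r%:Z + 1) = (r%:Z + 1) + (- 1) * N by lia.
rewrite fw_add; lia.
Qed.
Lemma acts_fw s : all (fun k => k <= r)%N s -> acts (wprod (ords s)) (fw s).
Proof.
rewrite /wprod; elim: s => [|k s IH] /=; first by rewrite big_nil => _; exact: acts1.
case/andP=> kr /IH a; rewrite big_cons; apply: actsM => //.
by have := acts_rrefl (inord k); rewrite inordK.
Qed.

Lemma fw_ext s1 s2 : all (fun k => k <= r)%N s1 -> all (fun k => k <= r)%N s2 ->
  (forall a : nat, (0 < a <= r)%N -> fw s1 a%:Z = fw s2 a%:Z) -> fw s1 =1 fw s2.
Proof.
move=> h1 h2 H x; have [j jx] := res x.
have /dvdzP[m em] := jx.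
have -> : x = j%:Z + m * N by lia.
rewrite !fw_add; congr (_ + _).
have jn := ltn_ord j; have [j0|j0] := leqP j r.
  have [->|j1] := eqVneq (j : nat) 0%N; last by apply: H; lia.
  by rewrite (_ : 0%:Z = 1 - 1%N%:Z) // !fw_sym // H.
have [->|j1] := eqVneq (j : nat) r.+1.
  by rewrite -addn1 PoszD !fw_mid.
have -> : j%:Z = 1 - (N + 1 - j%:Z) + 1 * N by lia.
rewrite !fw_add !fw_sym // (_ : N + 1 - j%:Z = (n.+1 - j)%:Z); last lia.
by rewrite H //; lia.
Qed.

(** Periodicity, the mirror symmetry and the fixed point [r + 1] determine the permutation from its
    values on [1, ..., r], so equality in [W_tau] becomes a finite comparison. *)
Lemma wprod_fw s1 s2 : all (fun k => k <= r)%N s1 -> all (fun k => k <= r)%N s2 ->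
  wprod (ords s1) = wprod (ords s2) <->
  (forall a : nat, (0 < a <= r)%N -> fw s1 a%:Z = fw s2 a%:Z).
Proof.
move=> h1 h2; have a1 := acts_fw h1; have a2 := acts_fw h2; split=> [E a _|H].
  rewrite -E in a2; have := acts_fun a%:Z (r%:Z + 1) a1 a2; rewrite !fw_mid //; lia.
have E := fw_ext h1 h2 H; apply: (@acts_eq _ _ (fw s1)) => // x y.
by rewrite !E; exact: a2.
Qed.
End Cox.




(** * Reduced expressions *)

Section Cox2.
Variable r : nat.
Hypothesis r_gt0 : (0 < r)%N.
Local Notation n := r.*2.+1.
Local Notation N := (n%:Z).
Local Notation fw := (fw r).
Local Notation rf := (rf r).
Implicit Types (x y z t : int).

(* Phi, evaluated on the window f 1, ..., f r, counts the reflections separating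
   f from the identity; it is defined so that no congruence condition on the
   entries is needed to bound its variation. *)
Definition gap t : int := Num.max (t %/ N)%Z ((N - t) %/ N)%Z.

Lemma gap_flip t : gap (N - t) = gap t.
Proof. by rewrite /gap (_ : N - (N - t) = t) 1?maxC //; lia. Qed.

(** The only inequality behind [Phi_step]: up to [gap_flip], a generator reverses the sign of one
    difference. *)
Lemma gap_opp t : gap (- t) <= gap t + 1.
Proof.
have E u : ((N + u) %/ N)%Z = 1 + (u %/ N)%Z by rewrite -{1}[N]mul1r divzMDl.
rewrite /gap opprK !E; lia.
Qed.

Lemma gapE (q t : int) : 0 < t < N -> gap (q * N + t) = `|q|.
Proof.
move=> tN; rewrite /gap divzMDl // divz_small; last lia.
have -> : N - (q * N + t) = (- q) * N + (N - t) by lia.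
rewrite divzMDl // divz_small; lia.
Qed.

Lemma gap_small t : 0 < t < N -> gap t = 0.
Proof. by move=> tN; rewrite -[t]add0r -(mul0r N) gapE. Qed.

(** [x + z - 1] is the difference of [z] and the mirror image [1 - x]; likewise the [2x - 1] in
    [Phi] compares [x] with its own mirror image. *)
Definition pairc x z := gap (z - x) + gap (x + z - 1).
Fixpoint Phi (s : seq int) : int :=
  if s is x :: s' then gap (x *+ 2 - 1) + \sum_(z <- s') pairc x z + Phi s' else 0.

Lemma Phi_cat s1 s2 : Phi (s1 ++ s2)
  = Phi s1 + Phi s2 + \sum_(x <- s1) \sum_(z <- s2) pairc x z.
Proof.
elim: s1 => [|x s1 IH] /=; first by rewrite big_nil addr0 add0r.
have ac (a b c d e f : int) : a + (b + c) + (d + e + f) = a + b + d + e + (c + f) by lia.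
by rewrite IH big_cat big_cons; exact: ac.
Qed.

Lemma Phi_swap s1 x z s2 : Phi (s1 ++ x :: z :: s2) - Phi (s1 ++ z :: x :: s2)
  = gap (z - x) - gap (x - z).
Proof.
rewrite !Phi_cat /= !big_cons; set a := \sum_(y <- s1) _; set b := \sum_(y <- s1) _.
have -> : a = b by apply: eq_bigr => y _; rewrite !big_cons addrCA.
rewrite /pairc (_ : z + x = x + z); lia.
Qed.

(** Reflecting [x] exchanges the two terms of every [pairc], so only the gap of [2x - 1] changes. In
    [Phi_last] the exchange happens up to [gap_flip]. *)
Lemma Phi_first x s : Phi ((1 - x) :: s) <= Phi (x :: s) + 1.
Proof.
rewrite /=; have -> : \sum_(z <- s) pairc (1 - x) z = \sum_(z <- s) pairc x z.
  apply: eq_bigr => z _; rewrite /pairc (_ : z - (1 - x) = x + z - 1); last lia.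
  by rewrite (_ : 1 - x + z - 1 = z - x) 1?[RHS]addrC //; lia.
have := gap_opp (x *+ 2 - 1); rewrite (_ : - (x *+ 2 - 1) = (1 - x) *+ 2 - 1); last lia.
have ac (a b c d : int) : a <= b + 1 -> a + c + d <= b + c + d + 1 by lia.
exact: ac.
Qed.

Lemma Phi_last x s : Phi (rcons s (N + 1 - x)) <= Phi (rcons s x) + 1.
Proof.
rewrite -!cats1 !Phi_cat /= !big_nil.
have -> : \sum_(y <- s) \sum_(z <- [:: N + 1 - x]) pairc y z
    = \sum_(y <- s) \sum_(z <- [:: x]) pairc y z.
  apply: eq_bigr => y _; rewrite !big_seq1 /pairc -[in RHS]gap_flip -[gap (y + x - 1)]gap_flip.
  rewrite (_ : N + 1 - x - y = N - (y + x - 1)); last lia.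
  by rewrite (_ : y + (N + 1 - x) - 1 = N - (x - y)); lia.
have := gap_opp (N - (x *+ 2 - 1)); rewrite (gap_flip (x *+ 2 - 1)).
rewrite -[gap (- _)]gap_flip.
rewrite (_ : N - - (N - (x *+ 2 - 1)) = (N + 1 - x) *+ 2 - 1); last lia.
have ac (a b c d : int) : a <= b + 1 -> c + (a + 0 + 0) + d <= c + (b + 0 + 0) + d + 1 by lia.
exact: ac.
Qed.

Definition win (f : int -> int) : seq int := [seq f a%:Z | a <- iota 1 r].
Lemma winE f : win f = [seq f a%:Z | a <- iota 1 r]. Proof. by []. Qed.

Lemma win_ext f1 f2 : (forall a : nat, (0 < a <= r)%N -> f1 a%:Z = f2 a%:Z) -> win f1 = win f2.
Proof. by move=> H; apply/eq_in_map => a; rewrite mem_iota => ar; apply: H; lia. Qed.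
Lemma win_inj f1 f2 : win f1 = win f2 -> forall a : nat, (0 < a <= r)%N -> f1 a%:Z = f2 a%:Z.
Proof. by move/eq_in_map => H a ar; apply: H; rewrite mem_iota; lia. Qed.

Lemma iota_split k : (0 < k < r)%N ->
  iota 1 r = iota 1 k.-1 ++ k :: k.+1 :: iota k.+2 (r - k).-1.
Proof.
move=> kr; have {1}-> : r = (k.-1 + (2 + (r - k).-1))%N by lia.
by rewrite !iotaD (_ : 1 + k.-1 = k)%N /=; [congr (_ ++ _ :: _ :: iota _ _); lia | lia].
Qed.

Lemma win_swap (f : int -> int) k : (0 < k < r)%N ->
  let s1 := [seq f a%:Z | a <- iota 1 k.-1] in
  let s2 := [seq f a%:Z | a <- iota k.+2 (r - k).-1] in
  win f = s1 ++ f k%:Z :: f k.+1%:Z :: s2 /\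
  win (f \o rf k) = s1 ++ f k.+1%:Z :: f k%:Z :: s2.
Proof.
move=> kr; rewrite /win (iota_split kr) !map_cat /=; split=> //.
have F (a : nat) : (0 < a <= r)%N -> a != k -> a != k.+1 -> rf k a = a.
  by move=> ar ak ak1; rewrite rfkE //; [repeat case: ifP; lia | lia].
rewrite (@rfkE _ r_gt0 k k%:Z) ?(@rfkE _ r_gt0 k k.+1%:Z) //; try lia.
rewrite eqxx (_ : k.+1%:Z == k%:Z = false); last lia.
rewrite (_ : k.+1%:Z == k%:Z + 1); last lia.
rewrite (_ : k%:Z + 1 = k.+1%:Z); last lia.
congr (_ ++ _ :: _ :: _); apply/eq_in_map => a; rewrite mem_iota /= => ar; rewrite F //; lia.
Qed.

(** On the window, multiplication by a generator on the right reflects the first entry ([k = 0]),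
    reflects the last one ([k = r]), or swaps two neighbours. *)
Lemma Phi_step s k : all (fun k => k <= r)%N s -> (k <= r)%N ->
  Phi (win (fw (rcons s k))) <= Phi (win (fw s)) + 1.
Proof.
move=> sr kr; have -> : win (fw (rcons s k)) = win (fw s \o rf k).
  by apply: win_ext => a _; rewrite fw_rcons.
have [k0|k0] := eqVneq k 0%N.
  rewrite k0 /win; have -> : iota 1 r = 1%N :: iota 2 r.-1 by rewrite -{1}(prednK r_gt0).
  rewrite !map_cons /= rf0E; try lia.
  have -> : [seq (fw s \o rf 0) b%:Z | b <- iota 2 r.-1] = [seq fw s b%:Z | b <- iota 2 r.-1].
    apply/eq_in_map => a; rewrite mem_iota => ar /=; rewrite rf0E; try lia.
    by repeat case: ifP; lia.
  by have := fw_sym r_gt0 1 sr; rewrite subrr => ->; exact: Phi_first.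
have [kr'|kr'] := eqVneq k r.
  rewrite kr' /win; have -> : iota 1 r = rcons (iota 1 r.-1) r.
    by rewrite -[in LHS](prednK r_gt0) iota_rcons; congr rcons; lia.
  rewrite !map_rcons /= rfrE; try lia.
  have -> : [seq (fw s \o rf r) b%:Z | b <- iota 1 r.-1] = [seq fw s b%:Z | b <- iota 1 r.-1].
    apply/eq_in_map => a; rewrite mem_iota => ar /=; rewrite rfrE; try lia.
    by repeat case: ifP; lia.
  rewrite eqxx; have -> : r%:Z + 2 = 1 - r%:Z + 1 * N by lia.
  rewrite fw_add // fw_sym // (_ : 1 - fw s r%:Z + 1 * N = N + 1 - fw s r%:Z); last lia.
  exact: Phi_last.
have k1 : (0 < k < r)%N by lia.
have [-> ->] := win_swap (fw s) k1.
set x := fw s k%:Z; set z := fw s k.+1%:Z; set s1 := map _ _; set s2 := map _ _.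
have h1 := Phi_swap s1 z x s2; have := gap_opp (z - x); rewrite opprB => h2.
have ac (a b c d : int) : a - b = c - d -> c <= d + 1 -> a <= b + 1 by lia.
exact: ac h1 h2.
Qed.

Lemma Phi_iota m a : (0 < a)%N -> (a + m <= r.+1)%N -> Phi [seq b%:Z | b <- iota a m] = 0.
Proof.
elim: m a => [|m IH] a a0 am //=.
rewrite IH //; last lia.
rewrite gap_small; last lia.
rewrite big_map big_seq big1 // => b; rewrite mem_iota => bm.
by rewrite /pairc !gap_small //; lia.
Qed.

Lemma Phi_word s : all (fun k => k <= r)%N s -> Phi (win (fw s)) <= (size s)%:Z.
Proof.
elim/last_ind: s => [_|s k IH]; first by rewrite /win Phi_iota.
rewrite all_rcons size_rcons => /andP[kr sr]; have := Phi_step sr kr; have := IH sr; lia.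
Qed.

Definition tight s := all (fun k => k <= r)%N s && (Phi (win (fw s)) == (size s)%:Z).

(** [Phi] depends on the group element alone and bounds from below the length of every word
    representing it. *)
Lemma tight_reduced s : tight s -> reduced (ords r s).
Proof.
case/andP=> sr /eqP E s' Es'; rewrite size_map.
have s'E : s' = ords r (map val s').
  by rewrite /ords -map_comp -[LHS]map_id; apply: eq_map => i /=; rewrite inord_val.
have s'r : all (fun k => k <= r)%N (map val s').
  by apply/allP => k /mapP[i _ ->]; rewrite -ltnS ltn_ord.
have := Phi_word s'r; rewrite size_map -lez_nat -E; apply: le_trans.
rewrite s'E in Es'; have := (wprod_fw r_gt0 s'r sr).1 Es' => H.
by rewrite (win_ext H).
Qed.

(** The step bound leaves no slack along a tight word; hence the word of [varpi'], a prefix of that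
    of [varpi], is reduced as well. *)
Lemma tight_rcons s k : tight (rcons s k) -> tight s.
Proof.
rewrite /tight all_rcons size_rcons => /andP[/andP[kr sr] /eqP E]; rewrite sr /=.
have := Phi_word sr.
have := Phi_step sr kr; rewrite E; lia.
Qed.

Local Notation cw := (cw r).
Definition cpow (i m : nat) : seq nat := flatten (nseq m (cw i)).

Lemma fw_up m (b : nat) : (m <= r)%N -> (0 < b <= r)%N ->
  fw (iota 0 m) b%:Z = if (b < m)%N then b.+1%:Z else if b == m then 0 else b%:Z.
Proof.
elim: m b => [|m IH] b mr br; first by rewrite /=; case: ifP => //; lia.
have -> : iota 0 m.+1 = rcons (iota 0 m) m by rewrite iota_rcons.
rewrite fw_rcons; have [m0|m0] := eqVneq m 0%N.
  by rewrite m0 rf0E /=; try lia; repeat case: ifP; lia.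
rewrite rfkE; try lia.
have [bm|bm] := eqVneq b m.
  rewrite bm eqxx (_ : m%:Z + 1 = m.+1%:Z); last lia.
  by rewrite IH; try lia; repeat case: ifP; lia.
rewrite (_ : (b%:Z == m%:Z) = false); last lia.
have [bm'|bm'] := eqVneq b m.+1.
  rewrite bm' (_ : m.+1%:Z == m%:Z + 1); last lia.
  by rewrite IH; try lia; repeat case: ifP; lia.
rewrite (_ : (b%:Z == m%:Z + 1) = false); last lia.
rewrite (_ : (b%:Z == - m%:Z) = false); last lia.
rewrite (_ : (b%:Z == 1 - m%:Z) = false); last lia.
by rewrite IH; try lia; repeat case: ifP; lia.
Qed.

Lemma fw_dn i m (b : nat) : (0 < i)%N -> (i + m <= r)%N -> (0 < b <= r)%N ->
  fw (rev (iota i m)) b%:Z =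
    if b == i then (i + m)%:Z else if (i < b <= i + m)%N then b.-1%:Z else b%:Z.
Proof.
elim: m b => [|m IH] b i0 mr br; first by rewrite /=; repeat case: ifP; lia.
have -> : iota i m.+1 = rcons (iota i m) (i + m) by rewrite iota_rcons.
rewrite rev_rcons [fw _ _]/= IH; try lia.
by repeat case: ifP => ?; rewrite rfkE; try lia; repeat case: ifP; lia.
Qed.

Lemma fw_iota a m (b : nat) : (0 < a)%N -> (a + m <= r)%N -> (0 < b <= r)%N ->
  fw (iota a m) b%:Z =
    if b == (a + m)%N then a%:Z else if (a <= b < a + m)%N then b.+1%:Z else b%:Z.
Proof.
elim: m b => [|m IH] b a0 mr br; first by rewrite /=; repeat case: ifP; lia.
have -> : iota a m.+1 = rcons (iota a m) (a + m) by rewrite iota_rcons.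
rewrite fw_rcons.
have -> : rf (a + m) b%:Z = (if b == (a + m)%N then b.+1 else if b == (a + m).+1 then b.-1 else b)%:Z.
  by rewrite rfkE; try lia; repeat case: ifP; lia.
by rewrite IH; repeat case: ifP; lia.
Qed.

(** [c_i] is the affine cycle [1 -> 2 -> .. -> i -> N + 1], so its [i]-th power shifts [1, ..., i]
    by one period. *)
Lemma fw_cw i (b : nat) : (0 < i <= r)%N -> (0 < b <= r)%N ->
  fw (cw i) b%:Z = if (b < i)%N then b.+1%:Z else if b == i then N + 1 else b%:Z.
Proof.
move=> ir br; rewrite /cw iota_rcons -cats1 fw_cat fw_cat fw_dn; try lia.
have H (a : nat) : (0 < a <= r)%N ->
    fw (iota 0 r) (fw [:: 0 + r]%N a%:Z) = if (a < r)%N then a.+1%:Z else N + 1.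
  move=> ar; rewrite /= rfrE; try lia; case: ifP => [/eqP[->]|an].
    have -> : r%:Z + 2 = 1 - r%:Z + 1 * N by lia.
    rewrite fw_add // fw_sym //; last by apply/allP => k; rewrite mem_iota; lia.
    by rewrite fw_up; try lia; repeat case: ifP; lia.
  case: ifP => [|_]; first lia.
  by rewrite fw_up; try lia; repeat case: ifP; lia.
by repeat case: ifP => ?; rewrite H; try lia; repeat case: ifP; lia.
Qed.

Lemma cw_le i : (i <= r)%N -> all (fun k => k <= r)%N (cw i).
Proof.
by move=> ir; apply/allP => k; rewrite /cw mem_cat mem_rev !mem_iota; lia.
Qed.
Lemma cpowS i m : cpow i m.+1 = cw i ++ cpow i m. Proof. by []. Qed.
Lemma cpow_le i m : (i <= r)%N -> all (fun k => k <= r)%N (cpow i m).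
Proof.
by move=> ir; elim: m => [|m IH] //; rewrite cpowS all_cat cw_le.
Qed.

Lemma fw_cpow i m (b : nat) : (0 < i <= r)%N -> (0 < b <= r)%N -> (m <= i)%N ->
  fw (cpow i m) b%:Z =
    if (b <= i)%N then (if (b + m <= i)%N then (b + m)%:Z else N + (b + m - i)%N%:Z) else b%:Z.
Proof.
move=> ir br; elim: m => [|m IH] mi; first by rewrite addn0 /=; repeat case: ifP; lia.
rewrite cpowS fw_cat IH; last lia.
case: ifP => bi; last by rewrite fw_cw; repeat case: ifP; lia.
case: ifP => bm; first by rewrite fw_cw; try lia; repeat case: ifP; lia.
have -> (a : nat) : N + a%:Z = a%:Z + 1 * N by lia.
rewrite fw_add // fw_cw; try lia; repeat case: ifP; lia.
Qed.

Lemma fw_cpow_full i (b : nat) : (0 < i <= r)%N -> (0 < b <= r)%N ->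
  fw (cpow i i) b%:Z = if (b <= i)%N then N + b%:Z else b%:Z.
Proof. by move=> ir br; rewrite fw_cpow //; repeat case: ifP; lia. Qed.

Lemma size_cpow i m : (i <= r)%N -> size (cpow i m) = (m * (n - i))%N.
Proof.
move=> ir; elim: m => [|m IH] //.
rewrite cpowS size_cat IH /cw size_cat size_rev !size_iota mulSn; lia.
Qed.

Lemma Phi_map (f : nat -> int) (a m : nat) (c d : int) :
  (forall x : nat, (a <= x < a + m)%N -> gap (f x *+ 2 - 1) = d) ->
  (forall x z : nat, (a <= x < z)%N -> (z < a + m)%N -> pairc (f x) (f z) = c) ->
  Phi [seq f b | b <- iota a m] = d * m%:Z + c * 'C(m, 2)%:Z.
Proof.
elim: m a => [|m IH] a hd hc /=; first by rewrite bin0n; lia.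
rewrite IH; first last.
- by move=> x z xz zm; apply: hc; lia.
- by move=> x xm; apply: hd; lia.
rewrite hd; last lia.
rewrite big_map big_seq (eq_bigr (fun=> c)); last first.
  by move=> z; rewrite mem_iota => zm; apply: hc; lia.
rewrite -big_seq big_const_seq count_predT size_iota iter_addr_0 binS bin1 PoszD.
by rewrite -mulr_natr natz intS !mulrDr mulr1; lia.
Qed.

Lemma bin2_double m : ('C(m, 2).*2 = m * m.-1)%N.
Proof. by rewrite bin2 -[RHS]odd_double_half; case: m => [|m] //=; rewrite oddM /= andNb. Qed.

(** The length [i (2r + 1 - i)] is matched by [2i] from the shifted entries, [2 'C(i, 2)] from pairs
    of them, and [2 i (r - i)] from pairs of a shifted and an unshifted entry. *)
Lemma tight_cpow i : (0 < i <= r)%N -> tight (cpow i i).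
Proof.
move=> ir; rewrite /tight cpow_le ?size_cpow; try lia; apply/eqP.
rewrite /win; have -> : iota 1 r = iota 1 i ++ iota i.+1 (r - i).
  by rewrite (_ : i.+1 = 1 + i)%N // -iotaD; congr iota; lia.
rewrite map_cat.
have -> : [seq fw (cpow i i) a%:Z | a <- iota 1 i] = [seq N + a%:Z | a <- iota 1 i].
  by apply/eq_in_map => a; rewrite mem_iota => ai; rewrite fw_cpow_full //; try lia; case: ifP; lia.
have -> : [seq fw (cpow i i) a%:Z | a <- iota i.+1 (r - i)] = [seq a%:Z | a <- iota i.+1 (r - i)].
  by apply/eq_in_map => a; rewrite mem_iota => ai; rewrite fw_cpow_full //; try lia; case: ifP; lia.
rewrite Phi_cat Phi_iota; try lia.
rewrite (@Phi_map (fun a => N + a%:Z) 1 i 2 2); first last.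
- move=> x z xz zi; rewrite /pairc gap_small; last lia.
  rewrite (_ : N + x%:Z + (N + z%:Z) - 1 = 2 * N + (x%:Z + z%:Z - 1)) ?gapE; lia.
- move=> x xi; rewrite (_ : (N + x%:Z) *+ 2 - 1 = 2 * N + (x%:Z + x%:Z - 1)) ?gapE; lia.
rewrite big_map big_seq (eq_bigr (fun=> (r - i)%:Z *+ 2)); last first.
  move=> x; rewrite mem_iota => xi.
  rewrite big_map big_seq (eq_bigr (fun=> 2)); last first.
    move=> z; rewrite mem_iota => zi; rewrite /pairc.
    rewrite (_ : z%:Z - (N + x%:Z) = (-1) * N + (z%:Z - x%:Z)) ?gapE; try lia.
    rewrite (_ : N + x%:Z + z%:Z - 1 = 1 * N + (z%:Z + x%:Z - 1)) ?gapE; lia.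
  by rewrite -big_seq big_const_seq count_predT size_iota iter_addr_0; lia.
rewrite -big_seq big_const_seq count_predT size_iota iter_addr_0.
have natm (a : int) m : a *+ m = a * m%:Z by rewrite -mulr_natr natz.
rewrite !natm; set C := 'C(i, 2).
have hC : (C + C = i * i.-1)%N by rewrite addnn bin2_double.
have [u ui] : exists u, r = (i + u)%N by exists (r - i)%N; lia.
have -> : (r - i = u)%N by lia.
rewrite ui; case: (i) hC => [|k] /=; nia.
Qed.

Lemma wt_add x (m : int) : wt r (x + m * N) = wt r x - m *: const_mx 1.
Proof.
apply/colP => k; rewrite !mxE (_ : x + m * N - 1 - k%:Z = m * N + (x - 1 - k%:Z)); last lia.
by rewrite divzMDl //; lia.
Qed.

Lemma val_tau (i : 'I_r.+1) : (0 < i)%N -> tau (node i) = (n - i)%N :> nat.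
Proof.
by move=> i0; have ir := ltn_ord i; rewrite /tau /= /node inordK ?modn_small //; lia.
Qed.

Lemma val_node (i : 'I_r.+1) : node i = i :> nat.
Proof. by have ir := ltn_ord i; rewrite /node inordK //; lia. Qed.

Lemma sum_fweight (i : 'I_n) : i != 0 -> \sum_j fweight i j = 0.
Proof.
move=> i0; rewrite (bigD1 0) //= (bigD1 i) //= big1 => [|j /andP[j0 ji]].
  by rewrite /fweight eqxx (negPf i0) eqxx; lia.
by rewrite /fweight (negPf j0) eq_sym (negPf ji).
Qed.

Lemma acts_varpi (i : 'I_r.+1) : (0 < i)%N -> acts (varpi (node i)) (fw (cpow i i)).
Proof.
move=> i0; have ir := ltn_ord i; apply: (acts_rt r_gt0) => x; have [j jx] := res r_gt0 x.
set f := fw _; have fle : all (fun k => k <= r)%N (cpow i i) by apply: cpow_le; lia.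
have ni0 : node i != 0 by rewrite -val_eqE /= val_node; lia.
have ti0 : tau (node i) != 0.
  by apply/eqP => E; have := val_tau i0; rewrite E /=; lia.
have E : varpi (node i) *m rt r x
    = rt r x - (fweight (node i) j + fweight (tau (node i)) j) *: const_mx 1.
  rewrite (rt_ord r_gt0 jx); apply/colP => k; rewrite -colE !mxE !eqxx !andbT.
  rewrite (eq_bigr (fun l => ((k == l)%:R * (l == j)%:R - (k == l)%:R * fweight (tau (node i)) j
    - fweight (node i) l * (l == j)%:R) + fweight (node i) l * fweight (tau (node i)) j)); last first.
    by move=> l _; rewrite !mxE; lia.
  (* The cross term of the two translations vanishes because [omega_i] pairs to 0 with [delta]. *)
  rewrite big_split /= -mulr_suml sum_fweight // mul0r addr0 !sumrB.
  have D (h : 'I_n -> int) (l0 : 'I_n) : \sum_l (l == l0)%:R * h l = h l0.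
    rewrite (bigD1 l0) //= eqxx mul1r big1 ?addr0 // => l /negPf->; exact: mul0r.
  rewrite (eq_bigr (fun l => (l == k)%:R * (l == j)%:R)) => [|l _]; last by rewrite [k == l]eq_sym.
  rewrite D (eq_bigr (fun l => (l == k)%:R * fweight (tau (node i)) j)) => [|l _]; last by rewrite [k == l]eq_sym.
  rewrite D (eq_bigr (fun l => (l == j)%:R * fweight (node i) l)) => [|l _]; last by rewrite mulrC.
  rewrite D; lia.
rewrite E; have -> : rt r x = wt r j%:Z - wt r (j%:Z + 1).
  by rewrite wt_succ // !(rt_ord r_gt0 jx) (@rt_ord _ r_gt0 j) ?subrr // dvdz0.
have /dvdzP[m em] := jx.
have -> : x = j%:Z + m * N by lia.
have -> : j%:Z + m * N + 1 = (j%:Z + 1) + m * N by lia.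
rewrite /f !fw_add // !wt_add -/f.
have tP := val_tau i0; have nP := val_node i; have jn := ltn_ord j.
set c := const_mx 1.
(* [d a] is the number of periods by which [f] moves [a]; beyond [r] it follows from the symmetry
   [a -> N + 1 - a]. *)
pose d (a : nat) : int := if a == 0%N then -1 else if (a <= i)%N then 1 else
  if (n - i < a)%N then -1 else 0.
have fP (a : nat) : (a <= n)%N -> f a%:Z = a%:Z + d a * N.
  move=> an; rewrite /d.
  have [ar|ar] := leqP a r.
    have [->|a0] := eqVneq a 0%N.
      have -> : f 0%:Z = 1 - f 1%N%:Z by rewrite /f -fw_sym.
      rewrite /f fw_cpow_full ?i0 //=; lia.
    by rewrite /f fw_cpow_full //; repeat case: ifP; lia.
  case: ifP => [|_]; first lia.
  case: ifP => [|_]; first lia.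
  have [->|a1] := eqVneq a r.+1.
    have -> : r.+1%:Z = r%:Z + 1 by lia.
    by rewrite /f fw_mid //; case: ifP; lia.
  have -> : a%:Z = 1 - (n.+1 - a)%N%:Z + 1 * N by lia.
  rewrite /f fw_add // fw_sym // fw_cpow_full //; repeat case: ifP; lia.
have -> : fweight (node i) j + fweight (tau (node i)) j = d j - d j.+1.
  have -> : fweight (node i) j = if j == 0%N :> nat then -1 else (nat_of_ord i == j)%:R.
    by rewrite /fweight -[node i == j]val_eqE /= nP.
  have -> : fweight (tau (node i)) j = if j == 0%N :> nat then -1 else (n - i == j)%N%:R.
    by rewrite -tP.
  by rewrite /d; repeat case: ifP; lia.
rewrite fP; last lia.
rewrite (_ : j%:Z + 1 = j.+1%:Z); last lia.
rewrite fP // !wt_add; apply/colP => k; rewrite !mxE; lia.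
Qed.

Lemma wprod_cpow (i : 'I_r.+1) : (0 < i)%N -> wprod (ords r (cpow i i)) = varpi (node i).
Proof.
move=> i0; have ir := ltn_ord i.
apply: (acts_eq r_gt0 (acts_fw r_gt0 _) (acts_varpi i0)); apply: cpow_le; lia.
Qed.

Lemma reduced_varpi (i : 'I_r.+1) : (0 < i)%N ->
  reduced_expr (ords r (cpow i i)) (varpi (node i)).
Proof.
move=> i0; split; first exact: wprod_cpow.
by apply/tight_reduced/tight_cpow; rewrite i0 -ltnS ltn_ord.
Qed.

Lemma orb_node (i : 'I_r.+1) : orb (node i) = i.
Proof.
have ir := ltn_ord i; apply: val_inj; rewrite /= /orb val_node.
have -> : minn i (tau (node i)) = i.
  by have [->|i0] := posnP i; rewrite ?min0n // val_tau //; lia.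
by rewrite inordK.
Qed.

Lemma rf_invol k x : (k <= r)%N -> rf k (rf k x) = x.
Proof.
move=> kr; have H := @fw_ext r r_gt0 [:: k; k] [::] _ _ _ x.
apply: H => //=; first by rewrite kr.
move=> a ar; have [->|k0] := eqVneq k 0%N.
  by rewrite (@rf0E r r_gt0 a); try lia; rewrite rf0E; repeat case: ifP; lia.
have [kr'|kr'] := eqVneq k r; last first.
  by rewrite (@rfkE r r_gt0 k a); try lia; rewrite rfkE; repeat case: ifP; lia.
rewrite kr' (@rfrE r r_gt0 a); try lia; case: ifP => [ea|]; last by rewrite rfrE; repeat case: ifP; lia.
rewrite (_ : r%:Z + 2 = 1 - r%:Z + 1 * N); last lia.
by rewrite rf_add // rf_sym // rfrE; repeat case: ifP; lia.
Qed.

Definition cpow' i := cpow i i.-1 ++ cw i.+1.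

Lemma cw_rcons i : (i < r)%N -> cw i = rcons (cw i.+1) i.
Proof.
move=> ir; rewrite /cw (_ : r - i = (r - i.+1).+1)%N; last lia.
by rewrite [iota i _]/= rev_cons -!cats1 catA.
Qed.

Lemma cpow_rcons i : (0 < i < r)%N -> cpow i i = rcons (cpow' i) i.
Proof.
move=> /andP[i0 ir]; have H m : cpow i m.+1 = cpow i m ++ cw i.
  by elim: m => [|m IH]; rewrite cpowS ?cats0 // {1}IH catA.
by rewrite -{2}(prednK i0) H [in LHS]cw_rcons // -rcons_cat.
Qed.

Lemma reduced_varpi' (i : 'I_r.+1) : (0 < i < r)%N ->
  reduced_expr (ords r (cpow' i)) (varpi' (node i)).
Proof.
move=> ir; have i0 : (0 < i)%N by lia.
have T : tight (cpow i i) by apply: tight_cpow; lia.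
have Er := cpow_rcons ir; split; last by apply: tight_reduced; rewrite Er in T; apply: tight_rcons T.
rewrite /varpi' orb_node -wprod_cpow // Er /ords map_rcons /wprod big_rcons /= inord_val -mulrA.
have -> : Defs.rrefl i * Defs.rrefl i = 1.
  have := actsM (acts_rrefl r_gt0 i) (acts_rrefl r_gt0 i) => a.
  by apply: (acts_eq r_gt0 a) => x y; rewrite mul1mx /= !rf_invol // -ltnS ltn_ord.
by rewrite mulr1.
Qed.

Lemma rf_flip k x : (k <= r)%N -> rf k (N + 1 - x) = N + 1 - rf k x.
Proof.
move=> kr; have -> : N + 1 - x = 1 - x + 1 * N by lia.
by rewrite rf_add // rf_sym //; lia.
Qed.

Lemma powE (i j : 'I_r.+1) m : (Defs.rrefl i * Defs.rrefl j) ^+ m = 1 <->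
  (forall a : nat, (0 < a <= r)%N -> iter m (rf i \o rf j) a%:Z = a%:Z).
Proof.
have E1 : ords r (flatten (nseq m [:: nat_of_ord i; nat_of_ord j])) = flatten (nseq m [:: i; j]).
  by elim: m => [|m IH] //=; rewrite /ords /= !inord_val; congr (_ :: _ :: _).
have E2 : wprod (flatten (nseq m [:: i; j])) = (Defs.rrefl i * Defs.rrefl j) ^+ m.
  elim: m {E1} => [|m IH]; first by rewrite /wprod big_nil expr0.
  by rewrite /wprod /= !big_cons -/(wprod _) IH exprS mulrA.
have E3 x : fw (flatten (nseq m [:: nat_of_ord i; nat_of_ord j])) x = iter m (rf i \o rf j) x.
  by elim: m {E1 E2} => [|m IH] //=; rewrite IH.
rewrite -E2 -E1; have ir := ltn_ord i; have jr := ltn_ord j.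
have h : all (fun k => k <= r)%N (flatten (nseq m [:: nat_of_ord i; nat_of_ord j])).
  by elim: m {E1 E2 E3} => [|m IH] //=; rewrite IH -ltnS ir -ltnS jr.
have := @wprod_fw r r_gt0 _ [::] h isT; rewrite {2}/wprod big_nil => ->.
by split=> H a ar; have := H a ar; rewrite E3.
Qed.

(** [braid_relations] speaks of the exact order of the product, so a moved point must be given for
    each smaller exponent. *)
Lemma pow_order (i j : 'I_r.+1) m :
  (forall a : nat, (0 < a <= r)%N -> iter m (rf i \o rf j) a%:Z = a%:Z) ->
  (forall k : nat, (0 < k < m)%N -> exists2 a : nat, (0 < a <= r)%N & iter k (rf i \o rf j) a%:Z != a%:Z) ->
  (Defs.rrefl i * Defs.rrefl j) ^+ m = 1 /\
  (forall k, (0 < k < m)%N -> (Defs.rrefl i * Defs.rrefl j) ^+ k <> 1).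
Proof.
move=> h1 h2; split=> [|k km]; first exact/powE.
by have [a ar /eqP na] := h2 k km; move/powE/(_ a ar).
Qed.

Lemma rf_ext s1 s2 : all (fun k => k <= r)%N s1 -> all (fun k => k <= r)%N s2 ->
  (forall a : nat, (0 < a <= r)%N -> fw s1 a%:Z = fw s2 a%:Z) -> fw s1 =1 fw s2.
Proof. exact: fw_ext. Qed.

Lemma pow2 (i j : 'I_r.+1) : (i.+1 < j)%N ->
  (Defs.rrefl i * Defs.rrefl j) ^+ 2 = 1 /\
  (forall k, (0 < k < 2)%N -> (Defs.rrefl i * Defs.rrefl j) ^+ k <> 1).
Proof.
move=> ij; have jr : (j <= r)%N by rewrite -ltnS ltn_ord.
have rfi (a : nat) : (0 < a <= r)%N -> exists b : nat, rf i a = b%:Z /\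
    ((b <= i.+1)%N /\ (a <= i.+1)%N \/ b = a /\ (i.+1 < a)%N).
  move=> ar; have [i0|i0] := eqVneq (i : nat) 0%N.
    rewrite i0 rf0E //; last lia.
    by case: ifP; [lia|case: ifP => [a1|a1 a0]; [exists 0%N; lia | exists a; lia]].
  rewrite rfkE //; try lia.
  by repeat case: ifP => ?; try lia; [exists i.+1 | exists (i : nat) | exists a]; lia.
have rfj (a : nat) : (a < j)%N -> rf j a = a.
  move=> aj; have [ejr|ejr] := eqVneq (j : nat) r.
    by rewrite ejr rfrE //; repeat case: ifP; lia.
  by rewrite rfkE //; repeat case: ifP; lia.
have rfij (a : nat) : (j <= a <= r)%N -> rf i (rf j a) = rf j a.
  move=> aj; have ia (b : nat) : (i.+1 < b <= r)%N -> rf i b = b.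
    by move=> ib; have [|b' [-> [|[->]]]] := rfi b; lia.
  have [ejr|ejr] := eqVneq (j : nat) r.
    rewrite ejr rfrE //; last lia.
    rewrite (_ : a%:Z == r%:Z); last lia.
    have -> : r%:Z + 2 = N + 1 - r%:Z by lia.
    by rewrite rf_flip ?ia //; lia.
  have [b [-> bj]] : exists b : nat, rf j a = b%:Z /\ (i.+1 < b <= r)%N.
    rewrite rfkE; try lia.
    by repeat case: ifP => ?; try lia; [exists j.+1 | exists (j : nat) | exists a]; lia.
  exact: ia.
have cm : fw [:: nat_of_ord i; nat_of_ord j] =1 fw [:: nat_of_ord j; nat_of_ord i].
  apply: rf_ext; rewrite /= ?jr ?andbT; try lia.
  move=> a ar /=; have [aj|aj] := ltnP a j.
    rewrite rfj //; have [//|b [-> hb]] := rfi a; rewrite rfj //; lia.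
  rewrite rfij; last lia.
  by have [//|b [-> hb]] := rfi a; rewrite (_ : b = a) //; lia.
apply: pow_order => [a ar|k km].
  by rewrite /=; have /= -> := cm (rf i (rf j a)); rewrite !rf_invol //; lia.
have -> : k = 1%N by lia.
exists j; first lia.
rewrite /= rfij; last lia.
have [ejr|ejr] := eqVneq (j : nat) r; first by rewrite ejr rfrE; repeat case: ifP; lia.
by rewrite rfkE; repeat case: ifP; lia.
Qed.

Lemma pow3 (i j : 'I_r.+1) : (0 < i)%N -> j = i.+1 :> nat -> (j < r)%N ->
  (Defs.rrefl i * Defs.rrefl j) ^+ 3 = 1 /\
  (forall k, (0 < k < 3)%N -> (Defs.rrefl i * Defs.rrefl j) ^+ k <> 1).
Proof.
move=> i0 ej jr; rewrite -[Defs.rrefl i]/(Defs.rrefl i).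
have rfi (a : nat) : (0 < a <= r)%N ->
    rf i a = (if a == i then i.+1 else if a == i.+1 then nat_of_ord i else a)%:Z.
  by move=> ar; rewrite rfkE; repeat case: ifP; lia.
have rfj (a : nat) : (0 < a <= r)%N ->
    rf j a = (if a == i.+1 then i.+2 else if a == i.+2 then i.+1 else a)%:Z.
  by move=> ar; rewrite ej rfkE; repeat case: ifP; lia.
have A0 : rf i i = i.+1%:Z by rewrite rfi; repeat case: ifP; lia.
have A1 : rf i i.+1 = i by rewrite rfi; repeat case: ifP; lia.
have A2 : rf i i.+2 = i.+2 by rewrite rfi; repeat case: ifP; lia.
have B0 : rf j i = i by rewrite rfj; repeat case: ifP; lia.
have B1 : rf j i.+1 = i.+2 by rewrite rfj; repeat case: ifP; lia.
have B2 : rf j i.+2 = i.+1 by rewrite rfj; repeat case: ifP; lia.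
have br : fw [:: nat_of_ord i; nat_of_ord j; nat_of_ord i]
    =1 fw [:: nat_of_ord j; nat_of_ord i; nat_of_ord j].
  apply: rf_ext; rewrite /= ?andbT; try lia.
  move=> a ar /=; have [->|a0] := eqVneq a i; first by rewrite !(A0, A1, A2, B0, B1, B2).
  have [->|a1] := eqVneq a i.+1; first by rewrite !(A0, A1, A2, B0, B1, B2).
  have [->|a2] := eqVneq a i.+2; first by rewrite !(A0, A1, A2, B0, B1, B2).
  have F0 : rf i a = a by rewrite rfi; repeat case: ifP; lia.
  have F1 : rf j a = a by rewrite rfj; repeat case: ifP; lia.
  by rewrite !(F0, F1).
apply: pow_order => [a ar|k km].
  by rewrite /=; have /= -> := br (rf j (rf i (rf j a))); rewrite !rf_invol //; lia.
exists i; first lia.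
have [->|->] : k = 1%N \/ k = 2%N by lia.
all: by rewrite /= !(A0, A1, A2, B0, B1, B2); lia.
Qed.

Lemma pow4_0 (i j : 'I_r.+1) : i = 0%N :> nat -> j = 1%N :> nat -> (1 < r)%N ->
  (Defs.rrefl i * Defs.rrefl j) ^+ 4 = 1 /\
  (forall k, (0 < k < 4)%N -> (Defs.rrefl i * Defs.rrefl j) ^+ k <> 1).
Proof.
have ir : (i <= r)%N by rewrite -ltnS ltn_ord.
have jr : (j <= r)%N by rewrite -ltnS ltn_ord.
move=> ei ej r1; pose s := [:: nat_of_ord i; nat_of_ord j].
have R0 x : - r%:Z <= x <= r%:Z -> rf i x = if x == 0 then 1 else if x == 1 then 0 else x.
  by move=> xr; rewrite ei rf0E //; lia.
have R1 x : - r%:Z <= x <= r%:Z -> rf j x =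
    if x == 1 then 2 else if x == 2 then 1 else if x == 0 then -1 else if x == -1 then 0 else x.
  by move=> xr; rewrite ej rfkE //; repeat case: ifP; lia.
have A0 : rf i 0 = 1 by rewrite R0 //; lia.
have A1 : rf i 1%N = 0 by rewrite R0 //; lia.
have A2 : rf i 2%N = 2%N by rewrite R0 //; lia.
have A3 : rf i (-1) = -1 by rewrite R0 //; lia.
have A4 : rf i 1 = 0 by rewrite R0 //; lia.
have A5 : rf i 2 = 2 by rewrite R0 //; lia.
have B0 : rf j 0 = -1 by rewrite R1 //; lia.
have B1 : rf j 1%N = 2 by rewrite R1 //; lia.
have B2 : rf j 2%N = 1 by rewrite R1 //; lia.
have B3 : rf j (-1) = 0 by rewrite R1 //; lia.
have B4 : rf j 1 = 2 by rewrite R1 //; lia.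
have B5 : rf j 2 = 1 by rewrite R1 //; lia.
pose AB := (A0, A1, A2, A3, A4, A5, (B0, B1, B2, B3, B4, B5)).
have br : fw (s ++ s) =1 fw (rev s ++ rev s).
  apply: rf_ext; rewrite /= ?andbT; try lia.
  move=> a ar /=; have [->|a1] := eqVneq a 1%N; first by rewrite !AB.
  have [->|a2] := eqVneq a 2%N; first by rewrite !AB.
  have F0 : rf i a = a by rewrite R0; repeat case: ifP; lia.
  have F1 : rf j a = a by rewrite R1; repeat case: ifP; lia.
  by rewrite !(F0, F1).
apply: pow_order => [a ar|k km].
  rewrite /=; have /= -> := br (rf i (rf j (rf i (rf j a)))).
  have Ii x : rf i (rf i x) = x by exact: rf_invol.
  have Ij x : rf j (rf j x) = x by exact: rf_invol.
  by move: (rf i) (rf j) Ii Ij => f g If Ig; rewrite !(If, Ig).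
exists 1%N; first lia.
have [->|[->|->]] : k = 1%N \/ k = 2%N \/ k = 3%N by lia.
all: by rewrite /= !AB.
Qed.

Lemma pow4_r (i j : 'I_r.+1) : i = r.-1 :> nat -> j = r :> nat -> (1 < r)%N ->
  (Defs.rrefl i * Defs.rrefl j) ^+ 4 = 1 /\
  (forall k, (0 < k < 4)%N -> (Defs.rrefl i * Defs.rrefl j) ^+ k <> 1).
Proof.
have ir : (i <= r)%N by rewrite -ltnS ltn_ord.
have jr : (j <= r)%N by rewrite -ltnS ltn_ord.
move=> ei ej r1; pose s := [:: nat_of_ord i; nat_of_ord j].
have er : r%:Z = r.-1%:Z + 1 by lia.
have A (x : nat) : (0 < x <= r)%N -> rf i x = (if x == r.-1 then r else if x == r then r.-1 else x)%:Z.
  by move=> xr; rewrite ei rfkE; repeat case: ifP; lia.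
have B (x : nat) : (0 < x <= r)%N -> rf j x = if x == r then N + 1 - r%:Z else x%:Z.
  by move=> xr; rewrite ej rfrE; repeat case: ifP; lia.
have Ai x : rf i (N + 1 - x) = N + 1 - rf i x by rewrite rf_flip //; lia.
have Bi x : rf j (N + 1 - x) = N + 1 - rf j x by rewrite rf_flip //; lia.
have A1 : rf i r.-1%:Z = r%:Z by rewrite A; repeat case: ifP; lia.
have A2 : rf i r%:Z = r.-1%:Z by rewrite A; repeat case: ifP; lia.
have B1 : rf j r.-1%:Z = r.-1%:Z by rewrite B; repeat case: ifP; lia.
have B2 : rf j r%:Z = N + 1 - r%:Z by rewrite B; repeat case: ifP; lia.
have br : fw (s ++ s) =1 fw (rev s ++ rev s).
  apply: rf_ext; rewrite /= ?andbT; try lia.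
  move=> a ar /=; have [->|a1] := eqVneq a r; first by rewrite !(A1, A2, B1, B2, Ai, Bi).
  have [->|a2] := eqVneq a r.-1; first by rewrite !(A1, A2, B1, B2, Ai, Bi).
  have F0 : rf i a = a by rewrite A; repeat case: ifP; lia.
  have F1 : rf j a = a by rewrite B; repeat case: ifP; lia.
  by rewrite !(F0, F1).
apply: pow_order => [a ar|k km].
  rewrite /=; have /= -> := br (rf i (rf j (rf i (rf j a)))).
  have Ii x : rf i (rf i x) = x by exact: rf_invol.
  have Ij x : rf j (rf j x) = x by exact: rf_invol.
  by move: (rf i) (rf j) Ii Ij => f g If Ig; rewrite !(If, Ig).
exists r; first lia.
have [->|[->|->]] : k = 1%N \/ k = 2%N \/ k = 3%N by lia.
all: by rewrite /= !(A1, A2, B1, B2, Ai, Bi); lia.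
Qed.
End Cox2.

(** * The longest element of the subgroup generated by [r_1], ..., [r_(r-1)] *)

Section Cox3.
Variable r : nat.
Hypothesis r_gt0 : (0 < r)%N.
Local Notation n := r.*2.+1.
Local Notation N := (n%:Z).
Local Notation fw := (fw r).
Local Notation rf := (rf r).
Local Notation win := (win r).
Local Notation Phi := (Phi r).
Implicit Types (x y z t : int).

(* A reduced word of the longest element of <r_a, ..., r_(a+m-1)>. *)
Fixpoint wl (a m : nat) : seq nat :=
  if m is m'.+1 then wl a.+1 m' ++ iota a m'.+1 else [::].

Lemma fw_wl a m (b : nat) : (0 < a)%N -> (m == 0%N) || (a + m <= r)%N -> (0 < b <= r)%N ->
  fw (wl a m) b%:Z = (if (a <= b <= a + m)%N then a.*2 + m - b else b)%N%:Z.
Proof.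
elim: m a b => [|m IH] a b a0 am br; first by rewrite /=; case: ifP; lia.
rewrite [wl _ _]/= -[a :: iota a.+1 m]/(iota a m.+1) fw_cat fw_iota //; try lia.
by repeat case: ifP => ?; rewrite IH; repeat case: ifP; lia.
Qed.

Lemma mem_wl a m k : k \in wl a m -> (a <= k < a + m)%N.
Proof.
elim: m a => [|m IH] a //=.
rewrite -[a :: iota a.+1 m]/(iota a m.+1) mem_cat mem_iota => /orP[/IH|]; lia.
Qed.

Lemma size_wl a m : size (wl a m) = 'C(m.+1, 2).
Proof.
elim: m a => [|m IH] a //; rewrite [wl _ _]/= -[a :: iota a.+1 m]/(iota a m.+1).
by rewrite size_cat IH size_iota [RHS]binS bin1.
Qed.

(** Two reduced words for the same element, because the block [wl 2 (r-2)] fixes [B_0] and [K_0]. It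
    has to be applied first in [T_theta^-1(B_0)], which asks for it on the left ([theta1]), and also
    in [T_theta(K_0)], which asks for it on the right ([theta2]). *)
Definition theta1 := wl 2 r.-2 ++ iota 1 r.-1.
Definition theta2 := rev (iota 1 r.-1) ++ wl 2 r.-2.
Definition mid (s : seq nat) := all (fun k => 0 < k < r)%N s.

Lemma theta1_mid : mid theta1.
Proof. by apply/allP => k; rewrite mem_cat mem_iota => /orP[/mem_wl|]; lia. Qed.
Lemma theta2_mid : mid theta2.
Proof. by apply/allP => k; rewrite mem_cat mem_rev mem_iota => /orP[|/mem_wl]; lia. Qed.
Lemma mid_le s : mid s -> all (fun k => k <= r)%N s.
Proof. by move=> /allP H; apply/allP => k /H; lia. Qed.

Lemma fw_theta1 (b : nat) : (0 < b <= r)%N -> fw theta1 b%:Z = (r.+1 - b)%N%:Z.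
Proof.
move=> br; rewrite fw_cat fw_iota; try lia.
by repeat case: ifP => ?; rewrite fw_wl; repeat case: ifP; rewrite /=; lia.
Qed.
Lemma fw_theta2 (b : nat) : (0 < b <= r)%N -> fw theta2 b%:Z = (r.+1 - b)%N%:Z.
Proof.
move=> br; rewrite fw_cat fw_wl; try lia.
case: ifP => ?; rewrite fw_dn; repeat case: ifP; lia.
Qed.

Lemma size_theta1 : size theta1 = 'C(r, 2).
Proof.
rewrite size_cat size_wl size_iota; case: (r) r_gt0 => [|[|m]] //= _.
by rewrite [RHS]binS bin1.
Qed.
Lemma size_theta2 : size theta2 = 'C(r, 2).
Proof. by rewrite -size_theta1 !size_cat size_rev addnC. Qed.

Lemma Phi_rev : Phi [seq (r.+1 - b)%N%:Z | b <- iota 1 r] = 'C(r, 2).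
Proof.
rewrite (@Phi_map r r_gt0 (fun b => (r.+1 - b)%N%:Z) 1 r 1 0) //; first by rewrite mul0r mul1r add0r.
  by move=> b br; rewrite gap_small; lia.
move=> b d bd dr; rewrite /pairc [gap _ (_ + _ - 1)]gap_small //; last lia.
rewrite (_ : _ - _ = (-1) * N + (N + b%:Z - d%:Z)) ?gapE; lia.
Qed.

Lemma tight_theta1 : tight r theta1.
Proof.
rewrite /tight mid_le ?theta1_mid // size_theta1 -Phi_rev; apply/eqP; congr Phi.
by apply/eq_in_map => a; rewrite mem_iota => ar; rewrite fw_theta1; lia.
Qed.
Lemma tight_theta2 : tight r theta2.
Proof.
rewrite /tight mid_le ?theta2_mid // size_theta2 -Phi_rev; apply/eqP; congr Phi.
by apply/eq_in_map => a; rewrite mem_iota => ar; rewrite fw_theta2; lia.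
Qed.

(* On permutations of 1, ..., r, Phi is the number of inversions. *)
Lemma Phi_inv s : uniq s -> {in s, forall x, 0 < x <= r%:Z} ->
  Phi s <= 'C(size s, 2) /\ (Phi s = 'C(size s, 2) -> sorted >=%R s).
Proof.
elim: s => [|x s IH] //= /andP[xs us] H.
have Hs : {in s, forall z, 0 < z <= r%:Z} by move=> z zs; apply: H; rewrite in_cons zs orbT.
have Hx : 0 < x <= r%:Z by apply: H; rewrite mem_head.
have [IH1 IH2] := IH us Hs; rewrite gap_small //; last lia.
rewrite binS bin1 add0r.
have P z : z \in s -> pairc r x z = (z < x)%R%:R.
  move=> zs; have z1 := Hs z zs; have zx : z != x by apply: contraNneq xs => <-.
  rewrite /pairc [gap _ (_ + _ - 1)]gap_small //; last lia.
  case: (ltP z x) => zx'.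
  - rewrite (_ : z - x = (-1) * N + (N + z - x)) ?gapE; lia.
  - rewrite gap_small; lia.
rewrite big_seq (eq_bigr (fun z => (z < x)%R%:R)) // -big_seq.
have -> : \sum_(z <- s) (z < x)%R%:R = (count (fun z => z < x) s)%:Z.
  elim: (s) => [|z s' IH'] /=; first by rewrite big_nil.
  by rewrite big_cons IH' PoszD -natz; case: (z < x).
have cs := count_size (fun z => z < x) s.
have ac (c l k : nat) (p : int) : (c <= l)%N -> p <= k%:Z -> c%:Z + p <= (k + l)%N%:Z.
  by lia.
have ac2 (c l k : nat) (p : int) : (c <= l)%N -> p <= k%:Z -> c%:Z + p = (k + l)%N%:Z ->
  p = k%:Z /\ c == l by lia.
split=> [|E]; first exact: ac.
have [E1 E2'] := ac2 _ _ _ _ cs IH1 E.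
have /allP E2 : all (fun z => z < x) s by rewrite all_count.
case: s {IH IH1 H Hs xs us P cs E E2'} IH2 E1 E2 => [|z s] //= IH2 /IH2 -> E2.
by rewrite andbT; apply: ltW; apply: E2; rewrite mem_head.
Qed.

Lemma win_perm s : mid s -> perm_eq (win (fw s)) [seq a%:Z | a <- iota 1 r].
Proof.
elim/last_ind: s => [|s k IH]; first by [].
rewrite /mid all_rcons => /andP[k1 /IH]; apply: perm_trans.
have -> : win (fw (rcons s k)) = win (fw s \o rf k).
  by apply: (win_ext r_gt0) => a _; rewrite fw_rcons.
have [-> ->] := win_swap r_gt0 (fw s) k1.
by apply/permP => p; rewrite !count_cat /=; lia.
Qed.

Lemma descent (s : seq int) : ~~ sorted <=%R s ->
  exists s1 x z s2, s = s1 ++ x :: z :: s2 /\ z < x.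
Proof.
elim: s => [|x [|z s] IH] //=; rewrite negb_and => /orP[|h].
  by rewrite -ltNge => zx; exists [::], x, z, s.
have [s1 [x' [z' [s2 [E zx]]]]] := IH h.
by exists (x :: s1), x', z', s2; rewrite E.
Qed.

Lemma win_swapE f u x z w : win f = u ++ x :: z :: w ->
  ((size u).+1 < r)%N /\ win (f \o rf (size u).+1) = u ++ z :: x :: w.
Proof.
move=> E; have kr : ((size u).+1 < r)%N.
  have := congr1 size E; rewrite size_map size_iota size_cat /=; lia.
split=> //; have k1 : (0 < (size u).+1 < r)%N by [].
have [E1 ->] := win_swap r_gt0 f k1; move: E1; rewrite E => /eqP.
rewrite eqseq_cat ?size_map ?size_iota // => /andP[/eqP<- /eqP[<- <- <-]].
by [].
Qed.

Lemma gap_ge0 t : 0 <= gap r t.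
Proof.
rewrite /gap le_max; have [t0|t0] := leP 0 t.
  by rewrite divz_ge0 ?t0 //; lia.
by rewrite [(_ <= (N - t) %/ _)%Z]divz_ge0; lia.
Qed.

Lemma Phi_ge0 s : 0 <= Phi s.
Proof.
by elim: s => [|x s IH] //=; rewrite !addr_ge0 ?gap_ge0 ?sumr_ge0 // => z _; rewrite addr_ge0 ?gap_ge0.
Qed.

(** Converse to [Phi_word] inside the symmetric group: swapping a descent lowers [Phi] by exactly
    one, so sorting the window produces a word no longer than [Phi]. The bound [m] drives the
    induction. *)
Lemma bubble (m : nat) s : mid s -> Phi (win (fw s)) <= m%:Z ->
  exists2 s1, mid s1 & win (fw s1) = win (fw s) /\ (size s1)%:Z <= Phi (win (fw s)).
Proof.
have F s' : mid s' -> uniq (win (fw s')) /\ {in win (fw s'), forall x, 0 < x <= r%:Z}.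
  move=> /win_perm pe; split.
    by rewrite (perm_uniq pe) map_inj_uniq ?iota_uniq // => a b [].
  by move=> x; rewrite (perm_mem pe) => /mapP[a]; rewrite mem_iota => ar ->; lia.
have id0 s' : mid s' -> sorted <=%R (win (fw s')) ->
  exists2 s1, mid s1 & win (fw s1) = win (fw s') /\ (size s1)%:Z <= Phi (win (fw s')).
  move=> ms so; have Ew : win (fw s') = win (fw [::]).
    apply: (sorted_eq le_trans le_anti) => //; last exact: win_perm.
    by rewrite winE sorted_map; exact: iota_sorted.
  by exists [::] => //; split; rewrite // Ew winE Phi_iota.
have drop s' u x z w : mid s' -> win (fw s') = u ++ x :: z :: w -> z < x ->
    Phi (win (fw s')) = Phi (u ++ z :: x :: w) + 1.
  move=> ms E zx; have [us Hs] := F _ ms; move: us Hs; rewrite E => us Hs.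
  have := Phi_swap r_gt0 u x z w.
  have xr : 0 < x <= r%:Z by apply: Hs; rewrite mem_cat mem_head orbT.
  have zr : 0 < z <= r%:Z by apply: Hs; rewrite mem_cat !in_cons eqxx !orbT.
  rewrite [gap r (x - z)]gap_small //; last lia.
  rewrite (_ : z - x = (-1) * N + (N + z - x)) ?gapE //; try lia.
elim: m s => [|m IH] s ms Pm.
all: have [|/descent[u [x [z [w [E zx]]]]]] := boolP (sorted <=%R (win (fw s))); first exact: id0.
all: have [kr Ek] := win_swapE E; have D := drop _ _ _ _ _ ms E zx.
  by have := Phi_ge0 (u ++ z :: x :: w); rewrite D in Pm; lia.
have mk : mid (rcons s (size u).+1) by rewrite /mid all_rcons kr.
have Ew : win (fw (rcons s (size u).+1)) = u ++ z :: x :: w.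
  by rewrite -Ek; apply: (win_ext r_gt0) => a _; rewrite fw_rcons.
have Pm' : Phi (win (fw (rcons s (size u).+1))) <= m%:Z by rewrite Ew; rewrite D in Pm; lia.
have [s1 ms1 [W1 S1]] := IH _ mk Pm'; rewrite Ew in W1 S1.
exists (rcons s1 (size u).+1); first by rewrite /mid all_rcons kr.
split; last by rewrite size_rcons D; lia.
have [_ E1] := win_swapE W1; rewrite E -E1.
by apply: (win_ext r_gt0) => a _; rewrite fw_rcons.
Qed.

(** The length of a longest word is at least ['C(r, 2)], the length of [theta1], and at most [Phi],
    which is at most ['C(r, 2)]. Equality forces a decreasing window, the common window of [theta1]
    and [theta2]. *)
Lemma longest_theta (w : 'M[int]_n) : is_longest (fun i : 'I_r.+1 => (0 < i < r)%N) w ->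
  reduced_expr (ords r theta1) w /\ reduced_expr (ords r theta2) w.
Proof.
move=> [s [Js [ws rs] ms]].
have sE : s = ords r (map val s).
  by rewrite /ords -map_comp -[LHS]map_id; apply: eq_map => i /=; rewrite inord_val.
have midE s' : mid s' -> all (fun i : 'I_r.+1 => (0 < i < r)%N) (ords r s').
  by move=> /allP H; apply/allP => i /mapP[k /H kr ->]; rewrite inordK; lia.
have mids : mid (map val s) by rewrite /mid all_map.
have mle := mid_le mids; set y := win (fw (map val s)).
have Py : Phi y <= (size s)%:Z by have := Phi_word r_gt0 mle; rewrite size_map.
have [s1 ms1 [W1 S1]] := bubble mids Py.
have ss1 : (size s <= size s1)%N.
  have := rs (ords r s1); rewrite size_map; apply.
  rewrite sE; apply/(wprod_fw r_gt0 (mid_le ms1) mle) => a ar.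
  exact: win_inj W1 a ar.
have C1 : ('C(r, 2) <= size s)%N.
  have := ms _ (midE _ theta1_mid) (tight_reduced r_gt0 tight_theta1).
  by rewrite size_map size_theta1.
have py := win_perm mids; rewrite -/y in py S1.
have uy : uniq y by rewrite (perm_uniq py) map_inj_uniq ?iota_uniq // => a b [].
have Hy : {in y, forall x, 0 < x <= r%:Z}.
  by move=> x; rewrite (perm_mem py) => /mapP[a]; rewrite mem_iota => ar ->; lia.
have sy : size y = r by rewrite size_map size_iota.
have [P1 P2] := Phi_inv uy Hy; rewrite sy in P1 P2.
have Ey : Phi y = 'C(r, 2) by lia.
have W : forall th, mid th -> (forall b : nat, (0 < b <= r)%N -> fw th b%:Z = (r.+1 - b)%N%:Z) ->
    wprod (ords r th) = w.
  move=> th mth fth; have Wy : win (fw th) = y.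
    have Wr : win (fw th) = [seq (r.+1 - b)%N%:Z | b <- iota 1 r].
      by apply/eq_in_map => a; rewrite mem_iota => ar; apply: fth; lia.
    apply: (sorted_eq ge_trans ge_anti); last 1 first.
    - by apply: (perm_trans (win_perm mth)); rewrite perm_sym.
    - rewrite Wr sorted_map; apply: (@sub_sorted _ leq); last exact: iota_sorted.
      by move=> a b ab /=; lia.
    - exact: P2.
  rewrite -ws [in RHS]sE; apply/(wprod_fw r_gt0 (mid_le mth) mle) => a ar.
  exact: win_inj Wy a ar.
split; split.
- exact: W theta1_mid fw_theta1.
- exact: tight_reduced tight_theta1.
- exact: W theta2_mid fw_theta2.
- exact: tight_reduced tight_theta2.
Qed.
End Cox3.

(** * Relations and symmetries in terms of tau-orbits *)

Lemma v_neq0 : v != 0.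
Proof. by rewrite tofrac_eq0 polyX_eq0. Qed.

Lemma v_sub_neq0 : v - v^-1 != 0.
Proof.
rewrite subr_eq0; apply/eqP => E; have : v * v = 1 by rewrite {2}E mulfV ?v_neq0.
rewrite /v -tofracM -(rmorph1 (@FracField.tofrac _)) => /eqP; rewrite tofrac_eq -expr2 => /eqP.
by move/(congr1 (size : {poly rat} -> nat)); rewrite size_polyXn size_poly1.
Qed.

Lemma v_add_neq0 : v + v^-1 != 0.
Proof.
rewrite addr_eq0; apply/eqP => E; have : v * v = - 1 by rewrite {2}E mulrN mulfV ?v_neq0.
rewrite /v -tofracM -(rmorph1 (@FracField.tofrac _)) -rmorphN => /eqP; rewrite tofrac_eq -expr2 => /eqP.
by move/(congr1 (size : {poly rat} -> nat)); rewrite size_polyXn size_polyN size_poly1.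
Qed.

Lemma qnum2 : qnum 2 = v + v^-1.
Proof.
rewrite /qnum; apply: (mulIf v_sub_neq0); rewrite divfK ?v_sub_neq0 //.
by rewrite mulrC -subr_sqr exprVn.
Qed.

Section Morph.
Variables (F : comNzRingType) (A B : lalgType F).
(* A predicate, because the inverse autV of a symmetry is a bare function. *)
Definition alg_morph (f : A -> B) : Prop :=
  [/\ linear f, {morph f : x y / x * y} & f 1 = 1].

Variables (f : A -> B) (fM : alg_morph f).
Lemma am_M x y : f (x * y) = f x * f y. Proof. by case: fM. Qed.
Lemma am_1 : f 1 = 1. Proof. by case: fM. Qed.
Lemma am_D x y : f (x + y) = f x + f y.
Proof. by case: fM => l _ _; rewrite -[x]scale1r l !scale1r. Qed.
Lemma am_0 : f 0 = 0.
Proof. by apply: (addrI (f 0)); rewrite -am_D !addr0. Qed.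
Lemma am_Z k x : f (k *: x) = k *: f x.
Proof. by case: fM => l _ _; rewrite -[k *: x]addr0 l am_0 addr0. Qed.
Lemma am_N x : f (- x) = - f x.
Proof. by rewrite -scaleN1r am_Z scaleN1r. Qed.
Lemma am_B x y : f (x - y) = f x - f y.
Proof. by rewrite am_D am_N. Qed.
Lemma am_X x n : f (x ^+ n) = f x ^+ n.
Proof. by elim: n => [|n IH]; rewrite ?expr0 ?am_1 // !exprS am_M IH. Qed.
Definition amE := (am_B, am_D, am_N, am_Z, am_M, am_X, am_1, am_0).

Lemma am_serre q x y : f (x ^+ 2 * y - q *: (x * y * x) + y * x ^+ 2)
  = f x ^+ 2 * f y - q *: (f x * f y * f x) + f y * f x ^+ 2.
Proof. by rewrite !amE. Qed.
Lemma am_comm x y : f (x * y - y * x) = f x * f y - f y * f x.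
Proof. by rewrite !amE. Qed.
Lemma am_ZB k x y : f (k *: (x - y)) = k *: (f x - f y).
Proof. by rewrite !amE. Qed.
Lemma am_ZM k x y : f (k *: (x * y)) = k *: (f x * f y).
Proof. by rewrite !amE. Qed.
Lemma am_NZM k x y : f (- (k *: (x * y))) = - (k *: (f x * f y)).
Proof. by rewrite !amE. Qed.
Lemma am_serre_tau q k x y z : f (- (q *: (k *: (y * x) + k *: (x * z))))
  = - (q *: (k *: (f y * f x) + k *: (f x * f z))).
Proof. by rewrite !amE. Qed.

Lemma am_inv_uniq x y z : x * y = 1 -> y * x = 1 -> f x * z = 1 -> f y = z.
Proof.
move=> xy yx h; have h' : f y * f x = 1 by rewrite -am_M yx am_1.
by rewrite -[f y]mulr1 -h mulrA h' mul1r.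
Qed.
End Morph.

Lemma am_qcomm (F : comNzRingType) (A B : algType F) (f : A -> B) (fM : alg_morph f) q x y :
  f (qcomm q x y) = qcomm q (f x) (f y).
Proof. by rewrite /qcomm !(amE fM). Qed.

Lemma alg_morph_lr (F : comNzRingType) (A B : lalgType F) (f : {lrmorphism A -> B}) : alg_morph f.
Proof. by split=> [k x y|x y|]; [exact: linearP | exact: rmorphM | exact: rmorph1]. Qed.
Lemma alg_morph_id (F : comNzRingType) (A : lalgType F) : alg_morph (@id A). Proof. by split. Qed.
Lemma alg_morph_comp (F : comNzRingType) (A B C : lalgType F) (f : B -> C) (g : A -> B) :
  alg_morph f -> alg_morph g -> alg_morph (f \o g).
Proof. by move=> fM gM; split=> [k x y|x y|] /=; rewrite !(am_D, am_Z, am_M, am_1). Qed.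
Lemma alg_morph_can (F : comNzRingType) (A B : lalgType F) (f : A -> B) (g : B -> A) :
  cancel f g -> cancel g f -> alg_morph f -> alg_morph g.
Proof.
move=> fK gK fM; have I := can_inj fK.
by split=> [k x y|x y|]; apply: I; rewrite ?(am_D fM) ?(am_Z fM) ?(am_M fM) ?(am_1 fM) !gK.
Qed.
Lemma alg_morph_iter (F : comNzRingType) (A : lalgType F) n (f : A -> A) :
  alg_morph f -> alg_morph (iter n f).
Proof. by move=> fM; elim: n => [|n IH]; [exact: alg_morph_id | exact: alg_morph_comp]. Qed.

Lemma presAlg_ext (F : comNzRingType) (X : choiceType) (R : relations F X) (A : lalgType F)
    (f g : presAlg R -> A) : alg_morph f -> alg_morph g ->
  (forall x, f (presAlg_pi R << fmu x >>) = g (presAlg_pi R << fmu x >>)) -> f =1 g.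
Proof.
move=> fM gM H z; have [x ->] := presAlg_surj z.
pose pi := [the {lrmorphism _ -> _} of @presAlg_pi _ _ R].
have piM : alg_morph pi := alg_morph_lr pi.
rewrite -/(pi x) [x]monalgE; elim/big_ind: _ => [|u w hu hw|k _].
- by rewrite (am_0 piM) !am_0.
- by rewrite (am_D piM) (am_D fM) (am_D gM) hu hw.
have -> : << x@_k *g k >> = x@_k *: << k >> :> {malg F[{fmonom X}]}.
  by rewrite -mul_malgC -[_ * _]/(fgmul _ _) fgmulUU mul1m mulr1.
rewrite (am_Z piM) (am_Z fM) (am_Z gM); congr (_ *: _); case: k => s.
elim: s => [|y s IH].
  have -> : << FMonom [::] >> = 1 :> {malg F[{fmonom X}]}.
    by congr << _ >>; apply: val_inj; rewrite /= fm1.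
  by rewrite (am_1 piM) (am_1 fM) (am_1 gM).
have -> : << FMonom (y :: s) >> = << fmu y >> * << FMonom s >> :> {malg F[{fmonom X}]}.
  rewrite -[_ * _]/(fgmul _ _) fgmulUU mulr1; congr << _ >>.
  by apply: val_inj; rewrite /= fmM fmU.
by rewrite (am_M piM) (am_M fM) (am_M gM) IH; congr (_ * _); exact: H.
Qed.

Section Relations.
Variable r : nat.
Local Notation R := (Relations (@iq_proper r)).
Implicit Types (i j l : 'I_r.*2.+1).

Let pi := [the {lrmorphism _ -> _} of @presAlg_pi _ _ R].
Let piM : alg_morph pi := alg_morph_lr pi.
Let rel x y : R x y -> pi x = pi y. Proof. exact: presAlg_rel. Qed.

Lemma iq_KV i : K i * Kinv i = 1.
Proof. exact: etrans (esym (am_M piM _ _)) (etrans (rel (iqKV _ _ _ i)) (am_1 piM)). Qed.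
Lemma iq_VK i : Kinv i * K i = 1.
Proof. exact: etrans (esym (am_M piM _ _)) (etrans (rel (iqVK _ _ _ i)) (am_1 piM)). Qed.
Lemma iq_KK i l : K i * K l = K l * K i.
Proof. exact: etrans (esym (am_M piM _ _)) (etrans (rel (iqKK _ _ _ i l)) (am_M piM _ _)). Qed.
Lemma iq_KB l i : K l * B i = v ^ (cartan (tau l) i - cartan l i) *: (B i * K l).
Proof. exact: etrans (esym (am_M piM _ _)) (etrans (rel (iqKB _ _ _ l i)) (am_ZM piM _ _ _)). Qed.
Lemma iq_BB i j : cartan i j = 0 -> j <> tau i -> B i * B j = B j * B i.
Proof.
move=> h1 h2.
exact: etrans (esym (am_M piM _ _)) (etrans (rel (iqBB _ _ _ h1 h2)) (am_M piM _ _)).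
Qed.
Lemma iq_serre i j : cartan i j = -1 -> j <> tau i -> tau i <> i ->
  B i ^+ 2 * B j - qnum 2 *: (B i * B j * B i) + B j * B i ^+ 2 = 0.
Proof.
move=> h1 h2 h3.
exact: etrans (esym (am_serre piM _ _ _)) (etrans (rel (iqSerre _ _ _ h1 h2 h3)) (am_0 piM)).
Qed.
Lemma iq_Btau i : cartan i (tau i) = 0 ->
  B (tau i) * B i - B i * B (tau i) = (v - v^-1)^-1 *: (K i - K (tau i)).
Proof.
move=> h1.
exact: etrans (esym (am_comm piM _ _)) (etrans (rel (iqBtau _ _ _ h1)) (am_ZB piM _ _ _)).
Qed.
Lemma iq_serre_fix i j : cartan i j = -1 -> tau i = i ->
  B i ^+ 2 * B j - qnum 2 *: (B i * B j * B i) + B j * B i ^+ 2 = - (v^-1 *: (B j * K i)).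
Proof.
move=> h1 h2.
exact: etrans (esym (am_serre piM _ _ _))
  (etrans (rel (iqSerre_fix _ _ _ h1 h2)) (am_NZM piM _ _ _)).
Qed.
Lemma iq_serre_tau i : cartan i (tau i) = -1 ->
  B i ^+ 2 * B (tau i) - qnum 2 *: (B i * B (tau i) * B i) + B (tau i) * B i ^+ 2
  = - (qnum 2 *: (v *: (K i * B i) + v *: (B i * K (tau i)))).
Proof.
move=> h1.
exact: etrans (esym (am_serre piM _ _ _))
  (etrans (rel (iqSerre_tau _ _ _ h1)) (am_serre_tau piM _ _ _ _ _)).
Qed.

Lemma Uiq_ext (A : lalgType Qv) (f g : Uiq r -> A) : alg_morph f -> alg_morph g ->
  (forall i, f (B i) = g (B i)) -> (forall i, f (K i) = g (K i)) -> f =1 g.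
Proof.
move=> fM gM fgB fgK; apply: presAlg_ext => // -[i|[i []]].
- exact: fgB.
- exact: fgK.
apply: (am_inv_uniq fM (iq_KV i) (iq_VK i)); rewrite fgK -[RHS](am_1 gM) -(iq_KV i) (am_M gM).
by [].
Qed.

End Relations.

Section RelationsSl2.
Let pi := [the {lrmorphism _ -> _} of @presAlg_pi _ _ (Relations sl2_proper)].
Let piM : alg_morph pi := alg_morph_lr pi.
Let rel x y : Relations sl2_proper x y -> pi x = pi y. Proof. exact: presAlg_rel. Qed.

Lemma sl2_KV a : sl2 (GK a) * sl2 (GKinv a) = 1.
Proof. exact: etrans (esym (am_M piM _ _)) (etrans (rel (slKV _ a)) (am_1 piM)). Qed.
Lemma sl2_VK a : sl2 (GKinv a) * sl2 (GK a) = 1.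
Proof. exact: etrans (esym (am_M piM _ _)) (etrans (rel (slVK _ a)) (am_1 piM)). Qed.
Lemma sl2_KV' a : sl2 (GK' a) * sl2 (GK'inv a) = 1.
Proof. exact: etrans (esym (am_M piM _ _)) (etrans (rel (slKV' _ a)) (am_1 piM)). Qed.
Lemma sl2_VK' a : sl2 (GK'inv a) * sl2 (GK' a) = 1.
Proof. exact: etrans (esym (am_M piM _ _)) (etrans (rel (slVK' _ a)) (am_1 piM)). Qed.

Lemma sl2_ext (A : lalgType Qv) (f g : Usl2 -> A) : alg_morph f -> alg_morph g ->
  (forall a, f (sl2 (GE a)) = g (sl2 (GE a))) -> (forall a, f (sl2 (GF a)) = g (sl2 (GF a))) ->
  (forall a, f (sl2 (GK a)) = g (sl2 (GK a))) -> (forall a, f (sl2 (GK' a)) = g (sl2 (GK' a))) ->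
  f =1 g.
Proof.
move=> fM gM hE hF hK hK'; apply: presAlg_ext => // -[] a.
- exact: hE.
- exact: hF.
- exact: hK.
- apply: (am_inv_uniq fM (sl2_KV a) (sl2_VK a)).
  by rewrite hK -[RHS](am_1 gM) -(sl2_KV a) (am_M gM).
- exact: hK'.
- apply: (am_inv_uniq fM (sl2_KV' a) (sl2_VK' a)).
  by rewrite hK' -[RHS](am_1 gM) -(sl2_KV' a) (am_M gM).
Qed.
End RelationsSl2.

(** * Nodes as pairs of a sign and an orbit *)

Section Nodes.
Variable r : nat.
Hypothesis r_gt0 : (0 < r)%N.
Local Notation n := r.*2.+1.

(** [tau] becomes negation of the sign, so one statement covers [B_k] and [B_(tau k)]. Both signs
    give the node 0 at [k = 0]. *)
Definition nd (e : bool) (k : nat) : 'I_n := if e then node (inord k) else tau (node (inord k)).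

Lemma tau_nd e k : tau (nd e k) = nd (~~ e) k.
Proof. by case: e => //=; rewrite /tau opprK. Qed.

Lemma val_nd e k : (k <= r)%N -> nd e k = (if e || (k == 0) then k else n - k)%N :> nat.
Proof.
move=> kr; case: e; first by rewrite -[nd _ _]/(node _) (val_node r_gt0) inordK.
rewrite -[nd _ _]/(tau _).
case: (posnP k) => [->|k0]; last by rewrite (val_tau r_gt0) // inordK.
have -> : inord 0 = 0 :> 'I_r.+1 by apply: val_inj; rewrite /= inordK.
by rewrite /= (val_node r_gt0) subn0 modnn.
Qed.

Lemma nd0 e : nd e 0 = 0.
Proof. by apply: ord_inj; rewrite val_nd // orbT. Qed.

Lemma nd_eq e k e' l : (k <= r)%N -> (l <= r)%N ->
  (nd e k == nd e' l) = (k == l) && ((e == e') || (k == 0%N)).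
Proof.
move=> kr lr; rewrite -(inj_eq (@ord_inj _)) !val_nd //.
by case: e; case: e' => /=; repeat case: ifP; lia.
Qed.

Lemma nd_surj j : exists e k, (k <= r)%N /\ j = nd e k.
Proof.
have jn := ltn_ord j; case: (leqP j r) => jr.
  by exists true, (j : nat); split=> //; apply: ord_inj; rewrite val_nd.
exists false, (n - j)%N; split; first lia.
by apply: ord_inj; rewrite val_nd; [case: ifP; lia | lia].
Qed.

(** The cyclic diagram as two branches, one for each sign, joined at the node 0 and closed by the
    edge between [r] and [r + 1]. *)
Definition adj (e : bool) k (e' : bool) l : bool :=
  ((k.+1 == l) || (l.+1 == k)) && [|| e == e', k == 0%N | l == 0%N]
  || [&& k == r, l == r & e != e'].

Lemma cartan_nd e k e' l : (k <= r)%N -> (l <= r)%N -> cartan (nd e k) (nd e' l) =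
  if (k == l) && ((e == e') || (k == 0%N)) then 2 else if adj e k e' l then -1 else 0.
Proof.
move=> kr lr; rewrite cartanE nd_eq //; case: ifP => //= H.
set D := _ || _; suff -> : D = adj e k e' l by [].
rewrite {}/D !(dvdN2 r_gt0) /adj ?val_nd //; try (repeat case: ifP; lia).
Qed.

Definition kb_weight (e : bool) k (e' : bool) l : int :=
  if (k == 0%N) || (l == 0%N) then 0 else
  (if e == e' then -1 else 1) *
  (if k == l then (if k == r then 3 else 2)
   else if (k.+1 == l) || (l.+1 == k) then -1 else 0).

Lemma kb_weightE e k e' l : (k <= r)%N -> (l <= r)%N ->
  cartan (nd (~~ e) k) (nd e' l) - cartan (nd e k) (nd e' l) = kb_weight e k e' l.
Proof.
move=> kr lr; rewrite !cartan_nd // /adj /kb_weight.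
by case: e; case: e' => /=; repeat case: ifP; lia.
Qed.
End Nodes.

Arguments nd : simpl never.

Section Data.
Variables (A : algType Qv) (r : nat) (b K Ki : bool -> nat -> A).

(** The relations over an arbitrary algebra, to be instantiated both at [Uiq r] and at the rank one
    algebra [Uiq 1]. *)
Record iq_data : Prop := IqData {
  b0E : forall e e', b e 0 = b e' 0;
  K0E : forall e e', K e 0 = K e' 0;
  Ki0E : forall e e', Ki e 0 = Ki e' 0;
  KV : forall e k, K e k * Ki e k = 1;
  VK : forall e k, Ki e k * K e k = 1;
  KK : forall e k e' l, K e k * K e' l = K e' l * K e k;
  Kb : forall e k e' l, (k <= r)%N -> (l <= r)%N ->
    K e k * b e' l = v ^ kb_weight r e k e' l *: (b e' l * K e k);
  bb : forall e k e' l, (k <= r)%N -> (l <= r)%N -> k != l -> ~~ adj r e k e' l ->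
    b e k * b e' l = b e' l * b e k;
  b_serre : forall e k e' l, (0 < k <= r)%N -> (l <= r)%N -> k != l -> adj r e k e' l ->
    b e k ^+ 2 * b e' l - (v + v^-1) *: (b e k * b e' l * b e k) + b e' l * b e k ^+ 2 = 0;
  b_tau : forall e k, (0 < k < r)%N ->
    b (~~ e) k * b e k - b e k * b (~~ e) k = (v - v^-1)^-1 *: (K e k - K (~~ e) k);
  b_serre0 : forall e e', b e 0 ^+ 2 * b e' 1 - (v + v^-1) *: (b e 0 * b e' 1 * b e 0)
    + b e' 1 * b e 0 ^+ 2 = - (v^-1 *: (b e' 1 * K e 0));
  b_serre_r : forall e, b e r ^+ 2 * b (~~ e) r - (v + v^-1) *: (b e r * b (~~ e) r * b e r)
    + b (~~ e) r * b e r ^+ 2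
    = - ((v + v^-1) *: (v *: (K e r * b e r) + v *: (b e r * K (~~ e) r)))
}.

Variable t : nat -> A -> A.

Record iq_sym : Prop := IqSym {
  tb_far : forall e k l, (k <= r)%N -> (l <= r)%N -> far k l -> t k (b e l) = b e l;
  tb_mid : forall e k, (0 < k < r)%N -> t k (b e k) = - (Ki e k * b (~~ e) k);
  tb_adj : forall e k l, (0 < k < r)%N -> (0 < l <= r)%N -> (l == k.+1) || (l.+1 == k) ->
    t k (b e l) = qcomm v (b e l) (b e k);
  tb_10 : forall e, (1 < r)%N -> t 1 (b e 0) =
    qcomm v (qcomm v (b e 0) (b true 1)) (b false 1) - v *: (b e 0 * K true 1);
  tb_00 : forall e, t 0 (b e 0) = Ki e 0 * b e 0;
  tb_01 : forall e, t 0 (b e 1) = qcomm v (b e 1) (b e 0);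
  tb_rr : forall e, t r (b e r) = - (v ^- 2 *: (b e r * Ki (~~ e) r));
  tb_r1 : forall e, (1 < r)%N -> t r (b e r.-1) =
    qcomm v (qcomm v (b e r.-1) (b e r)) (b (~~ e) r) - K e r * b e r.-1;
  tb_r0 : forall e, r = 1%N -> t 1 (b e 0) =
    v *: qcomm 1 (qcomm 1 (qcomm v (b e 0) (b true 1)) (b false 1)) (qcomm v (b false 1) (b true 1))
      - qcomm 1 (b e 0) (qcomm (v ^+ 3) (b false 1) (b true 1)) * K true 1
      + v *: (b e 0 * K true 1 * K false 1);
  tK_far : forall e k l, (k <= r)%N -> (l <= r)%N -> far k l -> t k (K e l) = K e l;
  tK_mid : forall e k, (0 < k < r)%N -> t k (K e k) = v ^- 2 *: Ki e k;
  tK_adj : forall e k l, (0 < k < r)%N -> (0 < l <= r)%N -> (l == k.+1) || (l.+1 == k) ->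
    t k (K e l) = - (v *: (K e l * K e k));
  tK_10 : forall e, (1 < r)%N -> t 1 (K e 0) = v ^+ 2 *: (K e 0 * K true 1 * K false 1);
  tK_00 : forall e, t 0 (K e 0) = Ki e 0;
  tK_01 : forall e, t 0 (K e 1) = K e 1 * K e 0;
  tK_rr : forall e, t r (K e r) = v^-1 *: Ki (~~ e) r;
  tK_r1 : forall e, (1 < r)%N -> t r (K e r.-1) = v *: (K e r.-1 * (K e r * K (~~ e) r));
  tK_r0 : forall e, r = 1%N -> t 1 (K e 0) = v ^+ 2 *: (K e 0 * (K true 1 * K false 1) ^+ 2)
}.
End Data.

Section Zpow.
Variables (A : algType Qv) (x y : A).
Lemma zpow0 : zpow x y (- 0) = 1. Proof. by []. Qed.
Lemma zpow1 : zpow x y (- -1) = x. Proof. exact: expr1. Qed.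
Lemma zpowN2 : zpow x y (- 2) = y ^+ 2. Proof. by []. Qed.
Lemma zpow_10 : zpow x y (- -1 - 0) = x. Proof. exact: expr1. Qed.
Lemma zpow_01 : zpow x y (- 0 - -1) = x. Proof. exact: expr1. Qed.
Lemma zpow_21 : zpow x y (- 2 - -1) = y. Proof. exact: expr1. Qed.
Lemma zpow_12 : zpow x y (- -1 - 2) = y. Proof. exact: expr1. Qed.
Lemma zpow_11 : zpow x y (- -1 - -1) = x ^+ 2. Proof. by []. Qed.
Lemma mulK_sqr : x * y = 1 -> x * y ^+ 2 = y.
Proof. by move=> E; rewrite expr2 mulrA E mul1r. Qed.
Lemma inv_comm (xi yi : A) : x * xi = 1 -> xi * x = 1 -> y * yi = 1 -> yi * y = 1 ->
  x * y = y * x -> xi * yi = yi * xi.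
Proof.
move=> h1 h2 h3 h4 h.
have h5 : x * yi = yi * x by rewrite -[x * yi]mul1r -h4 -!mulrA (mulrA y) -h -(mulrA x) h3 mulr1.
by rewrite -[yi * xi]mul1r -h2 -!mulrA (mulrA x) h5 -(mulrA yi) h1 mulr1.
Qed.
End Zpow.

Section Zexp.
Variables (F : fieldType) (x : F).
Lemma zexp_20 : x ^ (- 2 - 0) = x ^- 2. Proof. by []. Qed.
Lemma zexp_02 : x ^ (- 0 - 2) = x ^- 2. Proof. by []. Qed.
Lemma zexp_10 : x ^ (- -1 - 0) = x. Proof. exact: expr1. Qed.
Lemma zexp_01 : x ^ (- 0 - -1) = x. Proof. exact: expr1. Qed.
Lemma zexp_11 : x ^ (- -1 - -1) = x ^+ 2. Proof. by []. Qed.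
Lemma zexp21 : x ^ (- (2 + -1)) = x^-1. Proof. by []. Qed.
Lemma zexp12 : x ^ (- (-1 + 2)) = x^-1. Proof. by []. Qed.
Lemma zexp10 : x ^ (- (-1 + 0)) = x. Proof. exact: expr1. Qed.
Lemma zexp01 : x ^ (- (0 + -1)) = x. Proof. exact: expr1. Qed.
Lemma zexp11 : x ^ (- (-1 + -1)) = x ^+ 2. Proof. by []. Qed.
End Zexp.

Section Uiq.
Variable r : nat.
Hypothesis r_gt0 : (0 < r)%N.
Local Notation nd := (nd r).

Definition ub e k : Uiq r := B (nd e k).
Definition uK e k : Uiq r := K (nd e k).
Definition uKi e k : Uiq r := Kinv (nd e k).

Lemma Uiq_data : iq_data r ub uK uKi.
Proof.
split; rewrite /ub /uK /uKi.
- by move=> e e'; rewrite !(nd0 r_gt0).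
- by move=> e e'; rewrite !(nd0 r_gt0).
- by move=> e e'; rewrite !(nd0 r_gt0).
- by move=> e k; exact: iq_KV.
- by move=> e k; exact: iq_VK.
- by move=> e k e' l; exact: iq_KK.
- by move=> e k e' l kr lr; have := iq_KB (nd e k) (nd e' l); rewrite tau_nd (kb_weightE r_gt0).
- move=> e k e' l kr lr kl a; apply: iq_BB; first by rewrite (cartan_nd r_gt0) // (negPf kl) (negPf a).
  by apply/eqP; rewrite tau_nd (nd_eq r_gt0) // eq_sym (negPf kl).
- move=> e k e' l /andP[k0 kr] lr kl a; have := @iq_serre r (nd e k) (nd e' l).
  rewrite qnum2; apply; first by rewrite (cartan_nd r_gt0) // (negPf kl) a.
    by apply/eqP; rewrite tau_nd (nd_eq r_gt0) // eq_sym (negPf kl).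
  by apply/eqP; rewrite tau_nd (nd_eq r_gt0) //; case: (e); lia.
- move=> e k /andP[k0 kr]; have := @iq_Btau r (nd e k); rewrite tau_nd; apply.
  by rewrite (cartan_nd r_gt0) // /adj; try lia; case: (e) => /=; repeat case: ifP; lia.
- move=> e e'; have := @iq_serre_fix r (nd e 0) (nd e' 1); rewrite qnum2; apply.
    by rewrite (cartan_nd r_gt0) // /adj; case: (e); case: (e') => /=; repeat case: ifP; lia.
  by rewrite tau_nd !(nd0 r_gt0).
- move=> e; have := @iq_serre_tau r (nd e r); rewrite tau_nd qnum2; apply.
  by rewrite (cartan_nd r_gt0) // /adj; case: (e) => /=; repeat case: ifP; lia.
Qed.

Variable T : 'I_r.+1 -> algAut (Uiq r).
Hypothesis T_sym : forall i, is_symmetry i (T i).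
Let t k := T (inord k).

Lemma tBE k e l : (k <= r)%N -> t k (ub e l) =
  let i0 := nd true k in let i1 := nd false k in let j := nd e l in
  let a := (cartan i0 j, cartan i1 j) in
  if k == 0%N then
    if j == i0 then Kinv i0 * B i0
    else if cartan i0 j == -1 then qcomm v (B j) (B i0)
    else B j
  else if (k < r)%N then
    if j == i0 then - (Kinv i0 * B i1)
    else if j == i1 then - (Kinv i1 * B i0)
    else if a == (-1, 0) then qcomm v (B j) (B i0)
    else if a == (0, -1) then qcomm v (B j) (B i1)
    else if a == (-1, -1) then
      qcomm v (qcomm v (B j) (B i0)) (B i1) - v *: (B j * K i0)
    else B j
  else
    if j == i0 then - (v ^- 2 *: (B i0 * Kinv i1))
    else if j == i1 then - (v ^- 2 *: (B i1 * Kinv i0))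
    else if a == (-1, 0) then
      qcomm v (qcomm v (B j) (B i0)) (B i1) - K i0 * B j
    else if a == (0, -1) then
      qcomm v (qcomm v (B j) (B i1)) (B i0) - K i1 * B j
    else if a == (-1, -1) then
      v *: qcomm 1 (qcomm 1 (qcomm v (B j) (B i0)) (B i1)) (qcomm v (B i1) (B i0))
      - qcomm 1 (B j) (qcomm (v ^+ 3) (B i1) (B i0)) * K i0
      + v *: (B j * K i0 * K i1)
    else B j.
Proof. by move=> kr; have [_ ->] := T_sym (inord k) (nd e l); rewrite /T_B inordK. Qed.

Lemma tKE k e l : (k <= r)%N -> t k (uK e l) =
  let i0 := nd true k in let i1 := nd false k in let j := nd e l in
  if k == 0%N then K j * Kz i0 (- cartan i0 j)
  else if (k < r)%N then
    (- v) ^ (- cartan i0 j - cartan i1 j) *: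
      (K j * Kz i0 (- cartan i0 j) * Kz i1 (- cartan i1 j))
  else
    v ^ (- (cartan i0 j + cartan i1 j)) *:
      (K j * zpow (K i0 * K i1) (Kinv i1 * Kinv i0) (- cartan i0 j - cartan i1 j)).
Proof. by move=> kr; have [-> _] := T_sym (inord k) (nd e l); rewrite /T_K inordK. Qed.

Lemma cT (e : bool) k l c0 c1 : (k <= r)%N -> (l <= r)%N ->
  (if (k == l) && (e || (k == 0%N)) then 2 else if adj r true k e l then -1 else 0) = c0 ->
  (if (k == l) && (~~ e || (k == 0%N)) then 2 else if adj r false k e l then -1 else 0) = c1 ->
  (cartan (nd true k) (nd e l) = c0) * (cartan (nd false k) (nd e l) = c1).
Proof. by move=> kr lr <- <-; rewrite !(cartan_nd r_gt0) //; case: (e). Qed.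

Lemma Uiq_sym : iq_sym r ub uK uKi t.
Proof.
split.
- move=> e k l kr lr; rewrite /far => kl.
  have C : (cartan (nd true k) (nd e l) = 0) * (cartan (nd false k) (nd e l) = 0).
    by apply: cT => //; rewrite /adj; case: (e) => /=; repeat case: ifP; lia.
  by rewrite tBE //= !C !(nd_eq r_gt0) //=; repeat (case: ifP => //; try lia).
- move=> e k /andP[k0 kr]; have kr' : (k <= r)%N by lia.
  rewrite tBE //= !(nd_eq r_gt0) // kr (gtn_eqF k0) eqxx.
  by case: (e).
- move=> e k l /andP[k0 kr] /andP[l0 lr] kl; have kr' : (k <= r)%N by lia.
  have C : (cartan (nd true k) (nd e l) = if e then -1 else 0)
         * (cartan (nd false k) (nd e l) = if e then 0 else -1).
    by apply: cT => //; rewrite /adj; case: (e) => /=; repeat case: ifP; lia.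
  rewrite tBE //= !C !(nd_eq r_gt0) //= kr (gtn_eqF k0).
  have -> : (l == k) = false by lia.
  by case: (e).
- move=> e r1; have C : (cartan (nd true 1) (nd e 0) = -1) * (cartan (nd false 1) (nd e 0) = -1).
    by apply: cT => //; rewrite /adj; case: (e) => /=; repeat case: ifP; lia.
  by rewrite tBE //= !C !(nd_eq r_gt0) //= r1.
- by move=> e; rewrite tBE //= !(nd_eq r_gt0) //= orbT /ub /uKi !(nd0 r_gt0).
- move=> e; have C : (cartan (nd true 0) (nd e 1) = -1) * (cartan (nd false 0) (nd e 1) = -1).
    by apply: cT => //; rewrite /adj; case: (e) => /=; repeat case: ifP; lia.
  have D : (nd e 1 == nd true 0) = false by rewrite (nd_eq r_gt0).
  by rewrite tBE //; cbv zeta; rewrite eqxx C.1 D eqxx /ub !(nd0 r_gt0).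
- by move=> e; rewrite tBE //= !(nd_eq r_gt0) //= (gtn_eqF r_gt0) ltnn eqxx; case: (e).
- move=> e r1; have r1' : (r.-1 <= r)%N by lia.
  have C : (cartan (nd true r) (nd e r.-1) = if e then -1 else 0)
         * (cartan (nd false r) (nd e r.-1) = if e then 0 else -1).
    by apply: cT => //; rewrite /adj; case: (e) => /=; repeat case: ifP; lia.
  rewrite tBE //= !C !(nd_eq r_gt0) //= (gtn_eqF r_gt0) ltnn.
  have -> : (r.-1 == r) = false by lia.
  by case: (e).
- move=> e r1; have C : (cartan (nd true 1) (nd e 0) = -1) * (cartan (nd false 1) (nd e 0) = -1).
    by apply: cT => //; rewrite /adj; case: (e) => /=; repeat case: ifP; lia.
  rewrite tBE //= !C !(nd_eq r_gt0) //= [X in (1 < X)%N]r1.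
  by [].
- move=> e k l kr lr; rewrite /far => kl.
  have C : (cartan (nd true k) (nd e l) = 0) * (cartan (nd false k) (nd e l) = 0).
    by apply: cT => //; rewrite /adj; case: (e) => /=; repeat case: ifP; lia.
  rewrite tKE //= !C.
  rewrite /Kz !zpow0 (_ : - 0 - 0 = - 0) // (_ : - (0 + 0) = - 0) // !mulr1 !scale1r.
  by case: ifP => //; case: ifP.
- move=> e k /andP[k0 kr]; have kr' : (k <= r)%N by lia.
  have C : (cartan (nd true k) (nd e k) = if e then 2 else 0)
         * (cartan (nd false k) (nd e k) = if e then 0 else 2).
    by apply: cT => //; rewrite /adj; case: (e) => /=; repeat case: ifP; lia.
  rewrite tKE //= !C kr (gtn_eqF k0) /Kz.
  case: (e); rewrite zpow0 zpowN2 mulr1 (mulK_sqr (iq_KV _)); first by rewrite zexp_20 sqrrN.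
  by rewrite zexp_02 sqrrN.
- move=> e k l /andP[k0 kr] /andP[l0 lr] kl; have kr' : (k <= r)%N by lia.
  have C : (cartan (nd true k) (nd e l) = if e then -1 else 0)
         * (cartan (nd false k) (nd e l) = if e then 0 else -1).
    by apply: cT => //; rewrite /adj; case: (e) => /=; repeat case: ifP; lia.
  rewrite tKE //= !C kr (gtn_eqF k0) /Kz.
  by case: (e); rewrite zpow0 zpow1 mulr1 (zexp_10, zexp_01) scaleNr.
- move=> e r1; have C : (cartan (nd true 1) (nd e 0) = -1) * (cartan (nd false 1) (nd e 0) = -1).
    by apply: cT => //; rewrite /adj; case: (e) => /=; repeat case: ifP; lia.
  by rewrite tKE //; cbv zeta; rewrite C.1 C.2 r1 /Kz !zpow1 zexp_11 sqrrN.
- move=> e; rewrite tKE //; cbv zeta.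
  have -> : cartan (nd true 0) (nd e 0) = 2 by rewrite !(nd0 r_gt0) /cartan eqxx.
  by rewrite /Kz eqxx zpowN2 /uKi !(nd0 r_gt0) (mulK_sqr (iq_KV _)).
- move=> e; have C : (cartan (nd true 0) (nd e 1) = -1) * (cartan (nd false 0) (nd e 1) = -1).
    by apply: cT => //; rewrite /adj; case: (e) => /=; repeat case: ifP; lia.
  by rewrite (tKE _ _ (leq0n r)) /= C.1 /Kz zpow1 /uK !(nd0 r_gt0).
- move=> e; have C : (cartan (nd true r) (nd e r) = if e then 2 else -1)
         * (cartan (nd false r) (nd e r) = if e then -1 else 2).
    by apply: cT => //; rewrite /adj; case: (e) => /=; repeat case: ifP; lia.
  rewrite tKE //= !C (gtn_eqF r_gt0) ltnn /uK /uKi.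
  have KC : Kinv (nd false r) * Kinv (nd true r) = Kinv (nd true r) * Kinv (nd false r).
    have I j : Kinv j * K j = 1 := iq_VK j.
    exact: inv_comm (iq_KV _) (iq_VK _) (iq_KV _) (iq_VK _) (iq_KK _ _).
  case: (e); first by rewrite zexp21 zpow_21 KC mulrA iq_KV mul1r.
  by rewrite zexp12 zpow_12 mulrA iq_KV mul1r.
- move=> e r1; have r1' : (r.-1 <= r)%N by lia.
  have C : (cartan (nd true r) (nd e r.-1) = if e then -1 else 0)
         * (cartan (nd false r) (nd e r.-1) = if e then 0 else -1).
    by apply: cT => //; rewrite /adj; case: (e) => /=; repeat case: ifP; lia.
  rewrite tKE //= !C (gtn_eqF r_gt0) ltnn.
  case: (e); first by rewrite zexp10 zpow_10.
  by rewrite zexp01 zpow_01 [K (nd true r) * _]iq_KK.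
- move=> e r1; have C : (cartan (nd true 1) (nd e 0) = -1) * (cartan (nd false 1) (nd e 0) = -1).
    by apply: cT => //; rewrite /adj; case: (e) => /=; repeat case: ifP; lia.
  rewrite (tKE _ _ r_gt0) /= C.1 C.2 zexp11 [X in (1 < X)%N]r1.
  by rewrite zpow_11.
Qed.
End Uiq.

Lemma inv_weight (A : algType Qv) (c : Qv) (x y z : A) : c != 0 ->
  x * y = 1 -> y * x = 1 -> x * z = c *: (z * x) -> y * z = c^-1 *: (z * y).
Proof.
move=> c0 xy yx E; rewrite -[z * y]mul1r -yx -!mulrA (mulrA x) E -scalerAl -mulrA xy mulr1.
by rewrite -scalerAr scalerA mulVf // scale1r.
Qed.

Lemma am_fix_inv (F : comNzRingType) (A : lalgType F) (f : A -> A) x y : alg_morph f ->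
  x * y = 1 -> y * x = 1 -> f x = x -> f y = y.
Proof. by move=> fM xy yx fx; apply: (am_inv_uniq fM xy yx); rewrite fx. Qed.

(** * Symmetries on generators *)

Section Theory.
Variables (A : algType Qv) (r : nat) (b K Ki : bool -> nat -> A).
Hypothesis r_gt0 : (0 < r)%N.
Hypothesis D : iq_data r b K Ki.
Local Notation v0 := v_neq0.
Local Notation "[ a , b ]_v" := (qcomm v a b) (at level 0).

Lemma Kb_w (m : int) c e k e' l : (k <= r)%N -> (l <= r)%N -> kb_weight r e k e' l = m -> v ^ m = c ->
  K e k * b e' l = c *: (b e' l * K e k).
Proof. by move=> kr lr <- <-; exact: (Kb D). Qed.
Lemma Kib_w (m : int) c e k e' l : (k <= r)%N -> (l <= r)%N -> kb_weight r e k e' l = m -> v ^ (- m) = c ->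
  Ki e k * b e' l = c *: (b e' l * Ki e k).
Proof.
move=> kr lr <- <-; rewrite -invr_expz; apply: inv_weight (KV D _ _) (VK D _ _) (Kb D _ _ _ _) => //.
by rewrite expfz_neq0 // v0.
Qed.

Lemma Ki_comm e k e' l : Ki e k * Ki e' l = Ki e' l * Ki e k.
Proof. exact: inv_comm (KV D _ _) (VK D _ _) (KV D _ _) (VK D _ _) (KK D _ _ _ _). Qed.
Lemma KiK e k e' l : Ki e k * K e' l = K e' l * Ki e k.
Proof.
have := @inv_weight A 1 _ _ _ (oner_neq0 _) (KV D e k) (VK D e k); rewrite invr1.
by move=> /(_ (K e' l)); rewrite !scale1r; apply; exact: KK D _ _ _ _.
Qed.

Lemma Kb_mid e k : (0 < k < r)%N -> K e k * b e k = v ^- 2 *: (b e k * K e k).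
Proof.
by move=> kr; apply: (@Kb_w (- 2)) => //; try lia;
  rewrite /kb_weight; repeat case: ifP; lia.
Qed.
Lemma Kb_mid' e k : (0 < k < r)%N -> K e k * b (~~ e) k = v ^+ 2 *: (b (~~ e) k * K e k).
Proof.
by move=> kr; apply: (@Kb_w 2) => //; try lia;
  case: e; rewrite /kb_weight /=; repeat case: ifP; lia.
Qed.
Lemma Kb_adj e k l : (0 < k <= r)%N -> (0 < l <= r)%N -> (l == k.+1) || (k == l.+1) ->
  K e k * b e l = v *: (b e l * K e k).
Proof.
by move=> kr lr kl; apply: (@Kb_w 1) => //; try lia;
  rewrite /kb_weight; repeat case: ifP; lia.
Qed.
Lemma Kb_adj' e k l : (0 < k <= r)%N -> (0 < l <= r)%N -> (l == k.+1) || (k == l.+1) ->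
  K e k * b (~~ e) l = v^-1 *: (b (~~ e) l * K e k).
Proof.
by move=> kr lr kl; apply: (@Kb_w (- 1)) => //; try lia;
  case: e; rewrite /kb_weight /=; repeat case: ifP; lia.
Qed.
Lemma Kb_k0 e e' k : (k <= r)%N -> K e k * b e' 0 = b e' 0 * K e k.
Proof. by move=> kr; rewrite -[RHS]scale1r; apply: (@Kb_w 0) => //; rewrite /kb_weight orbT. Qed.
Lemma Kb_rr e : K e r * b e r = v ^- 3 *: (b e r * K e r).
Proof. by apply: (@Kb_w (- 3)) => //; rewrite /kb_weight; repeat case: ifP; lia. Qed.
Lemma Kb_rr' e : K e r * b (~~ e) r = v ^+ 3 *: (b (~~ e) r * K e r).
Proof. by apply: (@Kb_w 3) => //; case: e; rewrite /kb_weight /=; repeat case: ifP; lia. Qed.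

Lemma Kib_mid e k : (0 < k < r)%N -> Ki e k * b e k = v ^+ 2 *: (b e k * Ki e k).
Proof.
by move=> kr; apply: (@Kib_w (- 2)) => //; try lia;
  rewrite /kb_weight; repeat case: ifP; lia.
Qed.
Lemma Kib_mid' e k : (0 < k < r)%N -> Ki e k * b (~~ e) k = v ^- 2 *: (b (~~ e) k * Ki e k).
Proof.
by move=> kr; apply: (@Kib_w 2) => //; try lia;
  case: e; rewrite /kb_weight /=; repeat case: ifP; lia.
Qed.
Lemma Kib_adj e k l : (0 < k <= r)%N -> (0 < l <= r)%N -> (l == k.+1) || (k == l.+1) ->
  Ki e k * b e l = v^-1 *: (b e l * Ki e k).
Proof.
by move=> kr lr kl; apply: (@Kib_w 1) => //; try lia;
  rewrite /kb_weight; repeat case: ifP; lia.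
Qed.
Lemma Kib_adj' e k l : (0 < k <= r)%N -> (0 < l <= r)%N -> (l == k.+1) || (k == l.+1) ->
  Ki e k * b (~~ e) l = v *: (b (~~ e) l * Ki e k).
Proof.
by move=> kr lr kl; apply: (@Kib_w (- 1)) => //; try lia;
  case: e; rewrite /kb_weight /=; repeat case: ifP; lia.
Qed.
Lemma Kib_0l e e' l : (l <= r)%N -> Ki e 0 * b e' l = b e' l * Ki e 0.
Proof. by move=> lr; rewrite -[RHS]scale1r; apply: (@Kib_w 0). Qed.
Lemma Kib_k0 e e' k : (k <= r)%N -> Ki e k * b e' 0 = b e' 0 * Ki e k.
Proof. by move=> kr; rewrite -[RHS]scale1r; apply: (@Kib_w 0) => //; rewrite /kb_weight orbT. Qed.
Lemma Kib_rr e : Ki e r * b e r = v ^+ 3 *: (b e r * Ki e r).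
Proof. by apply: (@Kib_w (- 3)) => //; rewrite /kb_weight; repeat case: ifP; lia. Qed.
Lemma Kib_rr' e : Ki e r * b (~~ e) r = v ^- 3 *: (b (~~ e) r * Ki e r).
Proof. by apply: (@Kib_w 3) => //; case: e; rewrite /kb_weight /=; repeat case: ifP; lia. Qed.

Lemma mid_adj e k l : (0 < k < r)%N -> (0 < l <= r)%N -> (l == k.+1) || (l.+1 == k) ->
  [- (Ki e k * b (~~ e) k), [b e l, b e k]_v]_v = b e l.
Proof.
move=> kr lr kl; have kr' : (0 < k <= r)%N by lia.
have kl' : (l == k.+1) || (k == l.+1) by lia.
have E := b_tau D e kr.
apply: (@mid_fg_qcomm _ _ _ v0 _ _ _ (K e k) _ ((v - v^-1)^-1 *: (K e k - K (~~ e) k))).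
- exact: KV D _ _.
- by rewrite -scalerAl -scalerAr mulrBl mulrBr !KiK.
- by rewrite -E addrC subrK.
- apply: (bb D); try lia; rewrite /adj; case: (e) => /=; lia.
- rewrite (@kcomm _ _ v v v^-1 1) ?v_sub_neq0 ?scale1r ?mul1r //.
    exact: Kb_adj.
  by have := Kb_adj' (~~ e) kr' lr kl'; rewrite negbK.
- exact: Kib_mid'.
- exact: Kib_mid.
- exact: Kib_adj.
Qed.

Variable t : nat -> A -> A.
Hypothesis tM : forall k, alg_morph (t k).
Hypothesis S : iq_sym r b K Ki t.
Let morph_M k := am_M (tM k).
Let morph_B k := am_B (tM k).
Let morph_Z k := am_Z (tM k).
Let morph_N k := am_N (tM k).
Let morphE := (morph_B, morph_N, morph_Z, morph_M).

Lemma t_qcomm k x y : t k [x, y]_v = [t k x, t k y]_v.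
Proof. exact: am_qcomm. Qed.

Lemma b_up e k : (0 < k)%N -> (k.+1 < r)%N -> t k (t k.+1 (b e k)) = b e k.+1.
Proof.
move=> k0 kr; rewrite (tb_adj S) ?t_qcomm; try lia.
by rewrite (tb_mid S) ?(tb_adj S) ?mid_adj //; lia.
Qed.

Lemma b_dn e k : (0 < k)%N -> (k.+1 < r)%N -> t k.+1 (t k (b e k.+1)) = b e k.
Proof.
move=> k0 kr; rewrite (tb_adj S) ?t_qcomm; try lia.
by rewrite (tb_mid S) ?(tb_adj S) ?mid_adj //; lia.
Qed.

Lemma serre_adj e k l : (0 < k <= r)%N -> (l <= r)%N -> (l == k.+1) || (l.+1 == k) ->
  b e k ^+ 2 * b e l - (v + v^-1) *: (b e k * b e l * b e k) + b e l * b e k ^+ 2 = 0.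
Proof.
move=> kr lr kl; apply: (b_serre D) => //; first lia.
by rewrite /adj eqxx; lia.
Qed.

Section Wide.
Hypothesis r_gt1 : (1 < r)%N.
Local Notation q := r.-1.

Lemma q_mid : (0 < q < r)%N. Proof. lia. Qed.
Lemma q_le : (0 < q <= r)%N. Proof. lia. Qed.
Lemma r_le : (0 < r <= r)%N. Proof. lia. Qed.
Lemma rq_adj : (q == r.+1) || (q.+1 == r). Proof. lia. Qed.
Lemma rq_adj' : (q == r.+1) || (r == q.+1). Proof. lia. Qed.
Lemma qr_adj : (r == q.+1) || (r.+1 == q). Proof. lia. Qed.

Lemma qr_adj' : (r == q.+1) || (q == r.+1). Proof. lia. Qed.

Lemma b_rq_comm e : b (~~ e) r * b e q = b e q * b (~~ e) r.
Proof. by apply: (bb D); rewrite /adj; try lia; case: (e); lia. Qed.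

Lemma tr_b_rq e : t r [b e r, b e q]_v = [b e q, b e r]_v.
Proof.
rewrite t_qcomm (tb_rr S) (tb_r1 S) //.
apply: (@end_T_qcomm _ _ _ v0 (b (~~ e) r) (b e r) (b e q) (K (~~ e) r)).
- exact: b_rq_comm.
- exact: serre_adj r_le (leq_pred r) rq_adj.
- exact: (b_serre_r D).
- exact: Kb_rr.
- by have := Kb_rr' (~~ e); rewrite negbK.
- exact: Kb_rr'.
- exact: Kb_rr.
- by have := Kb_adj' (~~ e) r_le q_le rq_adj'; rewrite negbK.
- exact: (Kb_adj e r_le q_le rq_adj').
- exact: (KV D).
- by have := Kib_rr' (~~ e); rewrite negbK.
- exact: Kib_rr.
- by have := Kib_adj' (~~ e) r_le q_le rq_adj'; rewrite negbK.
- exact: KiK.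
- exact: v_add_neq0.
Qed.

(** An explicit preimage under [T_r]: in [b_end] both sides become values of [t r], and only their
    arguments are compared. [t1_b0_inv] serves [b_0] in the same way. *)
Lemma tr_b_q_inv e :
  t r ([b (~~ e) r, [b e r, b e q]_v]_v - v *: (K (~~ e) r * b e q)) = b e q.
Proof.
rewrite morph_B morph_Z morph_M t_qcomm tr_b_rq (tb_rr S) (tb_r1 S) // (tK_rr S) negbK.
apply: (@end_T_inv _ _ _ v0 (b (~~ e) r) (b e r) (b e q) (K e r)).
- exact: (VK D).
- exact: (Kib_rr e).
- by have := Kib_rr' e.
- exact: (Kib_adj e r_le q_le rq_adj').
Qed.

Lemma b_r e : t q (t r (t q (b e r))) = b e r.
Proof.
rewrite (tb_adj S) ?q_mid ?r_le ?qr_adj // tr_b_rq t_qcomm (tb_mid S) ?q_mid //.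
by rewrite (tb_adj S) ?q_mid ?r_le ?qr_adj // mid_adj ?q_mid ?r_le ?qr_adj.
Qed.

Lemma b_end e : t r (t q (t r (b e q))) = b (~~ e) q.
Proof.
rewrite -[RHS]tr_b_q_inv negbK; congr (t r _).
rewrite (tb_r1 S) // morph_B morph_M !t_qcomm.
rewrite !(tb_adj S _ q_mid r_le qr_adj) (tb_mid S) ?q_mid // (tK_adj S _ q_mid r_le qr_adj).
rewrite (mid_adj e q_mid r_le qr_adj); congr (_ - _).
rewrite mulrNN -scalerAl -!mulrA (mulrA (K e q)) (KV D) mul1r.
by [].
Qed.

Let o1 : (0 < 1 < r)%N. Proof. lia. Qed.
Let o1' : (0 < 1 <= r)%N. Proof. lia. Qed.

Local Notation kap e := ((v - v^-1)^-1 *: (K e 1 - K (~~ e) 1)).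

Lemma kap_b0 e e' : kap e * b e' 0 = b e' 0 * kap e.
Proof. by rewrite -scalerAl -scalerAr mulrBl mulrBr !Kb_k0. Qed.
Lemma kap_K e e' : kap e * K e' 1 = K e' 1 * kap e.
Proof. by rewrite -scalerAl -scalerAr mulrBl mulrBr !(KK D _ _ e'). Qed.
Lemma kap_Ki e e' : kap e * Ki e' 1 = Ki e' 1 * kap e.
Proof. by rewrite -scalerAl -scalerAr mulrBl mulrBr !KiK. Qed.
Lemma gf_kap e : b (~~ e) 1 * b e 1 = b e 1 * b (~~ e) 1 + kap e.
Proof. by rewrite -(b_tau D) // addrC subrK. Qed.

Lemma kap_f e : kap e * b e 1 = v ^+ 2 *: (b e 1 * kap e) - (v + v^-1) *: (b e 1 * K e 1).
Proof.
rewrite (@kcomm _ _ v (v ^- 2) (v ^+ 2) (- (v + v^-1))) ?v_sub_neq0 //.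
- by rewrite scaleNr addrC.
- exact: Kb_mid.
- by have := Kb_mid' (~~ e) o1; rewrite negbK.
- by rewrite mulNr -opprB mulrC -subr_sqr exprVn.
Qed.
Lemma kap_g e :
  kap e * b (~~ e) 1 = v ^- 2 *: (b (~~ e) 1 * kap e) + (v + v^-1) *: (b (~~ e) 1 * K e 1).
Proof.
rewrite (@kcomm _ _ v (v ^+ 2) (v ^- 2) (v + v^-1)) ?v_sub_neq0 //.
- by rewrite addrC.
- exact: Kb_mid'.
- exact: Kb_mid.
- by rewrite mulrC -subr_sqr exprVn.
Qed.

Lemma serre_10 e e' : b e 1 ^+ 2 * b e' 0 - (v + v^-1) *: (b e 1 * b e' 0 * b e 1)
  + b e' 0 * b e 1 ^+ 2 = 0.
Proof. by rewrite (b0E D e' e); apply: serre_adj. Qed.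

(** The formula defining [T_1(B_0)] prefers one sign; by [start_T_sym] either may be used, and the
    lemmas below take both. *)
Lemma t1_b0 e e' : t 1 (b e' 0) =
  [[b e' 0, b e 1]_v, b (~~ e) 1]_v - v *: (b e' 0 * K e 1).
Proof.
rewrite (tb_10 S) //; case: e => //.
rewrite (@start_T_sym _ _ _ v0 (b true 1) (b false 1) (b e' 0) (K true 1) (kap true)).
- by rewrite scalerA mulfV ?v_sub_neq0 // scale1r opprB (addrCA (K true 1)) subrr addr0.
- exact: (gf_kap true).
- exact: kap_b0.
- by rewrite Kb_k0.
Qed.

Lemma t1_b10 e e' : t 1 [b e 1, b e' 0]_v = [b e' 0, b (~~ e) 1]_v.
Proof.
rewrite t_qcomm (tb_mid S) // (t1_b0 e).
apply: (@start_T_qcomm _ _ _ v0 (b e 1) (b (~~ e) 1) (b e' 0) (K e 1) (Ki e 1) (kap e)).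
- exact: gf_kap.
- exact: serre_10.
- exact: kap_b0.
- exact: kap_f.
- exact: kap_g.
- exact: Kb_k0.
- exact: Kb_mid.
- exact: Kb_mid'.
- exact: (KV D).
- exact: (VK D).
- exact: kap_K.
- exact: kap_Ki.
- exact: Kib_k0.
- exact: Kib_mid.
- exact: Kib_mid'.
Qed.

Lemma t1_b0_inv e e' :
  t 1 ([b e 1, [b (~~ e) 1, b e' 0]_v]_v - v *: (b e' 0 * K e 1)) = b e' 0.
Proof.
rewrite morph_B morph_Z morph_M (t_qcomm 1 (b e 1)) t1_b10 negbK (tb_mid S) //.
rewrite (t1_b0 e) (tK_mid S) //.
apply: (@start_T_inv _ _ _ v0 (b e 1) (b (~~ e) 1) (b e' 0) (K e 1) (Ki e 1) (kap e)).
- exact: gf_kap.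
- exact: serre_10.
- exact: kap_b0.
- exact: kap_f.
- exact: kap_g.
- exact: Kb_k0.
- exact: Kb_mid.
- exact: Kb_mid'.
- exact: (KV D).
- exact: (VK D).
- exact: kap_K.
- exact: kap_Ki.
- exact: Kib_k0.
- exact: Kib_mid.
- exact: Kib_mid'.
Qed.
End Wide.

Lemma t0_b01 e e' : t 0 [b e' 0, b e 1]_v = b e 1.
Proof.
rewrite t_qcomm (tb_00 S) (tb_01 S) (b0E D e e').
apply: (@T0_inv _ _ _ v0 _ _ (K e' 0)).
- exact: (KV D).
- exact: Kib_0l.
- exact: Kib_0l.
- exact: (b_serre0 D).
Qed.

Lemma b_st e : (1 < r)%N -> t 0 (t 1 (t 0 (b e 1))) = b (~~ e) 1.
Proof. by move=> r1; rewrite (tb_01 S) t1_b10 // t0_b01. Qed.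

Lemma b_0 e : (1 < r)%N -> t 1 (t 0 (t 1 (b e 0))) = b e 0.
Proof.
move=> r1; rewrite -[RHS](t1_b0_inv r1 true e); congr (t 1 _).
rewrite (t1_b0 r1 true) morph_B morph_Z morph_M.
rewrite (t_qcomm 0 _ (b (~~ true) 1)) (t_qcomm 0 (b e 0)) !(tb_01 S) !(tb_00 S) (tK_01 S).
have := t0_b01 true e; rewrite t_qcomm (tb_00 S) (tb_01 S) !(b0E D _ e) => ->.
congr (_ - v *: _); rewrite (K0E D true e).
have h := Kib_0l e e (leq0n r).
nc v0 [:: b e 0; K true 1; K e 0; Ki e 0] (tt, h, VK D e 0, KK D true 1 e 0).
Qed.

(** * The values of the same short words on the elements [K_k] *)

Let KC e k e' l : K e k * K e' l = K e' l * K e k := KK D e k e' l.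
Let KiC e k e' l : Ki e k * K e' l = K e' l * Ki e k := KiK e k e' l.
Let KiC' e k e' l : K e k * Ki e' l = Ki e' l * K e k := esym (KiK e' l e k).

Lemma K_up e k : (0 < k)%N -> (k.+1 < r)%N -> t k (t k.+1 (K e k)) = K e k.+1.
Proof.
move=> k0 kr; rewrite (tK_adj S) ?morphE; try lia.
rewrite (tK_mid S) ?(tK_adj S) //; try lia.
nc v0 [:: Ki e k; K e k; K e k.+1] (tt, VK D e k, KV D e k, KC e k.+1 e k, KiC' e k.+1 e k).
Qed.

Lemma K_dn e k : (0 < k)%N -> (k.+1 < r)%N -> t k.+1 (t k (K e k.+1)) = K e k.
Proof.
move=> k0 kr; rewrite (tK_adj S) ?morphE; try lia.
rewrite (tK_mid S) ?(tK_adj S) //; try lia.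
nc v0 [:: Ki e k.+1; K e k.+1; K e k]
  (tt, VK D e k.+1, KV D e k.+1, KC e k e k.+1, KiC' e k e k.+1).
Qed.

Section WideK.
Hypothesis r_gt1 : (1 < r)%N.
Local Notation q := r.-1.

Lemma K_r e : t q (t r (t q (K e r))) = K e r.
Proof.
have h : t r (t q (K e r)) = - (v *: (K e q * K e r)).
  rewrite (tK_adj S) ?q_mid ?r_le ?qr_adj // !morphE (tK_rr S) (tK_r1 S) //.
  nc v0 [:: K e q; Ki (~~ e) r; K (~~ e) r; K e r]
    (tt, VK D (~~ e) r, KiC (~~ e) r e q, KC (~~ e) r e q, KC e r (~~ e) r, KC e r e q,
     KiC' e r (~~ e) r).
rewrite h !morphE (tK_adj S _ (q_mid r_gt1) (r_le r_gt1) (qr_adj r_gt1)) (tK_mid S) ?q_mid //.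
nc v0 [:: Ki e q; K e q; K e r] (tt, VK D e q, KC e r e q, KiC' e r e q).
Qed.

Lemma K_end e : t r (t q (t r (K e q))) = K (~~ e) q.
Proof.
have h : t q (t r (K e q)) = v *: (K e r * K (~~ e) r * K (~~ e) q).
  rewrite (tK_r1 S) // !morphE !(tK_adj S _ (q_mid r_gt1) (r_le r_gt1) (qr_adj r_gt1)).
  rewrite (tK_mid S) ?q_mid //.
  nc v0 [:: Ki e q; K e q; K e r; K (~~ e) r; K (~~ e) q]
    (tt, VK D e q, KC e r e q, KiC' e r e q, KC (~~ e) r e q, KiC' (~~ e) r e q).
rewrite h !morphE !(tK_rr S) (tK_r1 S) // negbK.
nc v0 [:: Ki e r; K e r; Ki (~~ e) r; K (~~ e) r; K (~~ e) q]
  (tt, VK D e r, VK D (~~ e) r, Ki_comm (~~ e) r e r, KC (~~ e) r e r, KiC (~~ e) r e r, KiC' (~~ e) r e r,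
   KC (~~ e) q e r, KC (~~ e) q (~~ e) r, KiC' (~~ e) q e r, KiC' (~~ e) q (~~ e) r).
Qed.

Let o1 : (0 < 1 < r)%N. Proof. lia. Qed.

Lemma t1_K0 e e' : t 1 (K e' 0) = v ^+ 2 *: (K e' 0 * K e 1 * K (~~ e) 1).
Proof. by rewrite (tK_10 S) //; case: e; rewrite // -!mulrA (KC true). Qed.

Lemma t1_sq_K0 e : t 1 (t 1 (K e 0)) = K e 0.
Proof.
rewrite (t1_K0 e) !morphE (t1_K0 e) !(tK_mid S) //.
nc v0 [:: K e 0; K e 1; Ki e 1; K (~~ e) 1; Ki (~~ e) 1]
  (tt, KV D e 1, KV D (~~ e) 1, KiC' (~~ e) 1 e 1).
Qed.

Lemma K_st e : t 0 (t 1 (t 0 (K e 1))) = K (~~ e) 1.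
Proof.
have h : t 1 (t 0 (K e 1)) = K e 0 * K (~~ e) 1.
  rewrite (tK_01 S) !morphE (tK_mid S) // (t1_K0 e).
  nc v0 [:: Ki e 1; K e 1; K e 0; K (~~ e) 1] (tt, VK D e 1, KC e 0 e 1, KiC' e 0 e 1).
rewrite h !morphE (tK_00 S) (tK_01 S) (K0E D (~~ e) e).
nc v0 [:: Ki e 0; K e 0; K (~~ e) 1]
  (tt, VK D e 0, KC (~~ e) 1 e 0, KiC' (~~ e) 1 e 0).
Qed.

Lemma K_0 e : t 1 (t 0 (t 1 (K e 0))) = K e 0.
Proof.
have h : t 0 (t 1 (K e 0)) = v ^+ 2 *: (K e 1 * K (~~ e) 1 * K e 0).
  rewrite (t1_K0 e) !morphE (tK_00 S) !(tK_01 S) !(K0E D (~~ e) e).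
  nc v0 [:: K e 1; K (~~ e) 1; Ki e 0; K e 0]
    (tt, VK D e 0, KC e 0 e 1, KC e 0 (~~ e) 1, KiC e 0 e 1, KiC e 0 (~~ e) 1).
rewrite h !morphE (t1_K0 e) !(tK_mid S) //.
nc v0 [:: Ki e 1; K e 1; Ki (~~ e) 1; K (~~ e) 1; K e 0]
  (tt, VK D e 1, VK D (~~ e) 1, Ki_comm (~~ e) 1 e 1, KC (~~ e) 1 e 1, KiC (~~ e) 1 e 1, KiC' (~~ e) 1 e 1,
   KC e 0 e 1, KC e 0 (~~ e) 1, KiC' e 0 e 1, KiC' e 0 (~~ e) 1).
Qed.
End WideK.

End Theory.

(** * The action of T_i and T_(varpi_i) *)

Section Node.
Variables (A : algType Qv) (r : nat) (b K Ki : bool -> nat -> A).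
Hypothesis r_gt0 : (0 < r)%N.
Hypothesis D : iq_data r b K Ki.
Variables t ti : nat -> A -> A.
Hypothesis tM : forall k, alg_morph (t k).
Hypothesis S : iq_sym r b K Ki t.
Hypotheses (tK : forall k, cancel (t k) (ti k)) (tiK : forall k, cancel (ti k) (t k)).
Hypothesis t_far : forall k l x, (k <= r)%N -> (l <= r)%N -> far k l -> t k (t l x) = t l (t k x).
Hypothesis t_br3 : forall k x, (0 < k)%N -> (k.+1 < r)%N ->
  t k (t k.+1 (t k x)) = t k.+1 (t k (t k.+1 x)).
Hypothesis t_br40 : forall x, (1 < r)%N -> t 0 (t 1 (t 0 (t 1 x))) = t 1 (t 0 (t 1 (t 0 x))).
Hypothesis t_br4r : forall x, (1 < r)%N ->
  t r.-1 (t r (t r.-1 (t r x))) = t r (t r.-1 (t r (t r.-1 x))).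
Local Notation v0 := v_neq0.
Local Notation "[ a , b ]_v" := (qcomm v a b) (at level 0).
Local Notation P := (P t ti).
Local Notation Q := (Q r t).
Local Notation Tp := (Tp r t).

Lemma tiM k : alg_morph (ti k).
Proof. exact: alg_morph_can (tK k) (tiK k) (tM k). Qed.
Lemma twM s : alg_morph (tw t s).
Proof. by elim: s => [|k s IH]; [exact: alg_morph_id | exact: (alg_morph_comp (tM k) IH)]. Qed.
Lemma PM m : alg_morph (P m).
Proof.
elim: m => [|m IH]; first exact: tM.
exact: (alg_morph_comp (tiM _) (alg_morph_comp IH (tM _))).
Qed.
Lemma QM m : alg_morph (Q m). Proof. exact: twM. Qed.

Let bfar := tb_far S.
Let bup := b_up r_gt0 D tM S.
Let bdn := b_dn r_gt0 D tM S.
Let bend e r1 := b_end r_gt0 D tM S r1 e.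
Let bst := b_st r_gt0 D tM S.
Let br e r1 := b_r r_gt0 D tM S r1 e.
Let b0 := b_0 r_gt0 D tM S.
Let Kfar := tK_far S.
Let Kup := K_up r_gt0 D tM S.
Let Kdn := K_dn r_gt0 D tM S.
Let Kend e r1 := K_end r_gt0 D tM S r1 e.
Let Kst e r1 := K_st r_gt0 D tM S r1 e.
Let Kr e r1 := K_r r_gt0 D tM S r1 e.
Let K0 e r1 := K_0 r_gt0 D tM S r1 e.

Let QTpb e m := @Q_Tp _ _ _ _ tK tiK t_far t_br3 t_br40 t_br4r _ bfar bup bdn bend br e m.
Let QTpK e m := @Q_Tp _ _ _ _ tK tiK t_far t_br3 t_br40 t_br4r _ Kfar Kup Kdn Kend Kr e m.
Let PtPb e m := @PtP _ _ _ _ tK tiK t_far t_br3 _ bdn bst e m.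
Let PtPK e m := @PtP _ _ _ _ tK tiK t_far t_br3 _ Kdn Kst e m.
Let Pb e m l := @P_fix _ _ _ _ tK tiK _ bfar e m l.
Let PK e m l := @P_fix _ _ _ _ tK tiK _ Kfar e m l.
Let Pfar m k x := @P_far _ _ _ _ tK tiK t_far m k x.
Let PP m x := @PP_braid _ _ _ _ tK tiK t_far t_br3 t_br40 m x.

Lemma Q_inj m : injective (Q m). Proof. exact: tw_inj tK _. Qed.

Lemma Pinv m e l : (m.+1 < l)%N -> (l <= r)%N -> P m (Ki e l) = Ki e l.
Proof. by move=> ml lr; apply: (am_fix_inv (PM m) (KV D e l) (VK D e l)); exact: PK. Qed.

Lemma PQ m i x : (m.+1 < i)%N -> (i <= r)%N -> Q i (P m x) = P m (Q i x).
Proof.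
move=> mi ir; apply/esym/(P_tw tK tiK t_far (s := Qw r i)).
by apply/allP => k /(mem_Qw ir); lia.
Qed.

(* Transported from m = 0 by the automorphism t_(m+2) t_(m+1). *)
Lemma serre_P e m : (m.+1 < r)%N -> let f := b e m.+1 in let p := P m (b (~~ e) m.+1) in
  p * f ^+ 2 - (v + v^-1) *: (f * p * f) + f ^+ 2 * p
  = - ((v + v^-1) * v *: (K e m.+1 * t m.+1 p)).
Proof.
elim: m => [|m IH] mr f p.
  rewrite /p /f /= (tb_01 S) -{2}(negbK e) (t1_b10 r_gt0 D tM S) // !negbK (b0E D (~~ e) e).
  apply: (@start_serre _ _ _ v0 _ _ _ _ ((v - v^-1)^-1 *: (K e 1 - K (~~ e) 1))).
  - exact: (gf_kap r_gt0 D mr).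
  - exact: (serre_10 r_gt0 D).
  - exact: (kap_b0 r_gt0 D).
  - exact: (kap_f r_gt0 D mr).
  - exact: (kap_g r_gt0 D mr).
  - exact: (Kb_k0 D).
  - exact: (Kb_mid r_gt0 D).
  - exact: (Kb_mid' r_gt0 D).
apply: (t_inj tK (k := m.+1)); apply: (t_inj tK (k := m.+2)).
have B y : t m.+2 (t m.+1 (t m.+2 y)) = t m.+1 (t m.+2 (t m.+1 y)) by rewrite t_br3.
rewrite !(amE (tM _)) B /p /f (P_shift tK tiK t_far bdn) // bdn // Kdn //.
by apply: IH; lia.
Qed.

(** [T_(m+1)] multiplies [p] by the quotient of [K e (m+1)] and [K (~~ e) (m+1)]; the form without
    inverses is transported from [m = 0] like [serre_P]. *)
Lemma t_P_K e m : (m.+1 < r)%N -> let p := P m (K (~~ e) m.+1) in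
  t m.+1 p * K (~~ e) m.+1 = p * K e m.+1.
Proof.
elim: m => [|m IH] mr p.
  rewrite /p /= (tK_01 S) !(amE (tM _)) (tK_mid S) // (t1_K0 D S mr (~~ e)) // negbK (K0E D (~~ e) e).
  nc v0 [:: Ki (~~ e) 1; K (~~ e) 1; K e 1; K e 0]
    (tt, VK D (~~ e) 1, KK D e 0 e 1, KK D e 0 (~~ e) 1, KK D e 1 (~~ e) 1).
apply: (t_inj tK (k := m.+1)); apply: (t_inj tK (k := m.+2)).
have B y : t m.+2 (t m.+1 (t m.+2 y)) = t m.+1 (t m.+2 (t m.+1 y)) by rewrite t_br3.
rewrite !(amE (tM _)) B /p (P_shift tK tiK t_far Kdn) // !Kdn //.
by apply: IH; lia.
Qed.

Lemma K_P_comm e e' m : (m.+1 < r)%N ->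
  K e' m.+1 * P m (K e m.+1) = P m (K e m.+1) * K e' m.+1.
Proof.
elim: m => [|m IH] mr.
  by rewrite /= (tK_01 S) mulrA (KK D e' _ e) -!mulrA (KK D e' _ e).
apply: (t_inj tK (k := m.+1)); apply: (t_inj tK (k := m.+2)).
rewrite !(amE (tM _)) (P_shift tK tiK t_far Kdn) // !Kdn //.
by apply: IH; lia.
Qed.

Section Fix.
Variables (e : bool) (m : nat).
Hypothesis mr : (m.+1 < r)%N.
Local Notation i := m.+1.
Local Notation l := m.+2.
Local Notation f := (b e i).
Local Notation p := (P m (b (~~ e) i)).
Local Notation pK := (P m (K (~~ e) i)).
Let ir : (0 < i < r)%N. Proof. lia. Qed.
Let ir' : (0 < i <= r)%N. Proof. lia. Qed.
Let lr : (0 < l <= r)%N. Proof. lia. Qed.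
Let il : (l == i.+1) || (l.+1 == i). Proof. lia. Qed.
Let l1 : (m.+1 < l)%N. Proof. lia. Qed.
Let l2 : (l <= r)%N. Proof. lia. Qed.
Let r1 : (1 < r)%N. Proof. lia. Qed.

(** [P_m] fixes [b_l] and may be inserted in front of it; [PP_braid] then brings [t_i] next to
    [b_l], and [PtP] turns [b_(tau i)] into [f]. *)
Lemma t_Pt_b : t i (P m (t i (b (~~ e) l))) = [P m (t i (b (~~ e) l)), f]_v.
Proof.
rewrite -{1}(Pb (~~ e) l1 l2) PP // (tb_adj S _ ir lr il).
rewrite !(am_qcomm (PM m), am_qcomm (tM i)) Pb //.
by rewrite PtPb // negbK (tb_adj S _ ir lr il) (am_qcomm (PM m)) Pb.
Qed.

(** The Serre relation of [B_i] and [B_l], both of sign [~~ e], transported by [P_m t_i P_m]. *)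
Lemma serre_Pt_b : let b' := P m (t i (b (~~ e) l)) in
  f ^+ 2 * b' - (v + v^-1) *: (f * b' * f) + b' * f ^+ 2 = 0.
Proof.
have := congr1 (fun x => P m (t i (P m x))) (serre_adj r_gt0 D (~~ e) (k := i) (l := l) ir' l2 il).
rewrite !(amE (PM m), amE (tM i)).
by rewrite PtPb // negbK Pb.
Qed.

Lemma t_Pt_K : t i (P m (t i (K (~~ e) l))) = - (v *: (P m (t i (K (~~ e) l)) * K e i)).
Proof.
rewrite -{1}(PK (~~ e) l1 l2) PP // (tK_adj S _ ir lr il).
rewrite !(amE (PM m), amE (tM i)) PK // !PtPK // negbK (tK_adj S _ ir lr il).
by rewrite !(amE (PM m)) PK.
Qed.

Lemma K_Pt_K : K e i * P m (t i (K (~~ e) l)) = P m (t i (K (~~ e) l)) * K e i.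
Proof.
have := congr1 (fun x => P m (t i (P m x))) (KK D (~~ e) i (~~ e) l).
by rewrite !(am_M (PM m), am_M (tM i)) PtPK // negbK PK.
Qed.

Section Inner.
Hypothesis lr' : (l < r)%N.
Let lmid : (0 < l < r)%N. Proof. lia. Qed.
Let li : (i == l.+1) || (i.+1 == l). Proof. lia. Qed.
Local Notation a := (Q l.+1 (b e l)).
Local Notation aK := (Q l.+1 (K e l)).

Lemma t_Q_b : t i a = [a, f]_v.
Proof.
rewrite -(Q_far t_far) // (tb_adj S _ ir lr il) (am_qcomm (QM _)).
by rewrite [Q l.+1 (b e i)](Q_fix_far bfar).
Qed.

Lemma serre_Q_b : f ^+ 2 * a - (v + v^-1) *: (f * a * f) + a * f ^+ 2 = 0.
Proof.
have := congr1 (Q l.+1) (serre_adj r_gt0 D e (k := i) (l := l) ir' l2 il).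
rewrite !(amE (QM _)).
by rewrite [Q l.+1 (b e i)](Q_fix_far bfar).
Qed.

Lemma t_Q_K : t i aK = - (v *: (aK * K e i)).
Proof.
rewrite -(Q_far t_far) // (tK_adj S _ ir lr il) !(amE (QM _)).
by rewrite [Q l.+1 (K e i)](Q_fix_far Kfar).
Qed.

(** After the injective [Q_l] the left side is [p] by [Q_Tp], and the right side is [P_m] of a
    commutator that [mid_adj] evaluates to [b (~~ e) i]. *)
Lemma Tp_b : Tp m f = [a, P m (t i (b (~~ e) l))]_v.
Proof.
apply: (@Q_inj l); rewrite QTpb // (am_qcomm (QM _)).
have -> : Q l a = t l (b (~~ e) l).
  by rewrite QS // (QtQ t_far t_br3 bup bdn bend).
have -> : Q l (P m (t i (b (~~ e) l))) = P m (t l (b (~~ e) i)).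
  by rewrite PQ // QS // bdn // (Q_fix_far bfar).
rewrite (tb_mid S _ lmid) (tb_adj S _ lmid ir' li) negbK.
rewrite -[b e l](Pb e l1 l2) -[Ki (~~ e) l](Pinv _ l1 l2).
rewrite -(am_M (PM m)) -(am_N (PM m)) -(am_qcomm (PM m)); congr (P m _).
by have := mid_adj r_gt0 D (~~ e) lmid ir' li; rewrite negbK => ->.
Qed.

Lemma Tp_K : Tp m (K e i) = - (v *: (aK * P m (t i (K (~~ e) l)))).
Proof.
apply: (@Q_inj l); rewrite QTpK // !(amE (QM _)).
have -> : Q l aK = t l (K (~~ e) l).
  by rewrite QS // (QtQ t_far t_br3 Kup Kdn Kend).
have -> : Q l (P m (t i (K (~~ e) l))) = P m (t l (K (~~ e) i)).
  by rewrite PQ // QS // Kdn // (Q_fix_far Kfar).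
rewrite (tK_mid S _ lmid) (tK_adj S _ lmid ir' li) !(amE (PM m)) (PK _ l1 l2).
have h := KK D (~~ e) l (~~ e) i.
have h' : P m (K (~~ e) i) * K (~~ e) l = K (~~ e) l * P m (K (~~ e) i).
  by rewrite -[K (~~ e) l](PK _ l1 l2) -!(am_M (PM m)) h.
nc v0 [:: Ki (~~ e) l; K (~~ e) l; pK] (tt, h', VK D (~~ e) l).
Qed.

Lemma t_Tp_b_inner : t i (Tp m f) = (v + v^-1)^-1 *: lusztig_op v f (Tp m f).
Proof.
rewrite Tp_b (lusztig_op_qcomm v0 serre_Q_b serre_Pt_b).
by rewrite scalerA mulVf ?v_add_neq0 // scale1r (am_qcomm (tM _)) t_Q_b t_Pt_b.
Qed.

Lemma t_Tp_K_inner : t i (Tp m (K e i)) = v ^+ 2 *: (Tp m (K e i) * K e i ^+ 2).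
Proof.
rewrite Tp_K !(amE (tM _)) t_Q_K t_Pt_K.
nc v0 [:: aK; P m (t i (K (~~ e) l)); K e i] (tt, K_Pt_K).
Qed.
End Inner.

Section Last.
Hypothesis er : l = r.

(** Here [Q_l] is [T_r], and the extra term is that of the preimage in [tr_b_q_inv], carried along
    by [P_m]. *)
Lemma Tp_b_last : Tp m f = [b e l, P m (t i (b (~~ e) l))]_v - v *: (K e l * p).
Proof.
have Z := tr_b_q_inv r_gt0 D tM S r1 (~~ e); rewrite negbK -er /= in Z.
apply: (@Q_inj l); rewrite QTpb //.
have -> y : Q l y = t l y by rewrite er Qr -er.
rewrite (tb_adj S _ ir lr il) -{1}(Pb e l1 l2) -(PK e l1 l2).
rewrite -(am_qcomm (PM m)) -(am_M (PM m)) -(am_Z (PM m)) -(am_B (PM m)) -Pfar //.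
by rewrite Z.
Qed.

Lemma Tp_K_last : Tp m (K e i) = v *: (K e l * K (~~ e) l * pK).
Proof.
have Z1 := tK_rr S; have Z2 := tK_r1 S (~~ e) r1; rewrite negbK -er /= in Z1 Z2.
apply: (@Q_inj l); rewrite QTpK //.
have -> y : Q l y = t l y by rewrite er Qr -er.
rewrite !(amE (tM _)) !Z1 negbK -Pfar // Z2 !(amE (PM m)) !(PK _ l1 l2).
have h : pK * K e l = K e l * pK.
  by rewrite -[K e l](PK _ l1 l2) -!(am_M (PM m)) (KK D e).
have h' : pK * K (~~ e) l = K (~~ e) l * pK.
  by rewrite -[K (~~ e) l](PK _ l1 l2) -!(am_M (PM m)) (KK D (~~ e) l).
nc v0 [:: Ki e l; K e l; Ki (~~ e) l; K (~~ e) l; pK]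
  (tt, h, h', VK D e l, VK D (~~ e) l, KK D (~~ e) l e l, KiK D (~~ e) l e l,
   esym (KiK D e l (~~ e) l), Ki_comm D (~~ e) l e l).
Qed.

(** The commutator is treated as in the inner case; on [K e l * p] the inhomogeneous relation
    [serre_P] makes Lusztig's operator agree with [T_i], up to [[2]]. *)
Lemma t_Tp_b_last : t i (Tp m f) = (v + v^-1)^-1 *: lusztig_op v f (Tp m f).
Proof.
have Lsub x y : lusztig_op v f (x - v *: y) = lusztig_op v f x - v *: lusztig_op v f y.
  by rewrite /lusztig_op; nc v0 [:: f; x; y] tt.
rewrite Tp_b_last Lsub (lusztig_op_qcomm v0 (serre_adj r_gt0 D e ir' l2 il) serre_Pt_b).
have Kf : K e l * f = v *: (f * K e l).
  by apply: (Kb_adj r_gt0 D) => //; lia.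
rewrite (lusztig_opKp v0 Kf (serre_P e mr)).
rewrite !(am_B (tM i), am_Z (tM i), am_qcomm (tM i)) t_Pt_b (tb_adj S _ ir lr il).
rewrite !(am_M (tM i)) (tK_adj S _ ir lr il).
rewrite [RHS]scalerBr; congr (_ - _); first by rewrite scalerA mulVf ?v_add_neq0 // scale1r.
rewrite mulNr -scalerAl -mulrA !scalerN !scalerA; congr (- (_ *: _)).
by rewrite -!mulrA [v * (_ * v)]mulrCA mulKf ?v_add_neq0.

Qed.

Lemma t_Tp_K_last : t i (Tp m (K e i)) = v ^+ 2 *: (Tp m (K e i) * K e i ^+ 2).
Proof.
rewrite Tp_K_last !(amE (tM _)) !(tK_adj S _ ir lr il).
have h := t_P_K e mr; have h' : t i pK = pK * K e i * Ki (~~ e) i.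
  by rewrite -h -mulrA (KV D) mulr1.
have c := KK D; have c1 := K_P_comm (~~ e) e mr; have c2 := K_P_comm (~~ e) (~~ e) mr.
rewrite h'.
nc v0 [:: K e l; K (~~ e) l; pK; K e i; K (~~ e) i; Ki (~~ e) i]
  (tt, c1, c2, c e i (~~ e) l, c (~~ e) i e i, KV D (~~ e) i).
Qed.
End Last.
End Fix.

Lemma t_Tp_b e m : (m.+1 < r)%N ->
  t m.+1 (Tp m (b e m.+1)) = (v + v^-1)^-1 *: lusztig_op v (b e m.+1) (Tp m (b e m.+1)).
Proof.
move=> mr; have [lr|lr] := ltnP m.+2 r; first exact: t_Tp_b_inner.
by apply: t_Tp_b_last => //; lia.
Qed.

Lemma t_Tp_K e m : (m.+1 < r)%N ->
  t m.+1 (Tp m (K e m.+1)) = v ^+ 2 *: (Tp m (K e m.+1) * K e m.+1 ^+ 2).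
Proof.
move=> mr; have [lr|lr] := ltnP m.+2 r; first exact: t_Tp_K_inner.
by apply: t_Tp_K_last => //; lia.
Qed.

Lemma TpM m : alg_morph (Tp m).
Proof.
apply: (@alg_morph_comp _ _ _ _ (iter m (c r t m.+1)) (G t m.+1 \o (t m.+1 \o Q m.+2))).
  by apply: alg_morph_iter; exact: twM.
by apply: alg_morph_comp; [exact: twM | apply: alg_morph_comp; [exact: tM | exact: QM]].
Qed.

Lemma Tp_Tp_b e m : (m.+1 < r)%N -> Tp m (Tp m (b e m.+1)) = b e m.+1.
Proof. exact: (Tp_Tp tK tiK t_far t_br3 t_br40 t_br4r bfar bup bdn bend bst br). Qed.

Lemma Tp_Tp_K e m : (m.+1 < r)%N -> Tp m (Tp m (K e m.+1)) = K e m.+1.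
Proof. exact: (Tp_Tp tK tiK t_far t_br3 t_br40 t_br4r Kfar Kup Kdn Kend Kst Kr). Qed.

Section Special.
(* Bh = T_theta^-1(B_0) and Kh = T_theta(K_0), with inverse Khi. *)
Variables (Bh Kh Khi : A).
Local Notation Sw := (tw t (iota 1 r.-1)).
Hypothesis SBh : Sw Bh = b true 0.
Hypothesis SKh : Sw Kh = K true 0.
Hypotheses (KhV : Kh * Khi = 1) (KhiV : Khi * Kh = 1).
(* T_(varpi_r) T_r^-1. *)
Local Notation g x := (iter r.-1 (c r t r.-1) (P r.-1 x)).

Let SM : alg_morph Sw := twM _.
(** Since [Sw] intertwines [P_(r-1)] with [T_0] and sends [Bh], [Kh] to [B_0], [K_0], the action of
    [P_(r-1)] is read off the formulas for [T_0]. *)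
Let SP x : Sw (P r.-1 x) = t 0 (Sw x).
Proof. exact: (SP tiK). Qed.

Lemma SKhi : Sw Khi = Ki true 0.
Proof.
rewrite -[LHS]mul1r -(VK D true 0) -mulrA -{1}SKh -(am_M SM) KhV (am_1 SM).
by rewrite mulr1.
Qed.

Lemma qcommA (x y z : A) : x * z = z * x -> [x, [y, z]_v]_v = [[x, y]_v, z]_v.
Proof. by move=> h; nc v0 [:: z; x; y] (tt, h). Qed.

(** The argument is an iterated v-commutator of [b_(j+1), ..., b_1]. Only the innermost entry [b_1]
    fails to commute with [B_0], so the bracket with [B_0] can be pulled outside. *)
Lemma t0_tw_b e j : (j < r)%N ->
  t 0 (tw t (iota 1 j) (b e j.+1)) = [tw t (iota 1 j) (b e j.+1), b true 0]_v.
Proof.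
elim: j => [|j IH] jr; first by rewrite /= (tb_01 S) (b0E D e true).
have F : all (fun k => (k <= r)%N && far k j.+2) (iota 1 j).
  by apply/allP => k; rewrite mem_iota /far; lia.
have E : tw t (iota 1 j.+1) (b e j.+2) = [b e j.+2, tw t (iota 1 j) (b e j.+1)]_v.
  rewrite iota_rcons tw_rcons add1n (tb_adj S); try lia.
  by rewrite (am_qcomm (twM _)) (tw_fix bfar _ jr F).
rewrite E (am_qcomm (tM 0)) IH; last lia.
rewrite (tb_far S) ?/far ?qcommA //; try lia.
by apply: (bb D) => //; rewrite /adj; case: (e) => /=; lia.
Qed.

Lemma t0_tw_K e j : (j < r)%N ->
  t 0 (tw t (iota 1 j) (K e j.+1)) = tw t (iota 1 j) (K e j.+1) * K true 0.
Proof.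
elim: j => [|j IH] jr; first by rewrite /= (tK_01 S) (K0E D e true).
have F : all (fun k => (k <= r)%N && far k j.+2) (iota 1 j).
  by apply/allP => k; rewrite mem_iota /far; lia.
have E : tw t (iota 1 j.+1) (K e j.+2) = - (v *: (K e j.+2 * tw t (iota 1 j) (K e j.+1))).
  rewrite iota_rcons tw_rcons add1n (tK_adj S); try lia.
  by rewrite !(amE (twM _)) (tw_fix Kfar _ jr F).
rewrite E !(amE (tM 0)) IH; last lia.
rewrite (tK_far S) ?/far //; try lia.
by rewrite mulNr -scalerAl mulrA.
Qed.

Let inj : injective Sw. Proof. exact: (tw_inj tK). Qed.

Lemma P_br e : P r.-1 (b e r) = [b e r, Bh]_v.
Proof.
apply: inj; rewrite SP (am_qcomm SM) SBh; have := @t0_tw_b e r.-1.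
by rewrite prednK //; apply; lia.
Qed.

Lemma P_Kr e : P r.-1 (K e r) = K e r * Kh.
Proof.
apply: inj; rewrite SP (am_M SM) SKh; have := @t0_tw_K e r.-1.
by rewrite prednK //; apply; lia.
Qed.

Lemma P_Bh : P r.-1 Bh = Khi * Bh.
Proof. by apply: inj; rewrite SP (am_M SM) SBh SKhi (tb_00 S). Qed.
Lemma P_Kh : P r.-1 Kh = Khi.
Proof. by apply: inj; rewrite SP SKh SKhi (tK_00 S). Qed.

(** For [r = 1] the exponent is 0, so fixing [x] is only asked for larger [r]. *)
Lemma iter_c_Sfix x : ((1 < r)%N -> c r t r.-1 x = x) -> iter r.-1 (c r t r.-1) x = x.
Proof.
case: (ltnP 1 r) => r1 h; last by rewrite (_ : r.-1 = 0)%N //; lia.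
by elim: {1}r.-1 => [|k IH] //; rewrite iterS IH h.
Qed.

Let cM : alg_morph (iter r.-1 (c r t r.-1)). Proof. by apply: alg_morph_iter; exact: twM. Qed.
Let c_br e : iter r.-1 (c r t r.-1) (b e r) = b e r.
Proof. by apply: (iter_c_fix bfar bup bdn br); lia. Qed.
Let c_Kr e : iter r.-1 (c r t r.-1) (K e r) = K e r.
Proof. by apply: (iter_c_fix Kfar Kup Kdn Kr); lia. Qed.
Let c_Bh : iter r.-1 (c r t r.-1) Bh = Bh.
Proof. by apply: iter_c_Sfix => r1; apply: (c_fix_S tK t_far t_br3 bfar b0 r1 SBh). Qed.
Let c_Kh : iter r.-1 (c r t r.-1) Kh = Kh.
Proof. by apply: iter_c_Sfix => r1; apply: (c_fix_S tK t_far t_br3 Kfar K0 r1 SKh). Qed.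
Let c_Khi : iter r.-1 (c r t r.-1) Khi = Khi.
Proof. exact: (am_fix_inv cM KhV KhiV c_Kh). Qed.

Lemma g_br e : g (b e r) = [b e r, Bh]_v.
Proof. by rewrite P_br (am_qcomm cM) c_br c_Bh. Qed.
Lemma g_Kr e : g (K e r) = K e r * Kh.
Proof. by rewrite P_Kr (am_M cM) c_Kr c_Kh. Qed.
Lemma g_Bh : g Bh = Khi * Bh.
Proof. by rewrite P_Bh (am_M cM) c_Khi c_Bh. Qed.
Lemma g_Kh : g Kh = Khi.
Proof. by rewrite P_Kh. Qed.

Local Notation kappa m := (tw t (rev (iota 1 m)) (K true 0)).

Lemma kappaS m : kappa m.+1 = t m.+1 (kappa m).
Proof. by rewrite iota_rcons rev_rcons. Qed.

Lemma kappa_far k m : (m.+1 < k)%N -> (k <= r)%N -> t k (kappa m) = kappa m.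
Proof.
move=> mk kr; rewrite -(tw_far t_far) // ?(tK_far S) //; first by rewrite /far; lia.
by apply/allP => j; rewrite mem_rev mem_iota /far; lia.
Qed.

(** [Bh] is defined by inverse symmetries but [Kh] by direct ones. As these squares act trivially
    along the way, [Sw Kh = K_0] holds in the same form as [Sw Bh = B_0]. *)
Lemma kappa_sq m : (m.+1 < r)%N -> t m.+1 (t m.+1 (kappa m)) = kappa m.
Proof.
elim: m => [|m IH] mr.
  exact: (t1_sq_K0 r_gt0 D tM S).
have E y : t m.+1 (t m.+2 (t m.+1 y)) = t m.+2 (t m.+1 (t m.+2 y)) by rewrite t_br3.
have F : t m.+2 (kappa m) = kappa m by apply: kappa_far; lia.
have mr' : (m.+1 < r)%N by lia.
by rewrite !kappaS -{1}F -!E (IH mr') F.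
Qed.

(** For [m = r - 2] this writes [Kh] through an element fixed by [T_r] and the two [K] of the orbit
    of [r - 1], on which [T_r] is known. *)
Lemma kappa_prod m : (m.+1 < r)%N ->
  kappa m.+1 = v ^+ 2 *: (kappa m * K true m.+1 * K false m.+1).
Proof.
elim: m => [|m IH] mr; first by rewrite /= (t1_K0 D S mr true).
rewrite (kappaS m.+1) [in RHS]IH ?[in LHS]IH; try lia.
rewrite !(amE (tM _)) kappa_far ?(tK_adj S); try lia.
nc v0 [:: kappa m; K true m.+1; K false m.+1; K true m.+2; K false m.+2]
  (tt, KK D true m.+2 false m.+1).
Qed.

Lemma tw_kappa m : (m < r)%N -> tw t (iota 1 m) (kappa m) = K true 0.
Proof.
elim: m => [|m IH] mr //; rewrite {1}iota_rcons tw_rcons kappaS add1n kappa_sq //.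
by apply: IH; lia.
Qed.

Lemma Kh_kappa : Kh = kappa r.-1.
Proof. by apply: inj; rewrite SKh tw_kappa //; lia. Qed.

Lemma tr_Kh : t r Kh = v ^+ 2 *: (Kh * (K true r * K false r) ^+ 2).
Proof.
case: (ltnP 1 r) => r1; last first.
  have E : r = 1%N by lia.
  by have := tK_r0 S true E; rewrite Kh_kappa E.
have [n E] : exists n, r.-1 = n.+1 by exists r.-2; lia.
have Z e := tK_r1 S e r1; rewrite E in Z.
rewrite Kh_kappa E kappa_prod; last lia.
rewrite !(amE (tM _)) !Z -[~~ true]/false -[~~ false]/true (kappa_far (k := r)) //; last lia.
nc v0 [:: kappa n; K true n.+1; K false n.+1; K true r; K false r]
  (tt, KK D true r false n.+1, KK D false r false n.+1, KK D false r true r).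
Qed.

(* Bh = [b, [b', B_0]_v]_v - v B_0 K_b, where U = t_1 .. t_(r-2) commutes with
   t_r and b, b', K_b are the images of B_(r-1), B_(r+2), K_(r-1) under U. *)
Section Bh_formula.
Hypothesis r1 : (1 < r)%N.
Local Notation q := r.-1.
Local Notation U := (tw t (iota 1 r.-2)).
Local Notation o := (b true 0).
Local Notation x := (b true r).
Local Notation y := (b false r).
Let UM : alg_morph U := twM _.
Let rM : r.-2.+1 = q. Proof. lia. Qed.
Let farU l : (q < l)%N -> all (fun k => (k <= r)%N && far k l) (iota 1 r.-2).
Proof. by move=> ql; apply/allP => k; rewrite mem_iota /far; lia. Qed.
Let Ub e : U (b e r) = b e r. Proof. by apply: (tw_fix bfar) => //; apply: farU; lia. Qed.
Let UK e : U (K e r) = K e r. Proof. by apply: (tw_fix Kfar) => //; apply: farU; lia. Qed.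
Let Ut z : t r (U z) = U (t r z).
Proof. by rewrite (tw_far t_far) //; apply: farU; lia. Qed.

(** Checked after [Sw]: [tw_iota2_fix] turns the images under [U] into [b_1] and [K_1], and what is
    left is the preimage of [B_0] under [T_1]. *)
Lemma Bh_U : Bh = [U (b true q), [U (b false q), o]_v]_v - v *: (o * U (K true q)).
Proof.
apply: inj; rewrite SBh -rM [iota 1 _.+1]/= [tw _ _ _]/= -/(tw _ _).
have o2 e : tw t (iota 2 r.-2) (b e 0) = b e 0.
  by apply: (tw_fix bfar) => //; apply/allP => k; rewrite mem_iota /far; lia.
rewrite !(amE (twM (iota 2 r.-2)), am_qcomm (twM (iota 2 r.-2))) o2.
rewrite !(tw_iota2_fix t_far bdn) ?(tw_iota2_fix t_far Kdn); try lia.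
by rewrite (t1_b0_inv r_gt0 D tM S r1 true).
Qed.

Lemma tr_U e : t r (U (b e q)) = [[U (b e q), b e r]_v, b (~~ e) r]_v - K e r * U (b e q).
Proof. by rewrite Ut (tb_r1 S) // !(amE UM, am_qcomm UM) !Ub UK. Qed.

Lemma tr_UK e : t r (U (K e q)) = v *: (U (K e q) * K e r * K (~~ e) r).
Proof. by rewrite Ut (tK_r1 S) // !(amE UM) !UK mulrA. Qed.

Lemma b_r0 e : o * b e r = b e r * o.
Proof. by apply: (bb D); rewrite /adj; case: (e); lia. Qed.

(* z behaves with respect to B_r and B_(r+1) as a neighbour of B_r only does. *)
Definition end_like e z := [/\ b (~~ e) r * z = z * b (~~ e) r,
  b e r ^+ 2 * z - (v + v^-1) *: (b e r * z * b e r) + z * b e r ^+ 2 = 0,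
  K e r * z = v *: (z * K e r) & K (~~ e) r * z = v^-1 *: (z * K (~~ e) r)].

Lemma end_like_U e : end_like e (U (b e q)).
Proof.
have rl := r_le r_gt0 r1; have ql := q_le r_gt0 r1; have rq := rq_adj' r_gt0 r1.
split.
- by rewrite -{1}Ub -(am_M UM) (b_rq_comm r_gt0 D r1) (am_M UM) Ub.
- have := congr1 U (serre_adj r_gt0 D e rl (leq_pred r) (rq_adj r_gt0 r1)).
  by rewrite !(amE UM) !Ub.
- by rewrite -{1}UK -(am_M UM) (Kb_adj r_gt0 D e rl ql rq) !(amE UM) UK.
- rewrite -{1}UK -(am_M UM); have := Kb_adj' r_gt0 D (~~ e) rl ql rq.
  by rewrite negbK => ->; rewrite !(amE UM) UK.
Qed.

(** With [w = B_0], the inner bracket of [Bh] may be used like a single generator next to the end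
    nodes. *)
Lemma end_like_qcomm e z w : (forall e', b e' r * w = w * b e' r) ->
  (forall e', K e' r * w = w * K e' r) -> end_like e z -> end_like e [z, w]_v.
Proof.
move=> bw Kw [h1 h2 h3 h4]; split.
- nc v0 [:: z; w; b (~~ e) r] (tt, h1, bw (~~ e)).
- nc v0 [:: z; w; b e r] (tt, serre_rule h2, bw e).
- nc v0 [:: z; w; K e r] (tt, h3, Kw e).
- nc v0 [:: z; w; K (~~ e) r] (tt, h4, Kw (~~ e)).
Qed.

Section EndLike.
Variables (e : bool) (z : A).
Hypothesis zE : end_like e z.
Local Notation M := ([[z, b e r]_v, b (~~ e) r]_v - K e r * z).

Lemma end_like_qcomm_b : [z, b e r]_v * b e r = v^-1 *: (b e r * [z, b e r]_v).
Proof. by case: zE => _ h _ _; nc v0 [:: b e r; z] (tt, serre_rule' h). Qed.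

Lemma end_like_M_y : M * b e r = b e r * M + v *: ([z, b e r]_v * K (~~ e) r).
Proof.
case: zE => h1 h2 h3 h4; apply: (end_M_y v0) => //.
- exact: (b_serre_r D).
- exact: (Kb_rr r_gt0 D).
- by have := Kb_rr' r_gt0 D (~~ e); rewrite negbK.
- exact: (Kb_rr' r_gt0 D).
- exact: (Kb_rr r_gt0 D).
- exact: v_add_neq0.
Qed.

Lemma end_like_M_x : M * b (~~ e) r = v^-1 *: (b (~~ e) r * M).
Proof.
case: zE => h1 h2 h3 h4; apply: (@end_M_x _ _ _ v0 _ _ _ (K (~~ e) r)) => //.
- by have := b_serre_r D (~~ e); rewrite negbK.
- exact: (Kb_rr r_gt0 D).
- by have := Kb_rr' r_gt0 D (~~ e); rewrite negbK.
- exact: (Kb_rr' r_gt0 D).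
- exact: (Kb_rr r_gt0 D).
Qed.
End EndLike.

Lemma tr_Bh_wide : t r Bh =
    v *: qcomm 1 (qcomm 1 [Bh, x]_v y) [y, x]_v
      - qcomm 1 Bh (qcomm (v ^+ 3) y x) * K true r + v *: (Bh * K true r * K false r).
Proof.
(* [c] is the bracket with [B_0]. As [B_0] commutes with [B_r], [B_(r+1)] and their [K], the element
   [N] of the identity is [T_r(c)]. *)
have Z := @big_identity _ _ _ v0 (U (b true q)) [U (b false q), o]_v o x y (K true r) (K false r) (U (K true q)).
have Kr0 e : K e r * o = o * K e r by apply: (Kb_k0 D).
have bE := end_like_U true.
have cE : end_like false [U (b false q), o]_v.
  by apply: end_like_qcomm (end_like_U false) => e //; rewrite b_r0.
rewrite [in RHS]Bh_U -Z.
- rewrite Bh_U !(am_B (tM _), am_Z (tM _), am_M (tM _), am_qcomm (tM _)) !tr_U tr_UK.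
  rewrite (tb_far S); try (rewrite /far; lia).
  congr ([_, _]_v - _); rewrite -[~~ false]/true.
  nc v0 [:: o; x; y; K false r; U (b false q)]
    (tt, esym (b_r0 true), esym (b_r0 false), Kr0 false).
- by case: bE.
- by case: cE.
- exact: b_r0.
- exact: b_r0.
- exact: end_like_qcomm_b bE.
- exact: end_like_qcomm_b cE.
- exact: end_like_M_y bE.
- exact: end_like_M_x bE.
- exact: end_like_M_y cE.
- exact: end_like_M_x cE.
- exact: (b_serre_r D true).
- exact: (b_serre_r D false).
- exact: (Kb_rr r_gt0 D).
- exact: (Kb_rr' r_gt0 D true).
- exact: (Kb_rr' r_gt0 D false).
- exact: (Kb_rr r_gt0 D).
- by case: bE.
- by case: bE.
- by case: cE.
- by case: cE.
- exact: Kr0.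
- exact: Kr0.
- have := congr1 U (Kb_adj r_gt0 D true (q_le r_gt0 r1) (r_le r_gt0 r1) (qr_adj' r_gt0 r1)).
  by rewrite !(amE UM) Ub.
- have := congr1 U (Kb_adj' r_gt0 D true (q_le r_gt0 r1) (r_le r_gt0 r1) (qr_adj' r_gt0 r1)).
  by rewrite !(amE UM) Ub.
- exact: (KK D).
- by have := congr1 U (KK D true q true r); rewrite !(am_M UM) UK.
- by have := congr1 U (KK D true q false r); rewrite !(am_M UM) UK.
Qed.
End Bh_formula.

Lemma tr_Bh : t r Bh =
    v *: qcomm 1 (qcomm 1 [Bh, b true r]_v (b false r)) [b false r, b true r]_v
      - qcomm 1 Bh (qcomm (v ^+ 3) (b false r) (b true r)) * K true r
      + v *: (Bh * K true r * K false r).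
Proof.
case: (ltnP 1 r) => r1; first exact: tr_Bh_wide.
have E : r = 1%N by lia.
have SB : Bh = b true 0 by rewrite -SBh E.
by rewrite SB; have := tb_r0 S true E; rewrite E.
Qed.
End Special.

End Node.

(** * Transport along the maps aleph *)

Lemma lusztig_opE (F : fieldType) (A : algType F) (x : F) (f u : A) (q := (x + x^-1)^-1) :
  x != 0 -> x + x^-1 != 0 -> q *: lusztig_op x f u
  = u * (q *: f ^+ 2) - x *: (f * u * f) + x ^+ 2 *: ((q *: f ^+ 2) * u).
Proof.
move=> x0 q0; have E : 1 + x ^+ 2 = (x + x^-1) * x by rewrite mulrDl mulVf // addrC expr2.
rewrite /lusztig_op E scalerDr scalerBr !scalerA mulKf // [q * x ^+ 2]mulrC.
by rewrite -scalerAr -scalerAl scalerA.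
Qed.

Lemma am_lusztig (F : fieldType) (U A : algType F) (f : U -> A) (x c : F) (x0 x1 : U) : alg_morph f ->
  f (x0 * (c *: x1 ^+ 2) - x *: (x1 * x0 * x1) + x ^+ 2 *: ((c *: x1 ^+ 2) * x0))
  = f x0 * (c *: f x1 ^+ 2) - x *: (f x1 * f x0 * f x1) + x ^+ 2 *: ((c *: f x1 ^+ 2) * f x0).
Proof. by move=> fM; rewrite !(amE fM). Qed.

Lemma aleph_lusztig (A : algType Qv) (f : Usl2 -> A) x0 x1 : alg_morph f ->
  f (lusztig_T1_0 x0 x1) = (v + v^-1)^-1 *: lusztig_op v (f x1) (f x0).
Proof.
move=> fM; rewrite (lusztig_opE _ _ v_neq0 v_add_neq0) -qnum2.
exact: (am_lusztig v (qnum 2)^-1 x0 x1 fM).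
Qed.

Section Aleph.
Variables (A : algType Qv) (r : nat) (b K Ki : bool -> nat -> A).
Hypothesis r_gt0 : (0 < r)%N.
Hypothesis D : iq_data r b K Ki.
Variables t ti : nat -> A -> A.
Hypothesis tM : forall k, alg_morph (t k).
Hypothesis S : iq_sym r b K Ki t.
Hypotheses (tK : forall k, cancel (t k) (ti k)) (tiK : forall k, cancel (ti k) (t k)).
Hypothesis t_far : forall k l x, (k <= r)%N -> (l <= r)%N -> far k l -> t k (t l x) = t l (t k x).
Hypothesis t_br3 : forall k x, (0 < k)%N -> (k.+1 < r)%N ->
  t k (t k.+1 (t k x)) = t k.+1 (t k (t k.+1 x)).
Hypothesis t_br40 : forall x, (1 < r)%N -> t 0 (t 1 (t 0 (t 1 x))) = t 1 (t 0 (t 1 (t 0 x))).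
Hypothesis t_br4r : forall x, (1 < r)%N ->
  t r.-1 (t r (t r.-1 (t r x))) = t r (t r.-1 (t r (t r.-1 x))).
Local Notation P := (P t ti).
Local Notation Tp := (Tp r t).

Section Lt.
Variable m : nat.
Hypothesis mr : (m.+1 < r)%N.
Local Notation i := m.+1.
Variable aleph : Usl2 -> A.
Hypothesis aM : alg_morph aleph.
Hypotheses (aF1 : aleph (sl2 (GF true)) = b true i) (aF0 : aleph (sl2 (GF false)) = Tp m (b true i))
  (aE1 : aleph (sl2 (GE true)) = b false i) (aE0 : aleph (sl2 (GE false)) = Tp m (b false i))
  (aK1 : aleph (sl2 (GK true)) = K true i) (aK'1 : aleph (sl2 (GK' true)) = K false i)
  (aK0 : aleph (sl2 (GK false)) = Tp m (K true i))
  (aK'0 : aleph (sl2 (GK' false)) = Tp m (K false i)).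
Variables T1 rho : Usl2 -> Usl2.
Hypotheses (T1M : alg_morph T1) (T1P : is_lusztig_T1 T1).
Hypotheses (rM : alg_morph rho) (rP : is_rho rho).

Let im : (0 < i < r)%N. Proof. lia. Qed.

Lemma aleph_Kinv1 : aleph (sl2 (GKinv true)) = Ki true i.
Proof. by apply: (am_inv_uniq aM (sl2_KV _) (sl2_VK _)); rewrite aK1 (KV D). Qed.
Lemma aleph_K'inv1 : aleph (sl2 (GK'inv true)) = Ki false i.
Proof. by apply: (am_inv_uniq aM (sl2_KV' _) (sl2_VK' _)); rewrite aK'1 (KV D). Qed.

(** Two morphisms compared on generators; those of index 1 are immediate, and those of index 0 are
    [t_Tp_b] and [t_Tp_K]. *)
Lemma t_aleph y : t i (aleph y) = aleph (T1 y).
Proof.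
case: T1P => -[hF1 hE1 hF0 hE0] [hK1 hK'1 hK0 hK'0].
pose f x := t i (aleph x); pose g x := aleph (T1 x).
suff : f =1 g by apply.
have Tb e := t_Tp_b r_gt0 D tM S tK tiK t_far t_br3 t_br40 t_br4r e mr.
have TK e := t_Tp_K r_gt0 D tM S tK tiK t_far t_br3 t_br40 t_br4r e mr.
apply: sl2_ext; rewrite /f /g.
- exact: (alg_morph_comp (tM i) aM).
- exact: (alg_morph_comp aM T1M).
- case.
    by rewrite aE1 (tb_mid S) // hE1 (am_N aM) (am_M aM) aleph_K'inv1 aF1.
  by rewrite aE0 Tb hE0 aleph_lusztig // aE1 aE0.
- case.
    by rewrite aF1 (tb_mid S) // hF1 (am_N aM) (am_M aM) aleph_Kinv1 aE1.
  by rewrite aF0 Tb hF0 aleph_lusztig // aF1 aF0.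
- case.
    by rewrite aK1 (tK_mid S) // hK1 (am_Z aM) aleph_Kinv1.
  by rewrite aK0 TK hK0 (am_Z aM) (am_M aM) (am_X aM) aK1 aK0.
- case.
    by rewrite aK'1 (tK_mid S) // hK'1 (am_Z aM) aleph_K'inv1.
  by rewrite aK'0 TK hK'0 (am_Z aM) (am_M aM) (am_X aM) aK'1 aK'0.
Qed.

(** By definition of aleph, [T_(varpi'_i)] sends the images of the generators of index 1 to those of
    index 0; it sends them back because its square fixes the former. *)
Lemma Tp_aleph y : Tp m (aleph y) = aleph (rho y).
Proof.
pose f x := Tp m (aleph x); pose g x := aleph (rho x).
suff : f =1 g by apply.
have Tb e := Tp_Tp_b r_gt0 D tM S tK tiK t_far t_br3 t_br40 t_br4r e mr.
have TK e := Tp_Tp_K r_gt0 D tM S tK tiK t_far t_br3 t_br40 t_br4r e mr.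
apply: sl2_ext; rewrite /f /g.
- by apply: (alg_morph_comp (f := Tp m)) => //; exact: TpM.
- exact: (alg_morph_comp aM rM).
- by move=> a; have [-> _ _ _] := rP a; case: a; rewrite /= ?aE1 ?aE0 ?Tb.
- by move=> a; have [_ -> _ _] := rP a; case: a; rewrite /= ?aF1 ?aF0 ?Tb.
- by move=> a; have [_ _ -> _] := rP a; case: a; rewrite /= ?aK1 ?aK0 ?TK.
- by move=> a; have [_ _ _ ->] := rP a; case: a; rewrite /= ?aK'1 ?aK'0 ?TK.
Qed.
End Lt.

Section Last.
Variables (Bh Kh Khi : A).
Hypothesis SBh : tw t (iota 1 r.-1) Bh = b true 0.
Hypothesis SKh : tw t (iota 1 r.-1) Kh = K true 0.
Hypotheses (KhV : Kh * Khi = 1) (KhiV : Khi * Kh = 1).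
Variables (A' : algType Qv) (b' K' Ki' : bool -> nat -> A').
Hypothesis D' : iq_data 1 b' K' Ki'.
Hypothesis ext : forall f g : A' -> A, alg_morph f -> alg_morph g ->
  (forall e k, (k <= 1)%N -> f (b' e k) = g (b' e k)) ->
  (forall e k, (k <= 1)%N -> f (K' e k) = g (K' e k)) -> f =1 g.
Variable aleph : A' -> A.
Hypothesis aM : alg_morph aleph.
Hypotheses (ab : forall e, aleph (b' e 1) = b e r) (ab0 : forall e, aleph (b' e 0) = Bh)
  (aK : forall e, aleph (K' e 1) = K e r) (aK0 : forall e, aleph (K' e 0) = Kh).
Variable t' : nat -> A' -> A'.
Hypotheses (t'M : forall k, alg_morph (t' k)) (S' : iq_sym 1 b' K' Ki' t').

Lemma aleph_Ki e : aleph (Ki' e 1) = Ki e r.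
Proof. by apply: (am_inv_uniq aM (KV D' e 1) (VK D' e 1)); rewrite aK (KV D). Qed.
Lemma aleph_Ki0 e : aleph (Ki' e 0) = Khi.
Proof. by apply: (am_inv_uniq aM (KV D' e 0) (VK D' e 0)); rewrite aK0. Qed.

Lemma aleph_ext (f g : A' -> A) : alg_morph f -> alg_morph g ->
  (forall e, f (b' e 0) = g (b' e 0)) -> (forall e, f (b' e 1) = g (b' e 1)) ->
  (forall e, f (K' e 0) = g (K' e 0)) -> (forall e, f (K' e 1) = g (K' e 1)) -> f =1 g.
Proof. by move=> fM gM h1 h2 h3 h4; apply: ext => // e [|[|k]]. Qed.

Lemma tr_aleph y : t r (aleph y) = aleph (t' 1 y).
Proof.
pose f x := t r (aleph x); pose g x := aleph (t' 1 x).
suff : f =1 g by apply.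
apply: aleph_ext; rewrite /f /g.
- exact: (alg_morph_comp (tM r) aM).
- exact: (alg_morph_comp aM (t'M 1)).
- move=> e; rewrite ab0 (tb_r0 S' e (erefl _)).
  rewrite !(amE aM, am_qcomm aM) !ab !ab0 !aK.
  exact: (tr_Bh r_gt0 D tM S tK t_far SBh).
- by move=> e; rewrite ab (tb_rr S') (tb_rr S) !(amE aM) ab aleph_Ki.
- move=> e; rewrite aK0 (tK_r0 S' e (erefl _)) !(amE aM) !aK aK0.
  exact: (tr_Kh r_gt0 D tM S tK t_far t_br3 SKh).
- by move=> e; rewrite aK (tK_rr S') (tK_rr S) !(amE aM) aleph_Ki.
Qed.

(** [T_(varpi_r) T_r^-1] corresponds to the rank one [T_0]; with [tr_aleph] this yields the product
    [T_0 T_1], the rank one [T_(varpi_1)]. *)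
Lemma g_aleph y : iter r.-1 (c r t r.-1) (P r.-1 (aleph y)) = aleph (t' 0 y).
Proof.
pose f x := iter r.-1 (c r t r.-1) (P r.-1 (aleph x)); pose g x := aleph (t' 0 x).
suff : f =1 g by apply.
apply: aleph_ext; rewrite /f /g.
- apply: (alg_morph_comp (f := iter r.-1 (c r t r.-1))); last exact: (alg_morph_comp (f := P r.-1) (PM tM tK tiK _) aM).
  by apply: alg_morph_iter; exact: twM.
- exact: (alg_morph_comp aM (t'M 0)).
- move=> e; rewrite ab0 (tb_00 S') !(amE aM) aleph_Ki0 ab0.
  exact: (g_Bh r_gt0 D tM S tK tiK t_far t_br3 SBh SKh KhV KhiV).
- move=> e; rewrite ab (tb_01 S') (am_qcomm aM) ab ab0.
  exact: (g_br r_gt0 D tM S tK tiK t_far t_br3 SBh).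
- move=> e; rewrite aK0 (tK_00 S') aleph_Ki0.
  exact: (g_Kh r_gt0 D tM S tK tiK t_far t_br3 SKh KhV KhiV).
- move=> e; rewrite aK (tK_01 S') !(amE aM) aK aK0.
  exact: (g_Kr r_gt0 D tM S tK tiK t_far t_br3 SKh).
Qed.
End Last.
End Aleph.

(** * Specialization to the iquantum group *)

Section Final.
Variable r : nat.
Hypothesis r_gt0 : (0 < r)%N.
Variable T : 'I_r.+1 -> algAut (Uiq r).
Hypothesis T_sym : forall i, is_symmetry i (T i).
Hypothesis T_braid : braid_relations T.
Variable Tw : 'M[int]_r.*2.+1 -> algAut (Uiq r).
Hypothesis TwP : is_Tw T Tw.

Let t k : Uiq r -> Uiq r := T (inord k).
Let ti k : Uiq r -> Uiq r := autV (T (inord k)).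

Let tM k : alg_morph (t k). Proof. exact: alg_morph_lr. Qed.
Let tK k : cancel (t k) (ti k). Proof. exact: autK. Qed.
Let tiK k : cancel (ti k) (t k). Proof. exact: autVK. Qed.
Let D := Uiq_data r_gt0.
Let S : iq_sym r (ub r) (uK r) (uKi r) t. Proof. exact: Uiq_sym. Qed.

Let inord_neq k l : (k <= r)%N -> (l <= r)%N -> k != l -> (inord k : 'I_r.+1) != inord l.
Proof. by move=> kr lr; rewrite -(inj_eq (@ord_inj _)) !inordK. Qed.

Let t_far k l x : (k <= r)%N -> (l <= r)%N -> far k l -> t k (t l x) = t l (t k x).
Proof.
suff H k' l' : (k' <= r)%N -> (l' <= r)%N -> (k'.+1 < l')%N -> t k' (t l' x) = t l' (t k' x).
  by move=> kr lr /orP[kl|lk]; [exact: H | apply/esym/H].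
move=> kr lr kl; have kl' : ((inord k' : 'I_r.+1).+1 < (inord l' : 'I_r.+1))%N by rewrite !inordK.
have [h1 h2] := pow2 r_gt0 kl'.
have ne : k' != l' by lia.
exact: (T_braid (inord_neq kr lr ne) (ltn0Sn _) h1 h2 x).
Qed.

Let t_br3 k x : (0 < k)%N -> (k.+1 < r)%N -> t k (t k.+1 (t k x)) = t k.+1 (t k (t k.+1 x)).
Proof.
move=> k0 kr; have [k1 k2 ne] : [/\ (k <= r)%N, (k.+1 <= r)%N & k != k.+1] by split; lia.
have [|||h1 h2] := @pow3 r r_gt0 (inord k) (inord k.+1); rewrite ?inordK //.
exact: (T_braid (inord_neq k1 k2 ne) (ltn0Sn _) h1 h2 x).
Qed.

Let t_br40 x : (1 < r)%N -> t 0 (t 1 (t 0 (t 1 x))) = t 1 (t 0 (t 1 (t 0 x))).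
Proof.
move=> r1; have [|||h1 h2] := @pow4_0 r r_gt0 (inord 0) (inord 1); rewrite ?inordK //.
exact: (T_braid (inord_neq (leq0n r) r_gt0 isT) (ltn0Sn _) h1 h2 x).
Qed.

Let t_br4r x : (1 < r)%N -> t r.-1 (t r (t r.-1 (t r x))) = t r (t r.-1 (t r (t r.-1 x))).
Proof.
move=> r1; have [k1 ne] : (r.-1 <= r)%N /\ r.-1 != r by split; lia.
have [|||h1 h2] := @pow4_r r r_gt0 (inord r.-1) (inord r); rewrite ?inordK //.
exact: (T_braid (inord_neq k1 (leqnn r) ne) (ltn0Sn _) h1 h2 x).
Qed.

Lemma Tword_ords s x : Tword T (ords r s) x = tw t s x.
Proof. by elim: s => //= k s ->. Qed.

Lemma tw_cpow i m x : tw t (cpow r i m) x = iter m (c r t i) x.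
Proof. by elim: m => //= m <-; rewrite /cpow /= tw_cat. Qed.

Lemma Tw_varpi (i : 'I_r.+1) x : (0 < i)%N -> Tw (varpi (node i)) x = iter i (c r t i) x.
Proof. by move=> i0; rewrite (TwP (reduced_varpi r_gt0 i0)) Tword_ords tw_cpow. Qed.

Lemma Tw_varpi' m x : (m.+1 < r)%N -> Tw (varpi' (nd r true m.+1)) x = Tp r t m x.
Proof.
move=> mr; have i0 : (0 < (inord m.+1 : 'I_r.+1) < r)%N by rewrite inordK //; lia.
rewrite (TwP (reduced_varpi' r_gt0 i0)) Tword_ords inordK; last lia.
rewrite /cpow' tw_cat tw_cpow -[tw t _ x]/(c r t m.+2 x) cE //.
by rewrite /Tp /G iota_rcons tw_rcons.
Qed.

Lemma inner_nodes (i : 'I_r.+1) (ir : (0 < i < r)%N)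
    (aleph : algIsoOnto Usl2 (subalg_gen (gens_lt Tw i))) (alephP : is_aleph_lt Tw i aleph)
    (T1 : algAut Usl2) (T1P : is_lusztig_T1 T1) (rho : algAut Usl2) (rhoP : is_rho rho)
    (x : Uiq r) : subalg_gen (gens_lt Tw i) x ->
  T i x = aleph (T1 (isoV aleph x)) /\ Tw (varpi (node i)) x = aleph (rho (T1 (isoV aleph x))).
Proof.
have [m em] : exists m, i = m.+1 :> nat by exists i.-1; rewrite prednK //; case/andP: ir.
have ei : i = inord m.+1 by apply: ord_inj; rewrite inordK -em //.
have mr : (m.+1 < r)%N by rewrite -em; case/andP: ir.
move=> /(isoVK aleph); move: (isoV aleph x) => y <-.
have i0 : (0 < i)%N by rewrite em.
have E z : T i z = t m.+1 z by rewrite ei.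
rewrite Tw_varpi // E em (iter_c_Tp t _ mr).
have B1 : B (node i) = ub r true m.+1 by rewrite ei.
have B2 : B (tau (node i)) = ub r false m.+1 by rewrite ei.
have K1 : K (node i) = uK r true m.+1 by rewrite ei.
have K2 : K (tau (node i)) = uK r false m.+1 by rewrite ei.
have ni : node i = nd r true m.+1 by rewrite ei.
have V z : Tw (varpi' (node i)) z = Tp r t m z by rewrite ni; exact: Tw_varpi'.
have aM : alg_morph aleph := alg_morph_lr aleph.
have rM : alg_morph rho := alg_morph_lr rho.
have T1M : alg_morph T1 := alg_morph_lr T1.
case: alephP => -[]; cbv beta zeta; rewrite !V B1 B2 K1 K2.
move=> aF1 aF0 aE1 aE0 [aK1 aK'1 aK0 aK'0].
have Et : t m.+1 (aleph y) = aleph (T1 y).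
  exact: (t_aleph r_gt0 D tM S tK tiK t_far t_br3 t_br40 t_br4r mr aM aF1 aF0 aE1 aE0
    aK1 aK'1 aK0 aK'0 T1M T1P).
rewrite Et; split=> //.
exact: (Tp_aleph r_gt0 D tM S tK tiK t_far t_br3 t_br40 t_br4r mr aM aF1 aF0 aE1 aE0
    aK1 aK'1 aK0 aK'0 rM rhoP).
Qed.

Lemma last_node (theta : 'M[int]_r.*2.+1)
    (thetaP : is_longest (fun i : 'I_r.+1 => (0 < i < r)%N) theta)
    (aleph : algIsoOnto (Uiq 1) (subalg_gen (gens_r Tw theta)))
    (alephP : is_aleph_r Tw theta aleph)
    (T' : 'I_2 -> algAut (Uiq 1)) (T'_sym : forall i, is_symmetry i (T' i))
    (x : Uiq r) : subalg_gen (gens_r Tw theta) x ->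
  T ord_max x = aleph (T' 1 (isoV aleph x)) /\
  Tw (varpi (node ord_max)) x = aleph (T' 0 (T' 1 (isoV aleph x))).
Proof.
have [/TwP th1 /TwP th2] := longest_theta r_gt0 thetaP.
have wl0 (f : bool -> nat -> Uiq r) e :
    (forall e k l, (k <= r)%N -> (l <= r)%N -> far k l -> t k (f e l) = f e l) ->
    tw t (wl 2 r.-2) (f e 0%N) = f e 0%N.
  move=> f_far; apply: (tw_fix f_far) => //.
  by apply/allP => k /(mem_wl r_gt0); rewrite /far; lia.
have bf := tb_far S; have Kf := tK_far S.
have b0 : B 0 = ub r true 0 by rewrite /ub nd0.
have K0 : K 0 = uK r true 0 by rewrite /uK nd0.
pose Bh := autV (Tw theta) (B 0); pose Kh := Tw theta (K 0); pose Khi := Tw theta (Kinv 0).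
(* Uses [theta1]: the block [wl 2 (r-2)] fixes [B_0], so by injectivity it cancels from
   [T_theta Bh = B_0]. *)
have SBh : tw t (iota 1 r.-1) Bh = ub r true 0.
  apply: (tw_inj tK (s := wl 2 r.-2)); rewrite (wl0 _ _ bf) -tw_cat -b0.
  by rewrite -[RHS](autVK (Tw theta)) th1 Tword_ords.
(* Uses [theta2]: the block acts first and fixes [K_0], which leaves [t_(r-1) .. t_1 K_0]. *)
have SKh : tw t (iota 1 r.-1) Kh = uK r true 0.
  rewrite /Kh th2 Tword_ords /theta2 tw_cat K0 (wl0 _ _ Kf).
  by apply: (tw_kappa r_gt0 D tM S t_far t_br3); lia.
have TwM : alg_morph (Tw theta) := alg_morph_lr (Tw theta).
have KhV : Kh * Khi = 1 by rewrite -(am_M TwM) iq_KV (am_1 TwM).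
have KhiV : Khi * Kh = 1 by rewrite -(am_M TwM) iq_VK (am_1 TwM).
move=> /(isoVK aleph); move: (isoV aleph x) => y <-.
have S' := Uiq_sym (ltn0Sn 0) T'_sym; have D' := Uiq_data (ltn0Sn 0).
have aM : alg_morph aleph := alg_morph_lr aleph.
have t'M k : alg_morph (T' (inord k)) := alg_morph_lr (T' (inord k)).
have om : (ord_max : 'I_r.+1) = inord r by apply: ord_inj; rewrite inordK.
have n0 e : nd 1 e 0 = inord 0 by apply: ord_inj; rewrite val_nd // inordK // orbT.
have nT : nd 1 true 1 = inord 1 by apply: ord_inj; rewrite val_nd // inordK.
have nF : nd 1 false 1 = inord 2 by apply: ord_inj; rewrite val_nd // inordK.
case: alephP => -[]; rewrite om /= => aB1 aB2 aB0 [aK1 aK2 aK0].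
have ab e : aleph (ub 1 e 1) = ub r e r by case: e; rewrite /ub ?nT ?nF.
have aK e : aleph (uK 1 e 1) = uK r e r by case: e; rewrite /uK ?nT ?nF.
have ab0 e : aleph (ub 1 e 0) = Bh by rewrite /ub n0.
have aK0' e : aleph (uK 1 e 0) = Kh by rewrite /uK n0.
have ext (f g : Uiq 1 -> Uiq r) : alg_morph f -> alg_morph g ->
    (forall e k, (k <= 1)%N -> f (ub 1 e k) = g (ub 1 e k)) ->
    (forall e k, (k <= 1)%N -> f (uK 1 e k) = g (uK 1 e k)) -> f =1 g.
  move=> fM gM h1 h2; apply: Uiq_ext => // j;
    have [e [k [k1 ->]]] := nd_surj (ltn0Sn 0) j; [exact: h1 | exact: h2].
have T1E : T' 1 = T' (inord 1) by congr T'; apply: ord_inj; rewrite inordK.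
have T0E : T' 0 = T' (inord 0) by congr T'; apply: ord_inj; rewrite inordK.
have Et : t r (aleph y) = aleph (T' (inord 1) y).
  exact: (tr_aleph r_gt0 D tM S tK t_far t_br3 SBh SKh D' ext aM ab ab0 aK aK0' t'M S').
rewrite T1E T0E -[T _ _]/(t r (aleph y)); split=> //.
rewrite -om Tw_varpi // [nat_of_ord _]/= (iter_cr tiK t_far t_br3) // Et.
exact: (g_aleph r_gt0 D tM S tK tiK t_far t_br3 SBh SKh KhV KhiV D' ext aM ab ab0 aK aK0' t'M S').
Qed.
End Final.

Theorem proposition3p8 (r : nat) (r_gt0 : (0 < r)%N)
    (T : 'I_r.+1 -> algAut (Uiq r))
    (T_sym : forall i, is_symmetry i (T i))
    (T_braid : braid_relations T)
    (Tw : 'M[int]_r.*2.+1 -> algAut (Uiq r))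
    (TwP : is_Tw T Tw) :
  (forall (i : 'I_r.+1), (0 < i < r)%N ->
    forall (aleph : algIsoOnto Usl2 (subalg_gen (gens_lt Tw i)))
           (alephP : is_aleph_lt Tw i aleph)
           (T1 : algAut Usl2) (T1P : is_lusztig_T1 T1)
           (rho : algAut Usl2) (rhoP : is_rho rho)
           (x : Uiq r), subalg_gen (gens_lt Tw i) x ->
      T i x = aleph (T1 (isoV aleph x)) /\
      Tw (varpi (node i)) x = aleph (rho (T1 (isoV aleph x))))
  /\
  (forall (theta : 'M[int]_r.*2.+1)
      (thetaP : is_longest (fun i : 'I_r.+1 => (0 < i < r)%N) theta)
      (aleph : algIsoOnto (Uiq 1) (subalg_gen (gens_r Tw theta)))
      (alephP : is_aleph_r Tw theta aleph)
      (T' : 'I_2 -> algAut (Uiq 1)) (T'_sym : forall i, is_symmetry i (T' i))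
      (x : Uiq r), subalg_gen (gens_r Tw theta) x ->
      T ord_max x = aleph (T' 1 (isoV aleph x)) /\
      Tw (varpi (node ord_max)) x = aleph (T' 0 (T' 1 (isoV aleph x)))).
Proof.
by split=> *; [apply: inner_nodes | apply: last_node].
Qed.
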